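(* Let $d\ge1$ and let $\Omega\in\{\mathbb{R}^d,\mathbb{T}^d\}$. Let $\rho,\mu\in\mathcal{P}(\Omega)$, and suppose that $(\rho-\mu)^+$ is absolutely continuous with respect to Lebesgue measure on $\Omega$. Let $h\in W^{1,1}_{\mathrm{loc}}(\Omega)$ be a corresponding distributional Coulomb potential, so that $$\Delta h=\mu-\rho\quad\text{in }\mathcal{D}'(\Omega).$$ Assume that $$\nabla h=0\quad\text{almost everywhere with respect to }(\rho-\mu)^+.$$ Then $\rho=\mu$.
   Context: $\mathcal{P}(\Omega)$ is the set of Borel probability measures on $\Omega$; $\mathbb{T}^d$ is the flat torus, identified with $(-\frac12,\frac12)^d$ with periodic boundary conditions. $(\rho-\mu)^+$ denotes the positive part in the Jordan decomposition of the finite signed measure $\rho-\mu$. Since $(\rho-\mu)^+$ is absolutely continuous, the condition $\nabla h=0$ $(\rho-\mu)^+$-a.e. does not depend on the Lebesgue representative of $\nabla h$. *)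

(* Defs.v *)
From HB Require Import structures.
From mathcomp Require Import all_boot all_order all_algebra.
From mathcomp Require Import all_classical all_reals all_analysis.
Import Order.TTheory GRing.Theory Num.Theory.
Import numFieldNormedType.Exports.

Set Implicit Arguments.
Unset Strict Implicit.
Unset Printing Implicit Defensive.

Local Open Scope classical_set_scope.
Local Open Scope ring_scope.

(* R^d with its Borel sigma-algebra. *)
Notation Rn R d := (g_sigma_algebraType (@open 'rV[R]_d)).

Section borel_rV.
Context {R : realType}.

Lemma open_measurable_rV (d : nat) (U : set 'rV[R]_d) :
  open U -> measurable (U : set (Rn R d)).
Proof. by move=> oU; exact: sub_sigma_algebra. Qed.

Lemma measurable_coord (d : nat) (i : 'I_d) :
  measurable_fun [set: Rn R d]
    ((fun v => (v : 'rV[R]_d) 0 i) : Rn R d -> measurableTypeR R).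
Proof.
apply: (measurability _ (measurable_realfun.RGenOpens.measurableE R)) => _ [_ [a [b ->] <-]].
rewrite setTI; apply: open_measurable_rV.
apply: open_comp; last exact: interval_open.
by move=> v _; exact: coord_continuous.
Qed.

Lemma measurable_fun_rV (dT : measure_display) (T : measurableType dT)
    (d : nat) (f : T -> Rn R d) :
  (forall i, measurable_fun [set: T]
     ((fun t => (f t : 'rV[R]_d) 0 i) : T -> measurableTypeR R)) ->
  measurable_fun [set: T] f.
Proof.
move=> mf; apply: (@measurability _ _ T (Rn R d) _ _ (@open 'rV[R]_d) erefl).
move=> _ [U oU <-]; rewrite setTI.
pose box (p : 'rV[rat]_d * nat) : set 'rV[R]_d :=
  [set y | forall i, ball (ratr (p.1 0 i) : R) p.2.+1%:R^-1 (y 0 i)].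
pose D : set ('rV[rat]_d * nat) := [set p | box p `<=` U].
have -> : f @^-1` U = \bigcup_(p in D) (f @^-1` box p).
  apply/seteqP; split => [t /= Uft|t [p Dp]]; last exact: Dp.
  have /nbhs_ballP[e /= e0 eU] : nbhs (f t : 'rV[R]_d) U.
    by move: oU; rewrite openE; apply.
  have e20 : 0 < e / 2 by rewrite divr_gt0.
  have [n ne] : exists n : nat, n.+1%:R^-1 < e / 2.
    by have [n _ /(_ n (leqnn _))] := near_infty_natSinv_lt (PosNum e20); exists n.
  have n0 : 0 < n.+1%:R^-1 :> R by rewrite invr_gt0.
  have qP i : exists q : rat, ball (ratr q : R) n.+1%:R^-1 ((f t : 'rV_d) 0 i).
    have /rat_in_itvoo[q] : (f t : 'rV_d) 0 i - n.+1%:R^-1 <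
        (f t : 'rV_d) 0 i + n.+1%:R^-1.
      by rewrite ltrBlDr -addrA ltrDl addr_gt0.
    rewrite in_itv/= => /andP[q1 q2]; exists q.
    by rewrite /ball/= ltr_distl q1 q2.
  exists (\row_i sval (cid (qP i)), n) => /=.
    move=> y yb; apply: eU; split => // j i; rewrite !ord1.
    move: (yb i); rewrite /= mxE; case: cid => q /= ftq qy.
    rewrite (splitr e); apply: (@ball_triangle _ _ (ratr q : R)).
      by apply/ball_sym; exact: (le_ball (ltW ne)).
    exact: (le_ball (ltW ne)).
  by move=> i /=; rewrite mxE; case: cid.
rewrite bigcup_mkcond; apply: countable_bigcupT_measurable => // p.
case: ifPn => // _.
have -> : f @^-1` box p = \bigcap_(i in [set: 'I_d])
    ((fun t => (f t : 'rV_d) 0 i) @^-1` ball (ratr (p.1 0 i) : R) p.2.+1%:R^-1).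
  by apply/seteqP; split => [t h i _|t h i]; apply: h.
apply: fin_bigcap_measurable => // i _.
rewrite -[X in measurable X]setTI; apply: mf => //.
exact: measurable_realfun.measurable_ball.
Qed.

End borel_rV.

Section lebesgue_rV.
Context {R : realType}.

Definition cons_rV (d : nat) (p : Rn R d * measurableTypeR R) : Rn R d.+1 :=
  \row_(i < d.+1) if unlift ord0 i is Some j then (p.1 : 'rV_d) 0 j else p.2.

Lemma measurable_cons_rV (d : nat) :
  measurable_fun [set: Rn R d * measurableTypeR R] (@cons_rV d).
Proof.
apply: measurable_fun_rV => i; rewrite /cons_rV.
case: (unliftP ord0 i) => [j ij|i0].
- rewrite (_ : (fun _ => _) = (fun v : Rn R d => (v : 'rV_d) 0 j) \o fst).
    exact: (measurableT_comp (measurable_coord j) measurable_fst).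
  by apply/funext => t; rewrite mxE ij liftK.
- rewrite (_ : (fun _ => _) = snd); first exact: measurable_snd.
  by apply/funext => t; rewrite mxE i0 unlift_none.
Qed.

Section add_coordinate.
Variables (d : nat) (m : {measure set (Rn R d) -> \bar R}).

Definition add_coordinate : set (Rn R d.+1) -> \bar R :=
  pushforward (m \x @lebesgue_measure R)%E (@cons_rV d).

Let mcons := @measurable_cons_rV d.

Let add_coordinate0 : add_coordinate set0 = 0%E.
Proof. by rewrite /add_coordinate measure0. Qed.

Let add_coordinate_ge0 A : (0 <= add_coordinate A)%E.
Proof. exact: measure_ge0. Qed.

Let add_coordinate_sigma_additive : semi_sigma_additive add_coordinate.
Proof. exact: measure_semi_sigma_additive. Qed.

HB.instance Definition _ := isMeasure.Build _ _ _ add_coordinate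
  add_coordinate0 add_coordinate_ge0 add_coordinate_sigma_additive.

End add_coordinate.

(* Lebesgue measure on R^0 is the unit mass at its only point. *)
Fixpoint lebesgue_rV (d : nat) : {measure set (Rn R d) -> \bar R} :=
  match d with
  | 0 => @dirac _ (Rn R 0) (0 : 'rV[R]_0) R
  | d'.+1 => add_coordinate (lebesgue_rV d')
  end.

Lemma lebesgue_rV_box (d : nat) (A : 'I_d -> set (measurableTypeR R)) :
  (forall i, measurable (A i)) ->
  lebesgue_rV d [set x : 'rV[R]_d | forall i, A i (x 0 i)] =
  (\prod_(i < d) lebesgue_measure (A i))%E.
Proof.
elim: d A => [A _|d IH A mA].
  rewrite big_ord0 /= diracE mem_set//.
  by case.
have mB : measurable ([set x : 'rV[R]_d | forall i, A (lift ord0 i) (x 0 i)] : set (Rn R d)).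
  rewrite (_ : [set x | _] = \bigcap_(i in [set: 'I_d])
    ((fun x : Rn R d => (x : 'rV_d) 0 i) @^-1` A (lift ord0 i))).
    apply: fin_bigcap_measurable => // i _.
    by rewrite -[X in measurable X]setTI; apply: measurable_coord.
  by apply/seteqP; split => [t h i _|t h i]; apply: h.
rewrite big_ord_recl muleC -IH//= -product_measure1E//.
rewrite /add_coordinate /pushforward; congr (_ _).
apply/seteqP; split => [[x y] /= h|[x y] /= [h1 h2] i].
- split => [i|]; first by have := h (lift ord0 i); rewrite mxE liftK.
  by have := h ord0; rewrite mxE unlift_none.
- by rewrite mxE; case: unliftP => [j ->|->].
Qed.

End lebesgue_rV.

(* The flat torus is represented by the half-open cube, which contains exactly
   one point of each class modulo Z^d. Its Borel sigma-algebra is the trace of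
   that of R^d, so Borel probability measures on the torus are the Borel
   probability measures on R^d giving mass 1 to the cube, and functions on the
   torus are functions on the cube or, equivalently, Z^d-periodic functions. *)
Inductive ambient := Euclidean | Torus.

Definition carrier {R : realType} {d : nat} (Omega : ambient) : set (Rn R d) :=
  match Omega with
  | Euclidean => setT
  | Torus => [set x | forall i, - 2^-1 <= (x : 'rV[R]_d) 0 i < 2^-1]
  end.

Section test_functions.
Context {R : realType} {d : nat}.
Implicit Types (phi : 'rV[R]_d -> R) (i : 'I_d).

Definition partial i phi : 'rV[R]_d -> R :=
  fun x => 'D_'e_i phi x.

Definition laplacian phi : 'rV[R]_d -> R :=
  fun x => \sum_(i < d) partial i (partial i phi) x.

Definition smooth phi : Prop :=
  forall s : seq 'I_d, let psi := foldr partial phi s in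
    continuous psi /\ forall i x, derivable psi x 'e_i.

Definition compactly_supported phi : Prop :=
  compact (closure [set x | phi x != 0]).

Definition Zd_periodic phi : Prop :=
  forall i x, phi (x + 'e_i) = phi x.

Definition test_function (Omega : ambient) phi : Prop :=
  smooth phi /\
  match Omega with
  | Euclidean => compactly_supported phi
  | Torus => Zd_periodic phi
  end.

End test_functions.

Section potentials.
Context {R : realType} {d : nat}.
Implicit Types (Omega : ambient) (h : Rn R d -> R) (g : Rn R d -> 'rV[R]_d).
Implicit Types rho mu : probability (Rn R d) R.

(* On the torus this is integrability over the whole cube, as it should be on
   a compact space. *)
Definition locally_integrable_on Omega h : Prop :=
  forall K : set 'rV[R]_d, compact K ->
    (lebesgue_rV d).-integrable (carrier Omega `&` K) (EFin \o h).

Definition is_weak_gradient Omega h g : Prop :=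
  forall i, locally_integrable_on Omega (fun x => g x 0 i) /\
    forall phi, test_function Omega phi ->
      \int[lebesgue_rV d]_(x in carrier Omega) (h x * partial i phi x) =
      - \int[lebesgue_rV d]_(x in carrier Omega) (g x 0 i * phi x).

Definition W11loc Omega h : Prop :=
  locally_integrable_on Omega h /\ exists g, is_weak_gradient Omega h g.

(* Delta h = mu - rho in the sense of distributions on Omega. *)
Definition coulomb_potential Omega rho mu h : Prop :=
  forall phi, test_function Omega phi ->
    \int[lebesgue_rV d]_(x in carrier Omega) (h x * laplacian phi x) =
    \int[mu]_(x in carrier Omega) phi x -
    \int[rho]_(x in carrier Omega) phi x.

End potentials.

Section positive_part.
Context {dT : measure_display} {T : measurableType dT} {R : realType}.

Definition charge_diff (m1 m2 : {finite_measure set T -> \bar R}) :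
    {charge set T -> \bar R} :=
  cadd (charge_of_finite_measure m1) (copp (charge_of_finite_measure m2)).

(* The result does not depend on the chosen Hahn decomposition, see
   Hahn_decomposition_uniq. *)
Definition positive_part (nu : {charge set T -> \bar R}) :
    {finite_measure set T -> \bar R} :=
  jordan_pos (svalP (cid (svalP (cid (Hahn_decomposition nu))))).

End positive_part.

(* Main.v *)
From HB Require Import structures.
Require Import Defs.
From mathcomp Require Import all_boot all_order all_algebra.
From mathcomp Require Import all_classical all_reals all_analysis.
From mathcomp Require Import measurable_realfun.
From mathcomp Require Import ring lra.
Import Order.TTheory GRing.Theory Num.Theory.
Import numFieldNormedType.Exports.

Set Implicit Arguments.
Unset Strict Implicit.
Unset Printing Implicit Defensive.

Local Open Scope classical_set_scope.
Local Open Scope ring_scope.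

(** Write nu = rho - mu, with positive part np and negative part nm, and let g
    be the gradient of h, so that - div g = nu in the sense of distributions
    and g = 0 np-almost everywhere. Suppose that np charges the open set U (the
    whole space, or the open unit cube for the torus).

    The idea is that near a typical point of np the measure nu looks like c dx
    with c > 0, so that - div g = c there, whereas g vanishes on almost all of
    the ball; no field can do both. The equation is only known for measures, so
    this is made quantitative with elementary means.

    By Radon-Nikodym and inner regularity (near_constant_density) there are
    c > 0 and a compact set K of positive Lebesgue measure, contained in U and
    in a positive Hahn set of nu, on which g = 0 and on which the density of np
    is c up to a small relative error. Then nu - c dx is dominated by a finite
    measure lam that gives K a small multiple of c |K| (comparison_measures),
    and a covering argument (covering_bound, concentration_point) yields x0 in
    K with lam (B_s(x0)) <= kappa c s^d at all small scales s, where kappa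
    depends on the dimension only.

    Let G_i(s, x) be the average of g_i at scale s around x, with a smooth
    kernel eta. There is a compactly supported zeta whose Laplacian is eta at
    scale 1/2 minus eta at scale 1 (kernels), so the equation of h expresses
    G_i(s/2, x) - G_i(s, x) as the integral against nu of a derivative of zeta
    at scale s. Changing scale therefore costs no derivative of g, and two
    opposite estimates follow from sums over dyadic scales.
    - Lower bound (mollified_difference_ge): for x in B_r(x0) the sum over i of
      G_i(r, x - r e_i) - G_i(r, x + r e_i) is at least a constant times c r.
      At a fixed large scale this is the equation itself, up to O(r^2); going
      down to scale r is a sum of second differences, controlled by lam.
    - Upper bound (mollified_boundP, integral_mollified_bound): going from
      scale r down to a tiny scale e, the function |G_i(r, .)| on the
      intersection of K with B_{2r}(x0) is at most a function of integral
      O(kappa c r^{d+1}) plus the averages of |g_i| over balls of radius 2 e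
      around points of K. As g_i = 0 on K, the latter only see the thin set of
      points close to K and outside of it, and tend to 0 with e.
    Since K fills most of B_{2r}(x0), the points x whose 2d neighbours
    x - r e_i, x + r e_i all lie in K fill at least half of B_r(x0)
    (leb_cross_ge); integrating the two bounds over them is contradictory for
    small kappa (no_density_point).

    Hence np U = 0 (positive_part_vanishes). What U misses is negligible for
    np, so rho <= mu, and two probability measures that are so ordered are
    equal. On the torus the test functions are the periodizations of functions
    supported in the open cube (test_function_extension).

    Norms and balls in R^d are those of the sup norm, so that a ball of radius
    r has volume (2r)^d. *)

(** * Flat functions of one variable and radial profiles *)

Section one_variable.
Context {R : realType}.
Implicit Types (f : R -> R) (a q : R).

(** A function squeezed between two parabolas has derivative 0 at their common vertex;
    this is how flat and powcumul are differentiated at the origin. *)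
Lemma is_derive_flat0 f (C : R) : f 0 = 0 ->
  (forall h, `|h| < 1 -> `|f h| <= C * h ^+ 2) -> is_derive (0 : R) 1 f 0.
Proof.
move=> f0 fC.
have C0 : 0 <= C.
  have h2 : `|2^-1 : R| < 1 by rewrite ger0_norm ?invr_ge0// invf_lt1 ?ltr1n.
  have := le_trans (normr_ge0 _) (fC _ h2).
  by rewrite pmulr_lge0// exprn_gt0// invr_gt0.
have lim0 : (h^-1 *: (f (h *: (1 : R) + 0) - f 0)) @[h --> (0:R)^'] --> (0 : R).
  apply/cvgrPdist_le => e e0; rewrite /=; near=> h.
  have h0 : h != 0 by near: h; exact: nbhs_dnbhs_neq.
  have h1 : `|h| < 1.
    by near: h; apply: dnbhs0_lt.
  have he : `|h| < e / (C + 1).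
    by near: h; apply: dnbhs0_lt; rewrite divr_gt0// ltr_wpDl.
  rewrite sub0r normrN addr0 f0 subr0 /GRing.scale/= mulr1 normrM normfV.
  rewrite ler_pdivrMl ?normr_gt0//.
  apply: (le_trans (fC _ h1)).
  rewrite -(real_normK (num_real h)) expr2 mulrCA ler_wpM2l//.
  move/ltW: he; rewrite ler_pdivlMr ?ltr_wpDl// mulrDr mulr1.
  by rewrite mulrC; apply: le_trans; rewrite lerDl.
apply: DeriveDef; first by apply/cvg_ex; exists 0.
exact/cvg_lim.
Unshelve. all: by end_near. Qed.

(** The factor q^a makes this family of flat functions closed under differentiation.
    *)
Definition flat a q : R := if 0 < q then expR (a * ln q - q^-1) else 0.

Lemma flat_le0 a q : q <= 0 -> flat a q = 0.
Proof. by rewrite leNgt /flat => /negbTE ->. Qed.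

Lemma flat_ge0 a q : 0 <= flat a q.
Proof. by rewrite /flat; case: ifP => // _; exact: expR_ge0. Qed.

Lemma flat_gt0 a q : 0 < q -> 0 < flat a q.
Proof. by rewrite /flat => ->; exact: expR_gt0. Qed.

Lemma flat_mul_id a q : flat (a + 1) q = q * flat a q.
Proof.
rewrite /flat; case: ifP => [q0|]; last by rewrite mulr0.
by rewrite -{3}(lnK q0) -expRD; congr expR; lra.
Qed.

(** The inequality ln x <= x - 1, applied to 1 / (k q), shows that the exponential
    beats the power; only a quadratic bound is needed, in order to differentiate at 0.
    *)
Lemma flat_small a : exists C : R, forall h, h < 1 -> flat a h <= C * h ^+ 2.
Proof.
pose k := `|2 - a| + 1 : R.
have k0 : 0 < k by rewrite ltr_wpDl.
exists (expR (k * ln k - k)) => h h1.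
rewrite /flat; case: ifPn => [h0|_]; last by rewrite mulr_ge0 ?expR_ge0 ?sqr_ge0.
have -> : h ^+ 2 = expR (2 * ln h) by rewrite -{1}(lnK h0) -expRM_natl.
rewrite -expRD ler_expR.
have lh : ln h <= 0 by rewrite ln_le0 // ltW.
have lnu : - ln h <= h^-1 / k - 1 + ln k.
  have : ln (1 + (h^-1 / k - 1)) <= h^-1 / k - 1.
    by apply: le_ln1Dx; rewrite -subr_gt0 opprK addrC addrCA subrr addr0 divr_gt0// invr_gt0.
  by rewrite [1 + _]addrC subrK ln_div ?posrE ?invr_gt0// lnV ?posrE// lerBlDr.
have lk : - ln h * k <= (h^-1 / k - 1 + ln k) * k by rewrite ler_pM2r.
rewrite mulrDl mulrBl divfK ?gt_eqF// mul1r in lk.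
have : `|2 - a| * ln h <= (2 - a) * ln h.
  rewrite -subr_ge0 -mulrBl.
  by apply: mulr_le0 => //; rewrite subr_le0 ler_norm.
move: lk; rewrite /k; lra.
Qed.

Lemma is_derive_flat a q : is_derive q (1 : R) (flat a) (a * flat (a - 1) q + flat (a - 2) q).
Proof.
have [q0|q0|->] := ltgtP q 0.
- rewrite !flat_le0 ?ltW// mulr0 addr0.
  apply: (@near_eq_is_derive _ _ _ (cst 0)).
  by near=> x; rewrite flat_le0// ltW//; near: x; exact: lt_nbhsl.
- apply: (@near_eq_is_derive _ _ _ (fun q => expR (a * ln q - q^-1))).
    by near=> x; rewrite /flat ifT//; near: x; exact: lt_nbhsr.
  have q00 : q != 0 by rewrite gt_eqF.
  have dl := is_derive1_ln q0.
  have dv : is_derive q (1:R) (fun q => q^-1 : R) (- q ^- 2).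
    apply: DeriveDef; first exact: (@derivableV _ _ id).
    by rewrite (@deriveV _ _ id)// derive_id /GRing.scale/= mulr1.
  have := @is_derive1_comp _ expR (fun q => a * ln q - q^-1) q _ _ (is_derive_expR _) (is_deriveB (is_deriveZ a dl) dv).
  move=> /is_derive_eq; apply.
  have -> : flat (a-1) q = q * flat (a-2) q by rewrite -flat_mul_id; congr flat; lra.
  have -> : expR (a * ln q - q^-1) = q * (q * flat (a - 2) q).
    rewrite -flat_mul_id -flat_mul_id (_ : a - 2 + 1 + 1 = a); last by lra.
    by rewrite /flat q0.
  rewrite /GRing.scale/=; field.
  exact: q00.
- rewrite !flat_le0// mulr0 addr0.
  have [C hC] := flat_small a.
  apply: (@is_derive_flat0 _ C); first by rewrite flat_le0.
  by move=> h /ltr_normlW h1; rewrite ger0_norm ?flat_ge0// hC.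
Unshelve. all: by end_near. Qed.

Lemma antiderivative f : continuous f -> (forall q, q <= 0 -> f q = 0) ->
  exists F : R -> R, (forall q, is_derive q (1 : R) F (f q)) /\ (forall q, q <= 0 -> F q = 0).
Proof.
move=> cf f0.
pose F x := (\int[@lebesgue_measure R]_(t in `[-1, x]) f t).
have F0 q : q <= 0 -> F q = 0.
  move=> q0; rewrite /F (@eq_Rintegral _ _ _ _ _ (cst 0)); last first.
    by move=> x /[!inE]/= /[!in_itv]/= /andP[_ xq]; rewrite f0// (le_trans xq).
  by rewrite Rintegral_cst//= mul0r.
exists F; split => // q; have [q0|q0] := ltP q 0.
  rewrite f0 ?ltW//.
  apply: (@near_eq_is_derive _ _ _ (cst 0)).
  by near=> x; rewrite F0// ltW//; near: x; exact: lt_nbhsl.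
have [dF FE] : derivable F q 1 /\ F^`()%classic q = f q.
  apply: (@continuous_FTC1_closed R f (-1) q (q + 1)).
  - by rewrite ltrDl.
  - apply: continuous_compact_integrable; first exact: segment_compact.
    by apply: continuous_subspaceT.
  - by rewrite (lt_le_trans _ q0)// ltrN10.
  - exact: cf.
by rewrite -FE derive1E; exact: derivableP.
Unshelve. all: by end_near. Qed.

Lemma is_derive_continuous f f' : (forall q, is_derive q (1 : R) f (f' q)) -> continuous f.
Proof.
by move=> df q; apply/differentiable_continuous/derivable1_diffP; case: (df q).
Qed.

Lemma continuous_flat a : continuous (flat a).
Proof. exact: (is_derive_continuous (is_derive_flat a)). Qed.

Definition hump q : R := flat 0 q * flat 0 (1 - q).

Lemma continuous_hump : continuous hump.
Proof.
move=> q; apply: cvgM; first exact: continuous_flat.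
by apply: (@continuous_comp _ _ _ (fun q => 1 - q) (flat 0)); [exact: cvgB (cvg_cst _) cvg_id|exact: continuous_flat].
Qed.

Lemma mean_value f f' (a b : R) : (forall q, is_derive q (1 : R) f (f' q)) -> a < b ->
  exists2 c, a < c < b & f b - f a = f' c * (b - a).
Proof.
move=> df ab; have [|c] := @MVT R f f' a b ab (fun x _ => df x).
  by apply: continuous_subspaceT; exact: is_derive_continuous df.
by rewrite in_itv/=; exists c.
Qed.

Lemma hump_ge0 q : 0 <= hump q.
Proof. by rewrite mulr_ge0// flat_ge0. Qed.

Lemma hump_eq0 q : q <= 0 \/ 1 <= q -> hump q = 0.
Proof.
move=> [q0|q1]; rewrite /hump; first by rewrite flat_le0// mul0r.
by rewrite (@flat_le0 _ (1 - q)) ?mulr0// subr_le0.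
Qed.

Lemma flat_le1 q : flat 0 q <= 1.
Proof.
have [q0|q0] := leP q 0; first by rewrite flat_le0.
by rewrite /flat q0 mul0r sub0r -expR0 ler_expR oppr_le0 invr_ge0 ltW.
Qed.

Lemma flat_mono p q : p <= q -> flat 0 p <= flat 0 q.
Proof.
move=> pq; have [p0|p0] := leP p 0; first by rewrite flat_le0// flat_ge0.
have q0 := lt_le_trans p0 pq.
by rewrite /flat p0 q0 !mul0r !sub0r ler_expR lerN2 lef_pV2.
Qed.

(** A primitive of a smooth bump on [0, 1]: it is flat at 0 and constant from 1 on. *)
Definition cumul : R -> R :=
  sval (cid (antiderivative continuous_hump (fun q h => @hump_eq0 q (or_introl h)))).

Lemma is_derive_cumul q : is_derive q (1 : R) cumul (hump q).
Proof. by rewrite /cumul; case: cid => /= F []. Qed.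

Lemma cumul_le0 q : q <= 0 -> cumul q = 0.
Proof. by rewrite /cumul; case: cid => /= F [_]; exact. Qed.

(** Being bounded by a flat function, cumul absorbs negative powers of q at the
    origin. *)
Lemma cumul_bound q : 0 < q -> 0 <= cumul q <= q * flat 0 q.
Proof.
move=> q0; have [c /andP[c0 cq]] := mean_value is_derive_cumul q0.
rewrite (@cumul_le0 0)// !subr0 => ->.
rewrite mulr_ge0 ?hump_ge0 ?(ltW q0)//= mulrC ler_pM2l//.
rewrite (@le_trans _ _ (flat 0 c))//; first by rewrite ler_piMr ?flat_ge0 ?flat_le1.
by rewrite flat_mono// ltW.
Qed.

Lemma cumul_ge1 q : 1 <= q -> cumul q = cumul 1.
Proof.
rewrite le_eqVlt => /predU1P[<-//|q1].
have [c /andP[c1 _] /eqP] := mean_value is_derive_cumul q1.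
by rewrite hump_eq0 ?mul0r ?subr_eq0; [move/eqP|right; exact: ltW].
Qed.

(** The function q^a cumul(q). For a = - d/2 it is the derivative of a radial
    potential, see powcumul_ode. *)
Definition powcumul a q : R := if 0 < q then expR (a * ln q) * cumul q else 0.

Lemma powcumul_le0 a q : q <= 0 -> powcumul a q = 0.
Proof. by rewrite leNgt /powcumul => /negbTE ->. Qed.

Lemma powcumul_mul_id a q : powcumul (a + 1) q = q * powcumul a q.
Proof.
rewrite /powcumul; case: ifP => [q0|]; last by rewrite mulr0.
by rewrite mulrA -{3}(lnK q0) -expRD; congr (expR _ * _); lra.
Qed.

Lemma powcumul_bound a q : 0 <= powcumul a q <= flat (a + 1) q.
Proof.
rewrite /powcumul; case: ifPn => [q0|_]; last by rewrite lexx flat_ge0.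
have /andP[c0 cq] := cumul_bound q0.
rewrite mulr_ge0 ?expR_ge0//= flat_mul_id.
apply: (le_trans (ler_wpM2l (expR_ge0 _) cq)).
by rewrite mulrCA ler_wpM2l ?(ltW q0)// /flat q0 mul0r sub0r -expRD.
Qed.

Lemma is_derive_powcumul a q :
  is_derive q (1 : R) (powcumul a) (a * powcumul (a - 1) q + flat a q * flat 0 (1 - q)).
Proof.
have [q0|q0|->] := ltgtP q 0.
- rewrite powcumul_le0 ?ltW// flat_le0 ?ltW// mulr0 mul0r addr0.
  apply: (@near_eq_is_derive _ _ _ (cst 0)).
  by near=> x; rewrite powcumul_le0// ltW//; near: x; exact: lt_nbhsl.
- apply: (@near_eq_is_derive _ _ _ ((fun q => expR (a * ln q)) * cumul)).
    by near=> x; rewrite /powcumul ifT//; near: x; exact: lt_nbhsr.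
  have dl := is_derive1_ln q0.
  have de := @is_derive1_comp _ expR (fun q => a * ln q) q _ _ (is_derive_expR _) (is_deriveZ a dl).
  have := is_deriveM de (is_derive_cumul q).
  move=> /is_derive_eq; apply; rewrite addrC; congr (_ + _).
    rewrite /GRing.scale/= /powcumul q0.
    have -> : expR (a * ln q) = q * expR ((a - 1) * ln q).
      by rewrite -{2}(lnK q0) -expRD; congr expR; lra.
    by field; rewrite gt_eqF.
  rewrite /GRing.scale/= /hump /flat q0 mulrA -expRD; congr (expR _ * _); lra.
- rewrite !powcumul_le0// flat_le0// mulr0 mul0r addr0.
  have [C hC] := flat_small (a + 1).
  apply: (@is_derive_flat0 _ C); first by rewrite powcumul_le0.
  move=> h /ltr_normlW h1; have /andP[h0 hl] := powcumul_bound a h.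
  by rewrite ger0_norm// (le_trans hl)// hC.
Unshelve. all: by end_near. Qed.

Lemma continuous_powcumul a : continuous (powcumul a).
Proof. exact: (is_derive_continuous (is_derive_powcumul a)). Qed.

Definition potential a : R -> R :=
  sval (cid (antiderivative (@continuous_powcumul a) (@powcumul_le0 a))).

Lemma is_derive_potential a q : is_derive q (1 : R) (potential a) (powcumul a q).
Proof. by rewrite /potential; case: cid => /= F []. Qed.

Lemma is_derive_affine f (f' b c q : R) : is_derive (c * q + b) (1 : R) f f' ->
  is_derive q (1 : R) (fun q => f (c * q + b)) (c * f').
Proof.
move=> df; have dg : is_derive q (1 : R) (fun q => c * q + b) c.
  have := is_deriveD (is_deriveZ c (is_derive_id q (1 : R))) (is_derive_cst b q (1 : R)).
  by move=> /is_derive_eq; apply; rewrite /GRing.scale/= mulr1 addr0.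
by rewrite mulrC; exact: (@is_derive1_comp _ f (fun q => c * q + b) q f' c df dg).
Qed.

Lemma is_derive_scaled f (f' c q : R) : is_derive (c * q) (1 : R) f f' ->
  is_derive q (1 : R) (fun q => f (c * q)) (c * f').
Proof.
move=> df; have := @is_derive_affine f f' 0 c q.
rewrite addr0 => /(_ df); congr is_derive; apply/funext => x.
by rewrite addr0.
Qed.

(** A class of functions closed under differentiation for syntactic reasons, so that
    its members are smooth without any estimate on higher derivatives. The parameters
    are those that the derivatives bring in. *)
Inductive profile : (R -> R) -> Prop :=
| profile_cst c : profile (cst c)
| profile_flat a b c : profile (fun q => flat a (c * q + b))
| profile_powcumul a c : profile (fun q => powcumul a (c * q))
| profile_potential a c : profile (fun q => potential a (c * q))
| profile_add f g : profile f -> profile g -> profile (fun q => f q + g q)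
| profile_mul f g : profile f -> profile g -> profile (fun q => f q * g q).

Lemma profile_scale c f : profile f -> profile (fun q => c * f q).
Proof. exact: profile_mul (profile_cst c). Qed.

Lemma profile_derive f : profile f ->
  exists2 f', profile f' & forall q, is_derive q (1 : R) f (f' q).
Proof.
elim=> {f} [c|a b c|a c|a c|f g _ [f' pf' df] _ [g' pg' dg]|f g pf [f' pf' df] pg [g' pg' dg]].
- by exists (cst 0); [exact: profile_cst|move=> q; exact: is_derive_cst].
- exists (fun q => c * (a * flat (a - 1) (c * q + b) + flat (a - 2) (c * q + b))).
    apply: profile_scale; apply: profile_add; last exact: profile_flat.
    by apply: profile_scale; exact: profile_flat.
  by move=> q; apply: is_derive_affine; exact: is_derive_flat.
- exists (fun q => c * (a * powcumul (a - 1) (c * q) + flat a (c * q + 0) * flat 0 ((- c) * q + 1))).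
    apply: profile_scale; apply: profile_add.
      by apply: profile_scale; exact: profile_powcumul.
    by apply: profile_mul; exact: profile_flat.
  move=> q; rewrite mulNr [- _ + 1]addrC addr0.
  by apply: is_derive_scaled; exact: is_derive_powcumul.
- exists (fun q => c * powcumul a (c * q)).
    by apply: profile_scale; exact: profile_powcumul.
  by move=> q; apply: is_derive_scaled; exact: is_derive_potential.
- exists (fun q => f' q + g' q); first exact: profile_add.
  by move=> q; exact: is_deriveD (df q) (dg q).
- exists (fun q => f q * g' q + g q * f' q).
    by apply: profile_add; exact: profile_mul.
  by move=> q; exact: is_deriveM (df q) (dg q).
Qed.

Variable d : nat.

Let pw : R := - (d%:R / 2).

Definition bump_profile q : R := 4 * (flat (pw + 1) q * flat 0 (1 - q)).

Lemma profile_bump : profile bump_profile.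
Proof.
have -> : bump_profile = fun q => 4 * (flat (pw + 1) (1 * q + 0) * flat 0 (-1 * q + 1)).
  by apply/funext => q; rewrite /bump_profile mul1r addr0 mulN1r [- q + 1]addrC.
by apply: profile_scale; apply: profile_mul; exact: profile_flat.
Qed.

Lemma bump_profile_ge0 q : 0 <= bump_profile q.
Proof. by rewrite !mulr_ge0// flat_ge0. Qed.

Lemma bump_profile_gt0 q : 0 < q < 1 -> 0 < bump_profile q.
Proof.
by move=> /andP[q0 q1]; rewrite !mulr_gt0// flat_gt0// subr_gt0.
Qed.

Lemma bump_profile_eq0 q : 1 <= q -> bump_profile q = 0.
Proof.
by move=> q1; rewrite /bump_profile (@flat_le0 _ (1 - q)) ?mulr0// subr_le0.
Qed.

(** If F' = powcumul pw, then the left-hand side at q = |y|^2 is the Laplacian of y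
    |-> F(|y|^2), because that Laplacian is 2 d F'(q) + 4 q F''(q). *)
Lemma powcumul_ode q q' : is_derive q (1 : R) (powcumul pw) q' ->
  4 * q * q' + d%:R * 2 * powcumul pw q = bump_profile q.
Proof.
move=> [_ <-]; have [_ ->] := is_derive_powcumul pw q.
rewrite /bump_profile flat_mul_id.
have -> : powcumul pw q = q * powcumul (pw - 1) q.
  by rewrite -powcumul_mul_id subrK.
by rewrite /pw; field.
Qed.

(** F0 is the difference of two rescaled copies of one radial potential, whose sources
    have the same total mass. Beyond q = 1 both copies are the same multiple of the
    fundamental solution up to a constant, which is subtracted; this gives F0 bounded
    support. *)
Lemma kernel_profiles : exists F0 F1 F2 F3 : R -> R,
  [/\ profile F0,
      [/\ forall q, is_derive q (1 : R) F0 (F1 q),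
          forall q, is_derive q (1 : R) F1 (F2 q) &
          forall q, is_derive q (1 : R) F2 (F3 q)],
      forall q, 1 <= q -> F0 q = 0 &
      forall q, d%:R * 2 * F1 q + 4 * q * F2 q =
        2 ^+ d * bump_profile (4 * q) - bump_profile q].
Proof.
(* The factor for which the two potentials cancel beyond q = 1. *)
pose k : R := 2 ^+ d / 4.
pose N := potential pw; pose M := powcumul pw.
(* The constant value of the difference there. *)
pose c : R := k * N 4 - N 1.
have pM1 : profile (fun q => k * 4 * M (4 * q) + -1 * M (1 * q)).
  by apply: profile_add; apply: profile_scale; exact: profile_powcumul.
have pF0 : profile (fun q => (k * N (4 * q) + -1 * N (1 * q)) + - c).
  apply: profile_add; last exact: profile_cst.
  by apply: profile_add; apply: profile_scale; exact: profile_potential.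
have [F2 pF2 dF2] := profile_derive pM1.
have [F3 pF3 dF3] := profile_derive pF2.
have dN q : is_derive q (1 : R) (fun q => (k * N (4 * q) + -1 * N (1 * q)) + - c)
    (k * 4 * M (4 * q) + -1 * M (1 * q)).
  have d4 := is_derive_scaled (is_derive_potential pw (4 * q)).
  have d1 := is_derive_scaled (is_derive_potential pw (1 * q)).
  have := is_deriveD (is_deriveD (is_deriveZ k d4) (is_deriveZ (-1) d1)) (is_derive_cst (- c) q 1).
  by move=> /is_derive_eq; apply; rewrite /GRing.scale/= /M; ring.
eexists _, _, F2, F3; split; [exact: pF0|split; [exact: dN|exact: dF2|exact: dF3]| |].
- move=> q; rewrite le_eqVlt => /predU1P[<-|q1].
    by rewrite !mulr1 mulN1r subrr.
  have [x /andP[x1 _] /eqP] := mean_value dN q1.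
  have -> : k * 4 * M (4 * x) + -1 * M (1 * x) = 0.
    have x0 : 0 < x by rewrite (lt_trans _ x1).
    have l4 : ln (4 : R) = ln 2 * 2.
      by rewrite (_ : 4 = 2 ^+ 2) ?lnXn// ?mulr_natr// -natrX.
    rewrite mul1r /M /powcumul x0 mulr_gt0//.
    rewrite (@cumul_ge1 (4 * x)); last by lra.
    rewrite (@cumul_ge1 x) ?(ltW x1)// lnM ?posrE// l4 (mulrDr pw) expRD.
    have -> : pw * (ln 2 * 2) = - (d%:R * ln 2) by rewrite /pw; field.
    rewrite expRN expRM_natl lnK ?posrE// /k.
    by field; rewrite expf_neq0.
  rewrite mul0r subr_eq0 => /eqP ->.
  by rewrite !mulr1 mulN1r subrr.
- move=> q.
  have [M' dM] : exists M', forall q, is_derive q (1 : R) M (M' q).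
    by eexists => x; exact: is_derive_powcumul.
  have -> : F2 q = k * 4 * (4 * M' (4 * q)) - M' q.
    have [_ <-] := dF2 q.
    have d4 := is_derive_scaled (dM (4 * q)).
    have d1 := is_derive_scaled (dM (1 * q)).
    have [_ ->] := is_deriveD (is_deriveZ (k * 4) d4) (is_deriveZ (-1) d1).
    by rewrite /GRing.scale/= !mul1r mulN1r.
  have := powcumul_ode (dM q); have := powcumul_ode (dM (4 * q)).
  rewrite -/M mul1r /k => <- <-.
  by field.
Qed.

End one_variable.

(** * Directional derivatives and the radial kernels *)

Section elementary_rules.
Context {R : realType} {V : normedModType R}.
Implicit Types f g : V -> R.

Lemma is_derive_mulf f g (x v : V) (df dg : R) : is_derive x v f df -> is_derive x v g dg ->
  is_derive x v (fun x => f x * g x) (f x * dg + g x * df).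
Proof. exact: is_deriveM. Qed.

Lemma is_derive_scalef f (c : R) (x v : V) (df : R) : is_derive x v f df ->
  is_derive x v (fun x => c * f x) (c * df).
Proof. exact: is_deriveZ. Qed.

Lemma continuous_scalef f (c : R) : continuous f -> continuous (fun x => c * f x).
Proof. by move=> cf x; apply: (@continuousM _ _ (cst c) f); [exact: cst_continuous|exact: cf]. Qed.

End elementary_rules.

Section directional_derivatives.
Context {R : realType} {d : nat}.
Implicit Types (f g phi psi : 'rV[R]_d -> R) (x y v : 'rV[R]_d) (i j : 'I_d).

Lemma is_derive_line f y v (l : R) :
  is_derive y v f l <-> is_derive (0 : R) 1 (fun h : R => f (h *: v + y)) l.
Proof.
have E : (fun h : R => h^-1 *: ((fun h : R => f (h *: v + y)) (h *: 1 + 0) - f (0 *: v + y))) =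
         (fun h : R => h^-1 *: (f (h *: v + y) - f y)).
  by apply/funext => h; rewrite /= addr0 scale0r add0r [_%:A]mulr1.
split => -[df dl]; apply: DeriveDef.
- by move: df => /derivable1P.
- by rewrite -dl /derive E.
- exact/derivable1P.
- by rewrite -dl /derive E.
Qed.

Lemma is_derive_chain (F : R -> R) f y v (F' f' : R) :
  is_derive (f y) (1 : R) F F' -> is_derive y v f f' -> is_derive y v (F \o f) (F' * f').
Proof.
move=> dF /is_derive_line df; apply/is_derive_line.
apply: (@is_derive1_comp _ F (fun h : R => f (h *: v + y)) 0 F' f') => //.
by rewrite scale0r add0r.
Qed.

Lemma is_derive_coord y v j : is_derive y v (fun y => y 0 j) (v 0 j).
Proof.
apply/is_derive_line.
have -> : (fun h : R => (h *: v + y) 0 j) = (fun h : R => v 0 j * h + y 0 j).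
  by apply/funext => h; rewrite !mxE mulrC.
have := is_deriveD (is_deriveZ (v 0 j) (is_derive_id (0 : R) 1)) (is_derive_cst (y 0 j) (0 : R) (1 : R)).
by move=> /is_derive_eq; apply; rewrite /GRing.scale/= mulr1 addr0.
Qed.

Definition normsq y : R := \sum_i y 0 i ^+ 2.

Lemma is_derive_normsq y v : is_derive y v normsq (2 * \sum_i v 0 i * y 0 i).
Proof.
have -> : normsq = \sum_i (fun y => y 0 i ^+ 2).
  by apply/funext => z; rewrite /normsq fct_sumE.
have h i : is_derive y v (fun y => y 0 i ^+ 2) (2 * (v 0 i * y 0 i)).
  have := is_deriveM (is_derive_coord y v i) (is_derive_coord y v i).
  by move=> /is_derive_eq; apply; rewrite /GRing.scale/= /GRing.scale/=; ring.
by move: (is_derive_sum h) => /is_derive_eq; apply; rewrite mulr_sumr.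
Qed.

Lemma continuous_normsq : continuous normsq.
Proof.
rewrite (_ : normsq = \sum_i (fun y => y 0 i ^+ 2)); last first.
  by apply/funext => z; rewrite /normsq fct_sumE.
move=> x; apply: (big_ind (fun f => {for x, continuous f})).
- exact: cst_continuous.
- by move=> f g cf cg; exact: continuousD.
- by move=> i _; apply: continuousM; exact: coord_continuous.
Qed.

Lemma partialE phi psi i : (forall y, is_derive y 'e_i phi (psi y)) -> partial i phi = psi.
Proof. by move=> h; apply/funext => y; have [_] := h y. Qed.

(** Polynomials in the coordinates and in radial profiles: a class that contains the
    kernels and is closed under partial derivatives. *)
Inductive radial_poly : ('rV[R]_d -> R) -> Prop :=
| radial_poly_cst c : radial_poly (cst c)
| radial_poly_coord i : radial_poly (fun y => y 0 i)
| radial_poly_profile F : profile F -> radial_poly (F \o normsq)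
| radial_poly_add f g : radial_poly f -> radial_poly g -> radial_poly (fun y => f y + g y)
| radial_poly_mul f g : radial_poly f -> radial_poly g -> radial_poly (fun y => f y * g y).

Lemma dot_e i y : \sum_j ('e_i : 'rV[R]_d) 0 j * y 0 j = y 0 i.
Proof.
rewrite (bigD1 i)//= big1 ?addr0; first by rewrite mxE !eqxx mul1r.
by move=> j ji; rewrite mxE (negbTE ji) andbF mul0r.
Qed.

Lemma radial_poly_partial i f : radial_poly f ->
  exists2 f', radial_poly f' & forall y, is_derive y 'e_i f (f' y).
Proof.
elim=> {f} [c|j|F pF|f g _ [f' pf' df] _ [g' pg' dg]|f g pf [f' pf' df] pg [g' pg' dg]].
- by exists (cst 0); [exact: radial_poly_cst|move=> y; exact: is_derive_cst].
- exists (cst (('e_i : 'rV[R]_d) 0 j)); first exact: radial_poly_cst.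
  by move=> y; exact: is_derive_coord.
- have [F' pF' dF] := profile_derive pF.
  exists (fun y => F' (normsq y) * (2 * y 0 i)).
    apply: radial_poly_mul; first exact: radial_poly_profile.
    by apply: radial_poly_mul; [exact: (radial_poly_cst 2)|exact: radial_poly_coord].
  move=> y; have := is_derive_normsq y 'e_i; rewrite dot_e.
  exact: is_derive_chain.
- exists (fun y => f' y + g' y); first exact: radial_poly_add.
  by move=> y; exact: is_deriveD (df y) (dg y).
- exists (fun y => f y * g' y + g y * f' y).
    by apply: radial_poly_add; exact: radial_poly_mul.
  by move=> y; exact: is_deriveM (df y) (dg y).
Qed.

Lemma radial_poly_continuous f : radial_poly f -> continuous f.
Proof.
elim=> {f} [c|j|F pF|f g _ cf _ cg|f g _ cf _ cg] x.
- exact: cst_continuous.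
- exact: coord_continuous.
- apply: continuous_comp; first exact: continuous_normsq.
  by have [F' _ dF] := profile_derive pF; exact: (is_derive_continuous dF).
- by apply: continuousD; [exact: cf|exact: cg].
- by apply: continuousM; [exact: cf|exact: cg].
Qed.

Lemma radial_poly_smooth f : radial_poly f -> smooth f.
Proof.
move=> pf s.
have : radial_poly (foldr partial f s).
  elim: s => //= i s IH; have [f' pf' df] := radial_poly_partial i IH.
  by rewrite (partialE df).
move=> ps; split; first exact: radial_poly_continuous.
move=> i x; have [f' _ df] := radial_poly_partial i ps.
by case: (df x).
Qed.

Lemma sum_delta i (c : 'I_d -> R) : \sum_j ('e_j : 'rV[R]_d) 0 i * c j = c i.
Proof.
rewrite (bigD1 i)//= big1 ?addr0; first by rewrite mxE !eqxx mul1r.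
by move=> j ji; rewrite mxE eq_sym (negbTE ji) andbF mul0r.
Qed.

Lemma normsqZ (a : R) y : normsq (a *: y) = a ^+ 2 * normsq y.
Proof.
by rewrite /normsq mulr_sumr; apply: eq_bigr => i _; rewrite mxE exprMn.
Qed.

Lemma coord_norm_le y i : `|y 0 i| <= `|y|.
Proof.
rewrite [leRHS]/Num.norm/= mx_normrE; apply/bigmax_geP; right => /=.
by exists (ord0, i).
Qed.

Lemma norm_coord_ge y (a : R) : 0 < a -> a <= `|y| -> exists i, a <= `|y 0 i|.
Proof.
move=> a0; rewrite [leRHS]/Num.norm/= mx_normrE => /bigmax_geP[|].
  by rewrite leNgt a0.
by move=> [[k i] _ /= h]; exists i; move: h; rewrite (ord1 k).
Qed.

Lemma normsq_ge1 y : 1 <= `|y| -> 1 <= normsq y.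
Proof.
move=> /(norm_coord_ge ltr01)[i yi].
rewrite /normsq (bigD1 i)//= -(real_normK (num_real _)).
rewrite (@le_trans _ _ (`|y 0 i| ^+ 2))//; first by rewrite -[1](expr1n _ 2) lerXn2r ?nnegrE.
by rewrite lerDl sumr_ge0// => j _; rewrite sqr_ge0.
Qed.

Section radial_laplacian.
Variables (F0 F1 F2 F3 : R -> R).
Hypothesis dF0 : forall q, is_derive q (1 : R) F0 (F1 q).
Hypothesis dF1 : forall q, is_derive q (1 : R) F1 (F2 q).
Hypothesis dF2 : forall q, is_derive q (1 : R) F2 (F3 q).

Let D (F F' : R -> R) : (forall q, is_derive q (1 : R) F (F' q)) ->
  forall j y, is_derive y 'e_j (F \o normsq) (F' (normsq y) * (2 * y 0 j)).
Proof.
move=> dF j y; have := is_derive_normsq y 'e_j; rewrite dot_e.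
exact: is_derive_chain.
Qed.

Lemma partial_radial i : partial i (F0 \o normsq) = fun y => F1 (normsq y) * (2 * y 0 i).
Proof. by apply: partialE => y; exact: D. Qed.

Let D2 i j y : is_derive y 'e_j (fun y => F1 (normsq y) * (2 * y 0 i))
  (('e_j : 'rV[R]_d) 0 i * (2 * F1 (normsq y)) + F2 (normsq y) * (4 * (y 0 j * y 0 i))).
Proof.
apply: (is_derive_eq (is_derive_mulf (D dF1 j y) (is_derive_scalef 2 (is_derive_coord y 'e_j i)))).
by rewrite /=; ring.
Qed.

Let D3 i j y : is_derive y 'e_j
  (fun y => ('e_j : 'rV[R]_d) 0 i * (2 * F1 (normsq y)) + F2 (normsq y) * (4 * (y 0 j * y 0 i)))
  (('e_j : 'rV[R]_d) 0 i * (F2 (normsq y) * (8 * y 0 j)) +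
   F3 (normsq y) * (8 * y 0 i) * y 0 j ^+ 2 + F2 (normsq y) * (4 * y 0 i)).
Proof.
have h1 := is_derive_scalef (('e_j : 'rV[R]_d) 0 i) (is_derive_scalef 2 (D dF1 j y)).
have h2 := is_derive_mulf (D dF2 j y) (is_derive_scalef 4
  (is_derive_mulf (is_derive_coord y 'e_j j) (is_derive_coord y 'e_j i))).
apply: (is_derive_eq (is_deriveD h1 h2)).
have -> : ('e_j : 'rV[R]_d) 0 j = 1 by rewrite mxE !eqxx.
by rewrite /=; ring.
Qed.

Lemma laplacian_radial y : laplacian (F0 \o normsq) y =
  d%:R * 2 * F1 (normsq y) + 4 * normsq y * F2 (normsq y).
Proof.
rewrite /laplacian.
under eq_bigr => i _ do rewrite partial_radial (partialE (D2 i i)).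
rewrite big_split/=; congr (_ + _).
  under eq_bigr => i _ do rewrite mxE !eqxx mul1r.
  by rewrite sumr_const card_ord -(mulr_natl (2 * _)) mulrA.
by rewrite -!mulr_sumr [RHS]mulrC; congr (_ * (_ * _)).
Qed.

(** Computing both sides explicitly replaces an appeal to the symmetry of mixed
    derivatives. *)
Lemma laplacian_partial_radial i y : laplacian (partial i (F0 \o normsq)) y =
  ((d%:R * 2 + 4) * F2 (normsq y) + 4 * normsq y * F3 (normsq y)) * (2 * y 0 i).
Proof.
rewrite /laplacian partial_radial.
under eq_bigr => j _ do rewrite (partialE (D2 i j)) (partialE (D3 i j)).
rewrite !big_split/= sum_delta -mulr_sumr sumr_const card_ord -/(normsq y) -(mulr_natl (F2 _ * _)).
by ring.
Qed.

Lemma is_derive_laplacian_profile q :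
  is_derive q (1 : R) (fun q => d%:R * 2 * F1 q + 4 * q * F2 q)
    ((d%:R * 2 + 4) * F2 q + 4 * q * F3 q).
Proof.
apply: (is_derive_eq (is_deriveD (is_derive_scalef (d%:R * 2) (dF1 q))
  (is_derive_mulf (is_derive_scalef 4 (is_derive_id q (1 : R))) (dF2 q)))).
by rewrite /=; ring.
Qed.

End radial_laplacian.

(** The Laplacian of zeta moves the mass of eta from scale 1 to scale 1/2, and zeta
    has bounded support because the two masses are equal. This is what makes the
    argument local. *)
Lemma kernels : (0 < d)%N -> exists zeta eta : 'rV[R]_d -> R,
  [/\ smooth zeta /\ smooth eta,
      (forall y, 1 <= `|y| -> zeta y = 0) /\ (forall y, 1 <= `|y| -> eta y = 0),
      (forall y, 0 <= eta y) /\ (exists p, 0 < eta p),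
      (forall y, laplacian zeta y = 2 ^+ d * eta (2 *: y) - eta y) &
      (forall i, laplacian (partial i zeta) =
        partial i (fun y => 2 ^+ d * eta (2 *: y) - eta y))].
Proof.
move=> d0; have [F0 [F1 [F2 [F3 [pF0 [dF0 dF1 dF2] F00 ode]]]]] := @kernel_profiles R d.
exists (F0 \o normsq), (bump_profile d \o normsq); split.
- by split; apply: radial_poly_smooth; apply: radial_poly_profile => //; exact: profile_bump.
- by split => y /normsq_ge1 y1; [exact: F00|exact: bump_profile_eq0].
- split=> [y|]; first exact: bump_profile_ge0.
  exists (const_mx (d.+1%:R^-1)) => /=; apply: bump_profile_gt0.
  rewrite /normsq; under eq_bigr => i _ do rewrite mxE.
  rewrite sumr_const card_ord -(mulr_natl _ d) exprVn.
  have d1 : (0 : R) < d.+1%:R ^+ 2 by rewrite exprn_gt0.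
  rewrite divr_gt0 ?ltr0n//= ltr_pdivrMr// mul1r -natrX ltr_nat.
  by rewrite (@leq_ltn_trans (d * d))// ?leq_pmulr// -mulnn ltn_mul.
- by move=> y; rewrite (laplacian_radial dF0 dF1) ode /= normsqZ -(natrX R 2 2).
- move=> i; apply/esym.
  have -> : (fun y => 2 ^+ d * (bump_profile d \o normsq) (2 *: y) - (bump_profile d \o normsq) y)
     = (fun q => d%:R * 2 * F1 q + 4 * q * F2 q) \o normsq.
    by apply/funext => y; rewrite /= ode normsqZ -(natrX R 2 2).
  apply: partialE => y.
  rewrite (laplacian_partial_radial dF0 dF1 dF2).
  have := is_derive_normsq y 'e_i; rewrite dot_e.
  apply: is_derive_chain; exact: is_derive_laplacian_profile.
Qed.

Lemma is_derive_dilation f (a : R) w y v (l : R) :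
  is_derive (a *: y + w) v f l -> is_derive y v (fun y => f (a *: y + w)) (a * l).
Proof.
move=> /is_derive_line df; apply/is_derive_line.
have -> : (fun h : R => f (a *: (h *: v + y) + w)) = (fun h => f ((a * h) *: v + (a *: y + w))).
  by apply/funext => h; rewrite scalerDr scalerA addrA.
by apply: (@is_derive_scaled R (fun h => f (h *: v + (a *: y + w)))); rewrite mulr0.
Qed.

Definition dilation (a : R) w y : 'rV[R]_d := a *: y + w.

Lemma foldr_partial_dilation phi (a : R) (w : 'rV[R]_d) (c : R) s : smooth phi ->
  foldr partial (fun y => c * phi (dilation a w y)) s =
  fun y => c * a ^+ size s * foldr partial phi s (dilation a w y).
Proof.
move=> sphi; elim: s => [|i s /= ->]; first by apply/funext => y; rewrite mulr1.
apply: partialE => y; have [_ /(_ i (dilation a w y)) dphi] := sphi s.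
have := is_deriveZ (c * a ^+ size s) (is_derive_dilation (derivableP dphi)).
by move=> /is_derive_eq; apply; rewrite /GRing.scale/= exprSr !mulrA.
Qed.

Lemma continuous_dilation (a : R) w : continuous (dilation a w).
Proof.
move=> y; apply: (@continuousD _ _ _ (fun y => a *: y) (cst w)).
  exact: scaler_continuous.
exact: cst_continuous.
Qed.

Lemma smooth_dilation phi (a : R) (w : 'rV[R]_d) (c : R) : smooth phi ->
  smooth (fun y => c * phi (dilation a w y)).
Proof.
move=> sphi s; rewrite foldr_partial_dilation//; have [cs ds] := sphi s; split.
  apply: continuous_scalef => y.
  by apply: (@continuous_comp _ _ _ (dilation a w)); [exact: continuous_dilation|exact: cs].
move=> i y; have df := is_derive_dilation (derivableP (ds i (dilation a w y))).
by case: (is_derive_scalef (c * a ^+ size s) df).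
Qed.

Lemma smooth_partial phi i : smooth phi -> smooth (partial i phi).
Proof. by move=> sphi s; have := sphi (rcons s i); rewrite foldr_rcons. Qed.

Lemma partial_dilation phi (a : R) (w : 'rV[R]_d) (c : R) i : smooth phi ->
  partial i (fun y => c * phi (dilation a w y)) =
  fun y => c * a * partial i phi (dilation a w y).
Proof. by move=> sphi; have := foldr_partial_dilation a w c [:: i] sphi. Qed.

End directional_derivatives.

(** * Mean value estimates for smooth functions *)

Section smooth_estimates.
Context {R : realType} {d : nat}.
Implicit Types (phi psi : 'rV[R]_d -> R) (u v x y : 'rV[R]_d) (i j : 'I_d).

Lemma smooth_continuous phi : smooth phi -> continuous phi.
Proof. by move=> /(_ [::]) []. Qed.

Lemma smooth_is_derive phi i y : smooth phi -> is_derive y 'e_i phi (partial i phi y).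
Proof. by move=> /(_ [::]) [_ /(_ i y)] /derivableP. Qed.

Definition supported_within (r : R) phi := forall y, r < `|y| -> phi y = 0.

Lemma supported_within_partial r phi i :
  supported_within r phi -> supported_within r (partial i phi).
Proof.
move=> sphi y ry; rewrite /partial (@near_eq_derive _ _ _ phi (cst 0)) ?derive_cst//.
near=> z; rewrite sphi//; near: z.
by apply: (cvgr_gt `|y|) => //; exact: norm_continuous.
Unshelve. all: by end_near. Qed.

Lemma compact_cball0 (r : R) : compact [set y : 'rV[R]_d | `|y| <= r].
Proof.
apply: bounded_closed_compact.
  by exists r; split; [exact: num_real|move=> x rx y /= /le_trans; apply; exact: ltW].
have -> : [set y : 'rV[R]_d | `|y| <= r] = Num.norm @^-1` [set q | q <= r] by [].
by apply: preimage_closed; [move=> y _; exact: norm_continuous|exact: closed_le].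
Qed.

Lemma supported_within_bounded r phi : continuous phi -> supported_within r phi ->
  exists2 C : R, 0 <= C & forall y, `|phi y| <= C.
Proof.
move=> cphi sphi.
have [r0|r0] := ltP r 0.
  by exists 0 => // y; rewrite sphi ?normr0// (lt_le_trans r0).
have [||c _ hc] := @compact_EVT_max _ R (fun y => `|phi y|) _ _ (compact_cball0 (r := r)).
- by exists 0; rewrite /= normr0.
- apply: continuous_subspaceT => y.
  by apply: (@continuous_comp _ _ _ phi Num.norm); [exact: cphi|exact: norm_continuous].
exists `|phi c| => // y; have [y1|y1] := leP `|y| r; last by rewrite sphi// normr0.
by apply: hc; rewrite inE.
Qed.

(** The finitely many bounds are added rather than maximized, which needs no default
    value. *)
Lemma finite_family_bounded (I : finType) (F : I -> 'rV[R]_d -> R) :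
  (forall t, exists2 C : R, 0 <= C & forall y, `|F t y| <= C) ->
  exists2 C : R, 0 <= C & forall t y, `|F t y| <= C.
Proof.
move=> H; have /choice[C hC] : forall t, exists C : R, 0 <= C /\ forall y, `|F t y| <= C.
  by move=> t; have [C C0 hC] := H t; exists C.
exists (\sum_t C t); first by apply: sumr_ge0 => t _; have [] := hC t.
move=> t y; have [_ /(_ y) h] := hC t; apply: (le_trans h).
by rewrite (bigD1 t)//= lerDl sumr_ge0// => u _; have [] := hC u.
Qed.

Lemma norm_e i : `|'e_i : 'rV[R]_d| <= 1.
Proof.
rewrite [leLHS]/Num.norm/= mx_normrE; apply: bigmax_le => // -[k j] _ /=.
by rewrite mxE; case: (_ && _); rewrite ?normr1 ?normr0.
Qed.

Lemma mean_value_line phi i u (t : R) : smooth phi -> 0 < t ->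
  exists2 c, `|c| < t & phi (u + t *: 'e_i) - phi (u - t *: 'e_i) =
    2 * t * partial i phi (u + c *: 'e_i).
Proof.
move=> sphi t0.
have dg q : is_derive q (1 : R) (fun h : R => phi (u + h *: 'e_i)) (partial i phi (u + q *: 'e_i)).
  have /is_derive_line dq := smooth_is_derive i (u + q *: 'e_i) sphi.
  have -> : (fun h : R => phi (u + h *: 'e_i)) =
      (fun h : R => (fun h : R => phi (h *: 'e_i + (u + q *: 'e_i))) (1 * h + - q)).
    by apply/funext => h; rewrite mul1r addrCA -scalerDl subrK.
  by rewrite -[X in is_derive _ _ _ X]mul1r; apply: (@is_derive_affine _ (fun h : R => phi (h *: 'e_i + (u + q *: 'e_i)))); rewrite mul1r subrr.
have tt : - t < t by rewrite gtrN.
have [c /andP[c1 c2]] := mean_value dg tt.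
rewrite scaleNr => ->; exists c; first by rewrite ltr_norml c1.
by rewrite opprK mulrC; congr (_ * _); rewrite mulr2n mulrDl mul1r.
Qed.

Lemma lipschitz_line phi i u (t C : R) : smooth phi -> 0 <= C ->
  (forall y, `|partial i phi y| <= C) -> `|phi (u + t *: 'e_i) - phi u| <= C * `|t|.
Proof.
move=> sphi C0 hC.
wlog t0 : u t / 0 < t => [H|].
  have [t0|t0|->] := ltgtP t 0; last by rewrite scale0r addr0 subrr !normr0 mulr0.
    have := H (u + t *: 'e_i) (- t); rewrite oppr_gt0 => /(_ t0).
    by rewrite scaleNr addrK normrN distrC.
  exact: H.
have t20 : 0 < t / 2 by rewrite divr_gt0.
have [c _] := mean_value_line i (u + (t / 2) *: 'e_i) sphi t20.
rewrite addrK -addrA -scalerDl -splitr => ->.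
rewrite normrM mulrC ler_pM// mulrC divfK// ger0_norm ?ltW//.
Qed.

(** The coordinates are changed one at a time. *)
Lemma lipschitz phi u v (C : R) : smooth phi -> 0 <= C ->
  (forall i y, `|partial i phi y| <= C) -> `|phi u - phi v| <= C * d%:R * `|u - v|.
Proof.
move=> sphi C0 hC.
have H s : `|phi (v + \sum_(i <- s) (u - v) 0 i *: 'e_i) - phi v| <= \sum_(i <- s) C * `|u - v|.
  elim: s => [|i s IH]; first by rewrite !big_nil addr0 subrr normr0.
  rewrite !big_cons addrCA addrC.
  set w := v + _ in IH *.
  rewrite -(subrK (phi w) (phi (w + _))) -addrA.
  apply: (le_trans (ler_normD _ _)); apply: lerD => //.
  apply: (le_trans (lipschitz_line _ _ sphi C0 (hC i))).
  by rewrite ler_wpM2l// coord_norm_le.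
have := H (index_enum 'I_d).
rewrite -row_sum_delta (addrC v) subrK sumr_const card_ord -(mulr_natl (_ * _)).
by rewrite mulrA (mulrC d%:R).
Qed.

(** The mean value theorem on the segment, and then the Lipschitz bound for the
    partial derivative. *)
Lemma centered_difference phi i u v (t C : R) : smooth phi -> 0 <= t -> 0 <= C ->
  (forall j y, `|partial j (partial i phi) y| <= C) ->
  `|phi (u + t *: 'e_i) - phi (u - t *: 'e_i) - 2 * t * partial i phi v| <=
    2 * t * (C * d%:R * (`|u - v| + t)).
Proof.
move=> sphi; rewrite le_eqVlt => /predU1P[<-|t0] C0 hC.
  by rewrite scale0r addr0 subr0 subrr !mulr0 !mul0r subr0 normr0.
have [c ct ->] := mean_value_line i u sphi t0.
have t2 : 0 <= 2 * t by rewrite mulr_ge0// ltW.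
rewrite -mulrBr normrM ger0_norm// ler_wpM2l//.
apply: (le_trans (lipschitz _ _ (smooth_partial i sphi) C0 hC)).
rewrite ler_wpM2l ?mulr_ge0// addrAC (le_trans (ler_normD _ _))// lerD2l.
by rewrite normrZ (le_trans _ (ltW ct))// ler_piMr// norm_e.
Qed.

End smooth_estimates.

(** * Lebesgue measure on R^d: balls, translations, integrals of derivatives *)

Section lebesgue_facts.
Context {R : realType}.

(** The copy of lebesgue_rV that is declared sigma-finite. *)
Definition leb (d : nat) : set (Rn R d) -> \bar R := lebesgue_rV d.

HB.instance Definition _ d := Measure.on (@leb d).

Lemma continuous_measurable_rV d (f : 'rV[R]_d -> R) : continuous f ->
  measurable_fun [set: Rn R d] (f : Rn R d -> measurableTypeR R).
Proof.
move=> cf.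
apply: (measurability _ (measurable_realfun.RGenOpens.measurableE R)) => _ [_ [a [b ->] <-]].
rewrite setTI; apply: open_measurable_rV.
by apply: open_comp; [move=> v _; exact: cf|exact: interval_open].
Qed.

Lemma ball_rVE d (x : 'rV[R]_d) (r : R) : 0 < r ->
  ball x r = [set y : 'rV[R]_d | forall i, ball (x 0 i) r (y 0 i)].
Proof.
move=> r0; apply/seteqP; split => [y [_ xy] i|y xy]; first exact: xy.
by split => // j i; rewrite ord1.
Qed.

Lemma measurable_ball_rV d (x : 'rV[R]_d) (r : R) : measurable (ball x r : set (Rn R d)).
Proof. by apply: open_measurable_rV; exact: ball_open. Qed.

Lemma leb_ball d (x : 'rV[R]_d) (r : R) : 0 < r -> leb (ball x r : set (Rn R d)) = ((r *+ 2) ^+ d)%:E.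
Proof.
move=> r0; rewrite ball_rVE// /leb.
rewrite (lebesgue_rV_box (A := fun i => ball (x 0 i) r)); last first.
  by move=> i; exact: measurable_realfun.measurable_ball.
under eq_bigr => i _ do rewrite lebesgue_measure_ball ?ltW//.
by rewrite prodEFin prodr_const card_ord.
Qed.

Lemma bigcup_ball d (x : 'rV[R]_d) : \bigcup_n ball x n.+1%:R = [set: 'rV[R]_d].
Proof.
apply/seteqP; split => // y _; exists (Num.truncn `|x - y|) => //.
by rewrite -ball_normE /ball_/= truncnS_gt.
Qed.

Lemma sigma_finite_leb d : sigma_finite [set: Rn R d] (@leb d).
Proof.
exists (fun n => ball (0 : 'rV[R]_d) n.+1%:R); first by rewrite bigcup_ball.
move=> n; split; first exact: measurable_ball_rV.
by rewrite leb_ball// ltry.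
Qed.

HB.instance Definition _ d := @Measure_isSigmaFinite.Build _ _ _ (@leb d) (@sigma_finite_leb d).

Lemma lebesgue_measure_translation (w : R) (A : set (measurableTypeR R)) : measurable A ->
  lebesgue_measure [set t : R | A (t + w)] = lebesgue_measure A.
Proof.
have mw : measurable_fun [set: measurableTypeR R] (fun t : measurableTypeR R => (t + w : R) : measurableTypeR R).
  exact: measurable_funD.
move=> mA; apply: esym.
apply: (@lebesgue_measure_unique R (pushforward (@lebesgue_measure R) (fun t : measurableTypeR R => (t + w : R) : measurableTypeR R))) => // _ [[a b] _ <-].
transitivity (lebesgue_measure (`](a - w), (b - w)]%classic : set (measurableTypeR R))).
  rewrite !lebesgue_measure_itv/= !lte_fin ltrD2r; case: ifP => // _.
  by rewrite -!EFinD; congr EFin; ring.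
congr lebesgue_measure; apply/seteqP.
by split => t /=; rewrite !in_itv/= ltrBlDr lerBrDr.
Qed.

Lemma measurable_translation d (w : 'rV[R]_d) :
  measurable_fun [set: Rn R d] (fun y : Rn R d => (y : 'rV[R]_d) + w : Rn R d).
Proof.
apply: measurable_fun_rV => i.
rewrite (_ : (fun _ => _) = (fun y : Rn R d => (y : 'rV[R]_d) 0 i + w 0 i)).
  by apply: measurable_funD => //; exact: measurable_coord.
by apply/funext => y; rewrite mxE.
Qed.

(** Separate from ge0_integral_translation because the induction that proves
    leb_translation uses it one dimension lower. *)
Lemma ge0_integral_translation_of d (w : 'rV[R]_d) (G : Rn R d -> \bar R) :
  (forall A : set (Rn R d), measurable A -> leb [set y : Rn R d | A ((y : 'rV[R]_d) + w)] = leb A) ->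
  measurable_fun setT G -> (forall x, 0 <= G x)%E ->
  (\int[@leb d]_x G ((x : 'rV[R]_d) + w)%R = \int[@leb d]_x G x)%E.
Proof.
move=> H mG G0.
have := @ge0_integral_pushforward _ _ _ _ R _ (measurable_translation w) (@leb d) setT G measurableT mG (fun y _ => G0 y).
rewrite preimage_setT => <-.
apply: (eq_measure_integral (@leb d)); first exact: measurable_translation.
by move=> ? A mA _; rewrite -[RHS](H A mA).
Qed.

(** Induction on the dimension, by slicing; in dimension one a measure with the right
    values on intervals is Lebesgue measure. *)
Lemma leb_translation d (w : 'rV[R]_d) (A : set (Rn R d)) : measurable A ->
  leb [set y : Rn R d | A ((y : 'rV[R]_d) + w)] = leb A.
Proof.
elim: d w A => [|d IH] w A mA.
  by congr leb; apply/seteqP; split => y /=; rewrite [w]thinmx0 addr0.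
pose w' : 'rV[R]_d := \row_i w 0 (lift ord0 i).
rewrite /leb/= /add_coordinate /pushforward /product_measure1 /=.
pose B := @cons_rV R d @^-1` A.
have mB : measurable B.
  by rewrite -[B]setTI; apply: (@measurable_cons_rV R d).
pose G x : \bar R := lebesgue_measure (xsection B x).
transitivity (\int[@leb d]_x G ((x : 'rV[R]_d) + w')%R)%E.
  apply: eq_integral => x _ /=; rewrite /G -[RHS](@lebesgue_measure_translation (w 0 ord0)); last first.
    exact: measurable_xsection.
  congr lebesgue_measure; apply/seteqP; rewrite /xsection/=.
  suff E t : (cons_rV (x, t) + w : 'rV[R]_d.+1) = cons_rV ((x : 'rV[R]_d) + w', t + w 0 ord0).
    by split => t /=; rewrite !in_setE /B /= E.
  apply/rowP => i; rewrite !mxE; case: unliftP => [j ->|->]; first by rewrite !mxE.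
  by [].
apply: ge0_integral_translation_of => //; first by move=> C mC; exact: IH.
exact: measurable_fun_xsection.
Qed.

Lemma ge0_integral_translation d (w : 'rV[R]_d) (G : Rn R d -> \bar R) :
  measurable_fun setT G -> (forall x, 0 <= G x)%E ->
  (\int[@leb d]_x G ((x : 'rV[R]_d) + w)%R = \int[@leb d]_x G x)%E.
Proof. by apply: ge0_integral_translation_of => A; exact: leb_translation. Qed.

End lebesgue_facts.

Section integration_facts.
Context {R : realType} {d : nat}.
Implicit Types (x y : 'rV[R]_d) (f phi psi : 'rV[R]_d -> R).

Lemma ball_normP x (r : R) y : ball x r y <-> `|x - y| < r.
Proof. by rewrite -ball_normE. Qed.

Lemma bounded_support_integrable (m : {measure set (Rn R d) -> \bar R}) f x (r C : R) :
  measurable_fun [set: Rn R d] (f : Rn R d -> measurableTypeR R) -> (forall y, `|f y| <= C) ->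
  (forall y, r <= `|x - y| -> f y = 0) -> (m (ball x r : set (Rn R d)) < +oo)%E ->
  m.-integrable [set: Rn R d] (EFin \o f).
Proof.
move=> mf fC f0 mb; have mB := measurable_ball_rV x r.
have : m.-integrable (ball x r : set (Rn R d)) (EFin \o f).
  apply: measurable_bounded_integrable => //; first exact: measurable_funTS.
  exists C; split; first exact: num_real.
  by move=> c Cc y _ /=; rewrite (le_trans (fC y))// ltW.
move=> /(integrable_mkcond _ mB); congr (integrable _ _ _).
apply/funext => y; rewrite patchE; case: ifPn => // yB.
rewrite /= f0// leNgt; apply/negP => h; move/negP: yB; apply.
by rewrite in_setE; apply/ball_normP.
Qed.

Lemma Rintegral_translation (w : 'rV[R]_d) f : measurable_fun [set: Rn R d] (f : Rn R d -> measurableTypeR R) ->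
  \int[@leb R d]_x f ((x : 'rV[R]_d) + w) = \int[@leb R d]_x f x.
Proof.
move=> mf; rewrite /Rintegral; congr fine.
have mf' : measurable_fun [set: Rn R d] (EFin \o f) by exact/measurable_EFinP.
rewrite [LHS]integralE [RHS]integralE; congr (_ - _)%E.
- rewrite -(ge0_integral_translation w (measurable_funepos mf') (fun x => funepos_ge0 _ x)).
  by apply: eq_integral => x _; rewrite !funeposE.
- rewrite -(ge0_integral_translation w (measurable_funeneg mf') (fun x => funeneg_ge0 _ x)).
  by apply: eq_integral => x _; rewrite !funenegE.
Qed.

Lemma smooth_measurable phi : smooth phi -> measurable_fun [set: Rn R d] (phi : Rn R d -> measurableTypeR R).
Proof. by move=> /smooth_continuous; exact: continuous_measurable_rV. Qed.

Lemma supported_within_integrable (m : {measure set (Rn R d) -> \bar R}) phi r :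
  smooth phi -> supported_within r phi -> (forall s, m (ball (0%R : 'rV[R]_d) s : set (Rn R d)) < +oo)%E ->
  m.-integrable [set: Rn R d] (EFin \o phi).
Proof.
move=> sphi rphi mb.
have [C C0 hC] := supported_within_bounded (smooth_continuous sphi) rphi.
apply: (@bounded_support_integrable m phi 0 (r + 1) C) => //; first exact: smooth_measurable.
by move=> y; rewrite sub0r normrN => ry; apply: rphi; rewrite (lt_le_trans _ ry)// ltrDl.
Qed.

Lemma leb_ball_lty (s : R) x : (@leb R d (ball x s) < +oo)%E.
Proof.
have [s0|s0] := ltP 0 s; first by rewrite leb_ball// ltry.
suff -> : ball x s = set0 by rewrite measure0 ltry.
by rewrite -subset0 => y /ball_normP; apply/negP; rewrite -leNgt (le_trans s0).
Qed.

Lemma integral_abs_le (m : {measure set (Rn R d) -> \bar R}) f x (r C V : R) :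
  measurable_fun [set: Rn R d] (f : Rn R d -> measurableTypeR R) -> 0 <= C -> (forall y, `|f y| <= C) ->
  (forall y, r <= `|x - y| -> f y = 0) -> (m (ball x r : set (Rn R d)) <= V%:E)%E ->
  (\int[m]_y (`|f y|)%:E <= (C * V)%:E)%E.
Proof.
move=> mf C0 fC f0 mV; have mB := measurable_ball_rV x r.
have -> : (\int[m]_y (`|f y|)%:E = \int[m]_(y in (ball x r : set (Rn R d))) (`|f y|)%:E)%E.
  rewrite [RHS]integral_mkcond; apply: eq_integral => y _; rewrite patchE; case: ifPn => // yB.
  rewrite f0 ?normr0// leNgt; apply/negP => h; move/negP: yB; apply.
  by rewrite in_setE; apply/ball_normP.
apply: (@le_trans _ _ (C%:E * m (ball x r : set (Rn R d)))%E).
  rewrite -integral_cst//; apply: ge0_le_integral => //.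
  - by apply/measurable_EFinP/measurableT_comp => //; exact: measurable_funTS.
  - by move=> y _; rewrite lee_fin.
by rewrite EFinM lee_wpmul2l// lee_fin.
Qed.

Lemma normr_Rintegral_le (m : {measure set (Rn R d) -> \bar R}) f x (r C V : R) :
  measurable_fun [set: Rn R d] (f : Rn R d -> measurableTypeR R) -> 0 <= C -> (forall y, `|f y| <= C) ->
  (forall y, r <= `|x - y| -> f y = 0) -> (m (ball x r : set (Rn R d)) <= V%:E)%E ->
  `|\int[m]_y f y| <= C * V.
Proof.
move=> mf C0 fC f0 mV.
have mfin : (m (ball x r : set (Rn R d)) < +oo)%E by rewrite (le_lt_trans mV)// ltry.
have intf := bounded_support_integrable mf fC f0 mfin.
apply: (le_trans (le_normr_Rintegral _ intf)) => //.
rewrite -lee_fin /Rintegral fineK; first exact: (integral_abs_le mf C0 fC f0 mV).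
apply: integrable_fin_num => //.
by have := integrable_abse intf; congr (integrable _ _ _).
Qed.

(** The integral of a centered difference of psi is 0 by invariance under translation,
    and this difference is 2 t times the derivative up to O(t^2) by
    centered_difference. *)
Lemma Rintegral_partial psi r i : smooth psi -> supported_within r psi ->
  \int[@leb R d]_x partial i psi x = 0.
Proof.
move=> spsi rpsi.
have sp := smooth_partial i spsi.
have [C C0 hC] := finite_family_bounded (fun j =>
  supported_within_bounded (smooth_continuous (smooth_partial j sp))
    (supported_within_partial j (supported_within_partial i rpsi))).
set I := \int[_]_x _.
pose rho := Num.max r 0 + 2.
have rho0 : 0 < rho by rewrite ltr_wpDl// le_max lexx orbT.
pose V : R := (rho *+ 2) ^+ d.
have key (t : R) : 0 < t -> t < 1 -> `|I| <= C * d%:R * t * V.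
  move=> t0 t1.
  pose D y := psi (y + t *: 'e_i) - psi (y - t *: 'e_i) - 2 * t * partial i psi y.
  have iphi : (@leb R d).-integrable [set: Rn R d] (EFin \o partial i psi).
    by apply: supported_within_integrable sp (supported_within_partial i rpsi) _ => s; exact: leb_ball_lty.
  have sT w : smooth (fun y => psi (y + w)).
    have -> : (fun y => psi (y + w)) = (fun y => 1 * psi (dilation 1 w y)).
      by apply/funext => y; rewrite /dilation scale1r mul1r.
    exact: smooth_dilation.
  have iT w : (@leb R d).-integrable [set: Rn R d] (EFin \o (fun y => psi (y + w))).
    apply: (supported_within_integrable (r := r + `|w|) (sT w)) => [y ry|s]; last exact: leb_ball_lty.
    by apply: rpsi; have := ler_normB (y + w) w; rewrite addrK; lra.
  have mD : measurable_fun [set: Rn R d] (D : Rn R d -> measurableTypeR R).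
    apply: measurable_funB; last by apply: measurable_funM => //; exact: smooth_measurable.
    by apply: measurable_funB; [exact: (smooth_measurable (sT _))|exact: (smooth_measurable (sT (- _)))].
  have DI : \int[@leb R d]_y D y = - (2 * t * I).
    rewrite /D RintegralB//; last 2 first.
    - by have := @integrableB _ _ _ (@leb R d) setT measurableT _ _ (iT (t *: 'e_i)) (iT (- (t *: 'e_i))).
    - by have := @integrableZl _ _ _ (@leb R d) setT measurableT (2 * t) _ iphi.
    rewrite RintegralB//.
    rewrite (Rintegral_translation (t *: 'e_i) (smooth_measurable spsi)).
    rewrite (Rintegral_translation (- (t *: 'e_i)) (smooth_measurable spsi)).
    by rewrite subrr sub0r RintegralZl.
  have DC y : `|D y| <= 2 * t * (C * d%:R * t).
    apply: (le_trans (centered_difference _ _ spsi (ltW t0) C0 hC)).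
    by rewrite subrr normr0 add0r.
  have D0 y : rho <= `|0 - y| -> D y = 0.
    rewrite sub0r normrN => ry.
    have te : `|t *: ('e_i : 'rV[R]_d)| <= 1.
      by rewrite normrZ gtr0_norm// mulr_ile1 ?norm_e// ltW.
    have ry2 : r + 2 <= `|y| by rewrite (le_trans _ ry)// lerD2r le_max lexx.
    rewrite /D rpsi; last first.
      have := ler_normB (y + t *: 'e_i) (t *: 'e_i); rewrite addrK; lra.
    rewrite rpsi; last first.
      have := ler_normD (y - t *: 'e_i) (t *: 'e_i); rewrite subrK; lra.
    rewrite (supported_within_partial i rpsi) ?mulr0 ?subrr//; lra.
  have C1 : 0 <= 2 * t * (C * d%:R * t) by rewrite !mulr_ge0// ltW.
  have lV : (@leb R d (ball 0%R rho) <= V%:E)%E by rewrite leb_ball.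
  have := normr_Rintegral_le mD C1 DC D0 lV.
  have t2 : 0 < 2 * t by rewrite mulr_gt0.
  by rewrite DI normrN normrM gtr0_norm// -[leRHS]mulrA ler_pM2l.
apply/eqP; rewrite -normr_le0; apply/ler_addgt0Pl => e e0; rewrite addr0.
pose B := C * d%:R * V + 1.
have V0 : 0 <= V by rewrite exprn_ge0// mulrn_wge0// ltW.
have B0 : 0 < B by rewrite ltr_wpDl// !mulr_ge0.
pose t := Num.min (2^-1) (e / B).
have t0 : 0 < t by rewrite lt_min invr_gt0 divr_gt0//= ltr0n.
have t1 : t < 1 by rewrite gt_min invf_lt1 ?ltr1n.
apply: (le_trans (key t t0 t1)).
rewrite mulrAC (@le_trans _ _ (B * t))//; first by rewrite ler_pM2r// /B lerDl.
by rewrite -ler_pdivlMl// mulrC ge_min lexx orbT.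
Qed.

End integration_facts.

(** * Regularity of finite measures and a covering bound *)

Section neighbourhoods.
Context {R : realType} {d : nat}.
Implicit Types (x y : 'rV[R]_d) (K A : set 'rV[R]_d) (s : R).

Definition thicken K s : set 'rV[R]_d := \bigcup_(x in K) ball x s.

Lemma open_thicken K s : open (thicken K s).
Proof. by apply: bigcup_open => x _; exact: ball_open. Qed.

Lemma measurable_thicken K s : measurable (thicken K s : set (Rn R d)).
Proof. by apply: open_measurable_rV; exact: open_thicken. Qed.

Lemma thicken_le K s1 s2 : s1 <= s2 -> thicken K s1 `<=` thicken K s2.
Proof. by move=> s12 y [x Kx xy]; exists x => //; exact: le_ball xy. Qed.

Lemma closed_measurable_rV A : closed A -> measurable (A : set (Rn R d)).
Proof.
by move=> cA; rewrite -[A]setCK; apply: measurableC; apply: open_measurable_rV; exact: closed_openC.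
Qed.

Lemma bigcap_thicken K : closed K -> \bigcap_n thicken K n.+1%:R^-1 = K.
Proof.
move=> cK; apply/seteqP; split=> [y h|y Ky n _]; last first.
  by exists y => //; exact: ballxx.
apply: contrapT => Ky.
have : nbhs y (~` K) by apply: open_nbhs_nbhs; split; [exact: closed_openC|].
move=> /nbhs_ballP[e /= e0 eK].
have [n ne] : exists n : nat, n.+1%:R^-1 < e.
  by have [n _ /(_ n (leqnn _))] := near_infty_natSinv_lt (PosNum e0); exists n.
have [x Kx xy] := h n Logic.I.
by apply: (eK x) => //; apply/ball_sym; apply: le_ball xy; exact: ltW.
Qed.

(** The sets thicken K s minus K decrease to the empty set when s tends to 0, because
    K is closed. *)
Lemma thin_thicken (m : {finite_measure set (Rn R d) -> \bar R}) K (e : R) : closed K -> 0 < e ->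
  exists2 s, 0 < s & (m (thicken K s `\` K : set (Rn R d)) < e%:E)%E.
Proof.
move=> cK e0; have mK := closed_measurable_rV cK.
pose F n : set (Rn R d) := thicken K n.+1%:R^-1 `\` K.
have mF n : measurable (F n) by apply: measurableD => //; exact: measurable_thicken.
have F0 : \bigcap_n F n = set0.
  rewrite -subset0 => y h; have : (\bigcap_n thicken K n.+1%:R^-1) y by move=> n _; have [] := h n Logic.I.
  by rewrite bigcap_thicken//; have [] := h 0%N Logic.I.
have : m \o F @ \oo --> m (\bigcap_n F n).
  apply: nonincreasing_cvg_mu => //.
  - by rewrite ltey_eq fin_num_measure.
  - by rewrite F0.
  - move=> a b ab; apply/subsetPset => y [yb yK]; split => //; apply: thicken_le yb.
    by rewrite lef_pV2 ?posrE// ler_nat ltnS.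
rewrite F0 measure0 => /fine_cvgP[_] /cvgrPdist_lt /(_ _ e0) [N _ /(_ N (leqnn _))] /=.
rewrite sub0r normrN => H; exists N.+1%:R^-1; first by rewrite invr_gt0.
have fm : m (F N) \is a fin_num by rewrite fin_num_measure.
by rewrite -(fineK fm) lte_fin; apply: le_lt_trans H; exact: ler_norm.
Qed.

(** Approximation from inside and from outside are required together: only then is the
    property stable under complements. *)
Definition squeezed (m : set (Rn R d) -> \bar R) (A : set (Rn R d)) := forall e : R, 0 < e ->
  exists F O : set 'rV[R]_d, [/\ closed F, open O, F `<=` A, A `<=` O & (m (O `\` F : set (Rn R d)) < e%:E)%E].

Lemma squeezed_open (m : {finite_measure set (Rn R d) -> \bar R}) (A : set 'rV[R]_d) : open A -> squeezed m A.
Proof.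
move=> oA e e0; have [|s s0 H] := @thin_thicken m (~` A) e _ e0; first exact: open_closedC.
exists (~` thicken (~` A) s), A; split => //.
- by apply: open_closedC; exact: open_thicken.
- move=> y ty; apply: contrapT => Ay; apply: ty; exists y => //; exact: ballxx.
- by move: H; rewrite !setDE !setCK setIC.
Qed.

(** The inner sets are united up to a large finite index only, for an infinite union
    of closed sets need not be closed. *)
Lemma squeezed_bigcup (m : {finite_measure set (Rn R d) -> \bar R}) (A : nat -> set (Rn R d)) :
  (forall n, squeezed m (A n)) -> squeezed m (\bigcup_n A n).
Proof.
move=> hA e e0.
have e4 n : 0 < e / 4 / (2 ^ n.+1)%:R by rewrite !divr_gt0// ltr0n expn_gt0.
have [F hF] := choice (fun n => hA n _ (e4 n)).
have [V hV] := choice hF.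
pose V' : set 'rV[R]_d := \bigcup_n V n; pose F' : set 'rV[R]_d := \bigcup_n F n.
have oV : open V' by apply: bigcup_open => n _; have [] := hV n.
have mV := open_measurable_rV oV.
have mF n : measurable (F n : set (Rn R d)) by apply: closed_measurable_rV; have [] := hV n.
pose G n : set 'rV[R]_d := \big[setU/set0]_(i < n) F i.
have mG n : measurable (G n : set (Rn R d)) by apply: bigsetU_measurable => i _; exact: mF.
have mD n : measurable (V' `\` G n : set (Rn R d)) by apply: measurableD.
have mF' : measurable (F' : set (Rn R d)) by apply: bigcupT_measurable.
have GE : \bigcap_n (V' `\` G n) = V' `\` F'.
  apply/seteqP; split => [y h|y [Oy Fy] n _].
    split; first by have [] := h 0%N Logic.I.
    move=> [n _ Fy]; have [_] := h n.+1 Logic.I; apply.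
    by rewrite /G big_ord_recr /=; right.
  by split => //; rewrite /G -bigcup_mkord => -[k _ Fk]; apply: Fy; exists k.
have cv : m \o (fun n => V' `\` G n) @ \oo --> m (V' `\` F').
  rewrite -GE; apply: nonincreasing_cvg_mu => //.
  - by rewrite ltey_eq fin_num_measure.
  - by rewrite GE; exact: measurableD.
  - move=> a b ab; apply/subsetPset => y [yO yG]; split => // yGa; apply: yG.
    by move: yGa; rewrite /G -!bigcup_mkord => -[k /= ka Fk]; exists k => //=; exact: leq_trans ab.
have small : (m (V' `\` F' : set (Rn R d)) <= (e / 4)%:E)%E.
  have mVF n : measurable (V n `\` F n : set (Rn R d)).
    by apply: measurableD => //; apply: open_measurable_rV; have [] := hV n.
  have := @measure_sigma_subadditive _ _ _ m (V' `\` F') (fun n => V n `\` F n) mVF.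
  move=> /(_ (measurableD mV mF')) H.
  apply: (le_trans (H _)).
    move=> y [[n _ Vy] Fy]; exists n => //; split => // Fn; apply: Fy; by exists n.
  apply: (@le_trans _ _ (\sum_(n <oo) (e / 4 / (2 ^ n.+1)%:R)%:E)%E).
    by apply: lee_nneseries => // n _; apply: ltW; have [] := hV n.
  by apply: epsilon_trick0; rewrite divr_ge0// ltW.
have fE n : m (V' `\` G n : set (Rn R d)) \is a fin_num by rewrite fin_num_measure.
have fV : m (V' `\` F' : set (Rn R d)) \is a fin_num by rewrite fin_num_measure//; exact: measurableD.
move: cv; rewrite -(fineK fV) => /fine_cvgP[_] /cvgrPdist_lt /(_ (e / 4)) [|N _ /(_ N (leqnn _))]; first by rewrite divr_gt0.
move=> /= H.
exists (G N), V'; split => //.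
- by rewrite /G; apply: closed_bigsetU => i _; have [] := hV i.
- by rewrite /G -bigcup_mkord => y [k _ Fk]; exists k => //; have [_ _ + _ _] := hV k; exact.
- by move=> y [k _ Ak]; exists k => //; have [_ _ _ + _] := hV k; exact.
- rewrite -(fineK (fE N)) lte_fin.
  have : fine (m (V' `\` F')) <= e / 4.
    by rewrite -lee_fin fineK// fin_num_measure//; exact: measurableD.
  move: H; set a := fine _; set b := fine _ => H h.
  have : b - a <= `|a - b| by rewrite distrC ler_norm.
  lra.
Qed.

Lemma measurable_squeezed (m : {finite_measure set (Rn R d) -> \bar R}) (A : set (Rn R d)) :
  measurable A -> squeezed m A.
Proof.
suff H : <<s @open 'rV[R]_d >> `<=` squeezed m by move=> mA; exact: H.
apply: smallest_sub.
- split.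
  + by apply: squeezed_open; exact: open0.
  + move=> B hB e e0; have [F [V [cF oV FB BO H]]] := hB e e0.
    exists (~` V), (~` F); split.
    * exact: open_closedC.
    * exact: closed_openC.
    * by move=> y Vy; split => // By; apply: Vy; exact: BO.
    * by move=> y [_ By] Fy; apply: By; exact: FB.
    * by move: H; rewrite !setDE setCK setIC.
  + by move=> B hB; exact: squeezed_bigcup.
- by move=> B oB; exact: squeezed_open.
Qed.

Lemma inner_regular (m : {finite_measure set (Rn R d) -> \bar R}) (A : set (Rn R d)) (e : R) :
  measurable A -> 0 < e ->
  exists F : set 'rV[R]_d, [/\ closed F, F `<=` A & (m (A `\` F) < e%:E)%E].
Proof.
move=> mA e0; have [F [V [cF oV FA AO H]]] := measurable_squeezed m mA e0.
exists F; split => //; apply: le_lt_trans H; apply: le_measure; rewrite ?inE.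
- by apply: measurableD => //; exact: closed_measurable_rV.
- by apply: measurableD; [exact: open_measurable_rV|exact: closed_measurable_rV].
- by apply: setSD.
Qed.

End neighbourhoods.

Section covering.
Context {R : realType} {d : nat}.
Implicit Types (x y : 'rV[R]_d) (K : set 'rV[R]_d) (rad : 'rV[R]_d -> R).

Let B rad x := ball x (rad x).

Lemma seq_argmax rad (s : seq 'rV[R]_d) : s != [::] ->
  exists2 y, y \in s & forall x, x \in s -> rad x <= rad y.
Proof.
elim: s => // a [_ _|b s IH _].
  by exists a; rewrite ?mem_head// => x; rewrite inE => /eqP ->.
have [//|y ys hy] := IH.
have [ay|ya] := leP (rad a) (rad y).
  exists y; first by rewrite inE ys orbT.
  by move=> x; rewrite inE => /predU1P[->//|/hy].
exists a; rewrite ?mem_head// => x; rewrite inE => /predU1P[->//|/hy h].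
by rewrite (le_trans h)// ltW.
Qed.

(** The greedy selection of Vitali: take a largest ball, discard those that meet it,
    and repeat. A discarded ball is not larger than the selected ball it meets, hence
    lies in three times the latter. *)
Lemma disjoint_subfamily rad (s : seq 'rV[R]_d) : (forall x, x \in s -> 0 < rad x) ->
  exists D : seq 'rV[R]_d, [/\ {subset D <= s}, pairwise (fun x y => B rad x `&` B rad y == set0) D &
    forall x, x \in s -> exists2 y, y \in D & B rad x `<=` ball y (3 * rad y)].
Proof.
have [n] := ubnP (size s); elim: n s => // n IH s /ltnSE sn r0.
have [->|s0] := eqVneq s [::]; first by exists [::]; split.
have [y ys ymax] := seq_argmax rad s0.
pose s' := [seq x <- s | B rad y `&` B rad x == set0].
have s's x : x \in s' -> x \in s by rewrite mem_filter => /andP[].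
have yy : B rad y y by apply: ballxx; exact: r0.
have [||D [Ds pD cD]] := IH s'.
- apply: leq_trans sn; rewrite -(count_predC (fun x => B rad y `&` B rad x == set0) s) size_filter.
  rewrite -addn1 leq_add2l -has_count; apply/hasP; exists y => //=.
  by apply/set0P; exists y.
- by move=> x /s's /r0.
exists (y :: D); split.
- by move=> x; rewrite inE => /predU1P[->//|/Ds /s's].
- rewrite /= pD andbT; apply/allP => x /Ds.
  by rewrite mem_filter => /andP[].
- move=> x xs; have [xy|xy] := boolP (B rad y `&` B rad x == set0).
    have [|z zD hz] := cD x; first by rewrite mem_filter xy.
    by exists z => //; rewrite inE zD orbT.
  exists y; first exact: mem_head.
  move: xy => /set0P[w [yw xw]] v xv.
  have xy := ymax x xs.
  move: yw xw xv; rewrite /B => /ball_normP yw /ball_normP xw /ball_normP xv; apply/ball_normP.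
  have -> : y - v = (y - w) - (x - w) + (x - v).
    by apply/rowP => j; rewrite !mxE; ring.
  have h1 := ler_normD (y - w - (x - w)) (x - v); have h2 := ler_normB (y - w) (x - w).
  lra.
Qed.

Lemma measure_disjoint_family (m : {measure set (Rn R d) -> \bar R}) rad (D : seq 'rV[R]_d) (A : set (Rn R d)) :
  measurable A -> pairwise (fun x y => B rad x `&` B rad y == set0) D ->
  (forall x, x \in D -> B rad x `<=` A) -> (\sum_(x <- D) m (B rad x : set (Rn R d)) <= m A)%E.
Proof.
elim: D A => [|x D IH] A mA; first by rewrite big_nil measure_ge0.
rewrite /= => /andP[/allP xD pD] DA; rewrite big_cons.
have mB := measurable_ball_rV x (rad x).
rewrite (measureDI m mA mB) addeC; apply: leeD.
  apply: IH => //; first exact: measurableD.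
  move=> y yD z yz; split; first by apply: DA yz; rewrite inE yD orbT.
  move=> xz; have /eqP := xD y yD; rewrite -subset0 => /(_ z); apply; by split.
rewrite setIidr//; apply: DA; exact: mem_head.
Qed.

Lemma measure_cover_seq (I : eqType) (m : {measure set (Rn R d) -> \bar R}) (C : I -> set (Rn R d))
    (D : seq I) (A : set (Rn R d)) : measurable A -> (forall i, measurable (C i)) ->
  (forall z, A z -> exists2 i, i \in D & C i z) -> (m A <= \sum_(x <- D) m (C x))%E.
Proof.
elim: D A => [|x D IH] A mA mC AD.
  suff -> : A = set0 by rewrite measure0 big_nil.
  by rewrite -subset0 => z /AD[].
rewrite big_cons (measureDI m mA (mC x)) addeC; apply: leeD.
  by apply: le_measure; rewrite ?inE//; exact: measurableI.
apply: IH => // [|z [Az Cz]]; first exact: measurableD.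
have [y] := AD z Az; rewrite inE => /predU1P[->//|yD Cy]; by exists y.
Qed.

(** Points at which m is dense at some scale are covered by finitely many such balls,
    from which disjoint ones are selected; 6 = 2 * 3 comes from the factor 3 of the
    selection and from the volume (2r)^d of a ball. *)
Lemma covering_bound (m : {measure set (Rn R d) -> \bar R}) K (s0 theta : R) : 0 < theta ->
  compact K ->
  (forall x, K x -> exists s, [/\ 0 < s, s <= s0 & ((theta * s ^+ d)%:E < m (ball x s : set (Rn R d)))%E]) ->
  (theta%:E * @leb R d K <= (6 ^+ d)%:E * m (thicken K s0 : set (Rn R d)))%E.
Proof.
move=> th0 cK H.
have /choice[rad hrad] : forall x, exists s, K x -> [/\ 0 < s, s <= s0 & ((theta * s ^+ d)%:E < m (ball x s : set (Rn R d)))%E].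
  move=> x; have [Kx|nKx] := pselect (K x); last by exists 0.
  by have [s hs] := H x Kx; exists s.
have := cK; rewrite compact_cover => /(_ _ K (fun x => ball x (rad x))).
case=> [x Kx|x Kx|D DK KD]; first exact: ball_open.
  by exists x => //; apply: ballxx; have [] := hrad x Kx.
have KD' x : x \in finmap.enum_fset D -> K x by move=> xD; have := DK x xD; rewrite in_setE.
have [|E [ED pE cE]] := @disjoint_subfamily rad (finmap.enum_fset D).
  by move=> x /KD' /hrad[].
have mK : measurable (K : set (Rn R d)).
  by apply: closed_measurable_rV; apply: compact_closed => //; exact: norm_hausdorff.
have h1 : (@leb R d K <= \sum_(x <- E) @leb R d (ball x (3 * rad x)))%E.
  apply: measure_cover_seq => // [x|z /KD[x /= xD xz]]; first exact: measurable_ball_rV.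
  by have [y yE hy] := cE x xD; exists y => //; exact: hy.
have h2 : (\sum_(x <- E) m (B rad x : set (Rn R d)) <= m (thicken K s0 : set (Rn R d)))%E.
  apply: measure_disjoint_family => //; first exact: measurable_thicken.
  move=> x /ED /KD' Kx z xz; exists x => //.
  by apply: le_ball xz; have [] := hrad x Kx.
apply: (@le_trans _ _ (theta%:E * (\sum_(x <- E) @leb R d (ball x (3 * rad x))))%E).
  by rewrite lee_wpmul2l// lee_fin ltW.
apply: (@le_trans _ _ ((6 ^+ d)%:E * (\sum_(x <- E) m (B rad x : set (Rn R d))))%E); last first.
  by rewrite lee_wpmul2l// lee_fin exprn_ge0.
rewrite !ge0_sume_distrr//.
rewrite big_seq [leRHS]big_seq; apply: lee_sum => x /ED /KD' /hrad[r0 _ hx].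
rewrite leb_ball ?mulr_gt0// -EFinM.
have -> : theta * (3 * rad x *+ 2) ^+ d = 6 ^+ d * (theta * rad x ^+ d).
  have -> : 3 * rad x *+ 2 = 6 * rad x by ring.
  by rewrite exprMn mulrCA.
by rewrite EFinM lee_wpmul2l ?lee_fin ?exprn_ge0// ltW.
Qed.

End covering.

(** * Integrals over moving balls *)

Lemma mem_iff (T1 T2 : Type) (A : set T1) (B : set T2) a b : (A a <-> B b) -> (a \in A) = (b \in B).
Proof. by move=> [h1 h2]; apply/idP/idP; rewrite !in_setE. Qed.

Section ball_averages.
Context {R : realType} {d : nat}.
Implicit Types (x y : 'rV[R]_d) (r s : R).

Lemma measurable_near_diagonal r :
  measurable [set p : Rn R d * Rn R d | ball (p.1 : 'rV[R]_d) r (p.2 : 'rV[R]_d)].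
Proof.
have [r0|r0] := ltP 0 r; last first.
  rewrite (_ : [set p | _] = set0)//; rewrite -subset0 => -[x y] /= /ball_normP.
  by apply/negP; rewrite -leNgt (le_trans r0).
have -> : [set p : Rn R d * Rn R d | ball (p.1 : 'rV[R]_d) r (p.2 : 'rV[R]_d)] =
    \bigcap_(i in [set: 'I_d]) ((fun p : Rn R d * Rn R d => (p.1 : 'rV[R]_d) 0 i - (p.2 : 'rV[R]_d) 0 i)
      @^-1` ball (0 : R) r).
  apply/seteqP; split => [[x y] /= xy i _|[x y] /= xy].
    by rewrite /ball/= sub0r normrN; move: xy; rewrite ball_rVE// => /(_ i).
  rewrite ball_rVE// => i; have := xy i Logic.I.
  by rewrite /ball/= sub0r normrN.
apply: fin_bigcap_measurable => // i _.
have mf : measurable_fun [set: Rn R d * Rn R d]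
   (fun p : Rn R d * Rn R d => (p.1 : 'rV[R]_d) 0 i - (p.2 : 'rV[R]_d) 0 i : measurableTypeR R).
  apply: measurable_funB.
    exact: (measurableT_comp (measurable_coord i) measurable_fst).
  exact: (measurableT_comp (measurable_coord i) measurable_snd).
by rewrite -[X in measurable X]setTI; apply: mf => //; exact: measurable_ball.
Qed.

Local Open Scope ereal_scope.

Definition ball_mass (m : set (Rn R d) -> \bar R) (f : Rn R d -> \bar R) r (x : Rn R d) : \bar R :=
  \int[m]_(y in (ball (x : 'rV[R]_d) r : set (Rn R d))) f y.

Section tonelli.
Variables (m : {sigma_finite_measure set (Rn R d) -> \bar R}) (f : Rn R d -> \bar R) (r : R).
Hypotheses (mf : measurable_fun setT f) (f0 : forall y, 0 <= f y).

Let F (p : Rn R d * Rn R d) : \bar R :=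
  f p.2 * (\1_[set p : Rn R d * Rn R d | ball (p.1 : 'rV[R]_d) r (p.2 : 'rV[R]_d)] p)%:E.

Let mF : measurable_fun setT F.
Proof.
apply: emeasurable_funM; first exact: measurableT_comp mf measurable_snd.
by apply/measurable_EFinP; apply: measurable_indic; exact: measurable_near_diagonal.
Qed.

Let F0 p : 0 <= F p. Proof. by rewrite mule_ge0// lee_fin. Qed.

Let ball_massE x : ball_mass m f r x = \int[m]_y F (x, y).
Proof.
rewrite /ball_mass integral_mkcond; apply: eq_integral => y _.
rewrite patchE /F/= indicE.
rewrite (@mem_iff _ _ _ (ball (x : 'rV[R]_d) r) (x, y) y)//.
by case: ifPn => yB; rewrite /= ?mule1 ?mule0.
Qed.

Lemma measurable_ball_mass : measurable_fun setT (ball_mass m f r).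
Proof.
rewrite (_ : ball_mass m f r = fubini_F m F); last by apply/funext => x; rewrite ball_massE.
exact: measurable_fun_fubini_tonelli_F.
Qed.

Lemma ball_mass_ge0 x : 0 <= ball_mass m f r x.
Proof. exact: integral_ge0. Qed.

(** By Tonelli: a point y is counted by all x in the ball of radius r around y, whose
    volume is (2r)^d. *)
Lemma integral_ball_mass : (0 < r)%R ->
  \int[@leb R d]_x ball_mass m f r x = ((r *+ 2) ^+ d)%:E * \int[m]_y f y.
Proof.
move=> r0; under eq_integral do rewrite ball_massE.
rewrite (fubini_tonelli (m1 := @leb R d) (m2 := m) F mF F0).
rewrite -ge0_integralZl//; last by rewrite lee_fin exprn_ge0// mulrn_wge0// ltW.
apply: eq_integral => y _.
transitivity (\int[@leb R d]_x (f y * (\1_(ball (y : 'rV[R]_d) r : set (Rn R d)) x)%:E)).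
  apply: eq_integral => x _; rewrite /F/= !indicE; congr (_ * (nat_of_bool _)%:R%:E).
  by apply: mem_iff; split => /ball_sym.
rewrite ge0_integralZl//; last first.
  by apply/measurable_EFinP; apply: measurable_indic; exact: measurable_ball_rV.
rewrite integral_indic//; last exact: measurable_ball_rV.
rewrite setIT muleC; congr (_ * _).
exact: leb_ball.
Qed.

End tonelli.

End ball_averages.

(** * Bounded measurable functions and rescaled kernels *)

Section bounded_measurable.
Context {R : realType} {d : nat}.
Implicit Types (f g k : 'rV[R]_d -> R).

Definition bounded_measurable f :=
  measurable_fun [set: Rn R d] (f : Rn R d -> measurableTypeR R) /\ exists C, forall y, `|f y| <= C.

Lemma bounded_measurableD f g : bounded_measurable f -> bounded_measurable g ->
  bounded_measurable (fun y => f y + g y).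
Proof.
move=> [mf [C hC]] [mg [D hD]]; split; first exact: measurable_funD.
by exists (C + D) => y; rewrite (le_trans (ler_normD _ _))// lerD.
Qed.

Lemma bounded_measurableZ a f : bounded_measurable f -> bounded_measurable (fun y => a * f y).
Proof.
move=> [mf [C hC]]; split; first exact: measurable_funM.
by exists (`|a| * C) => y; rewrite normrM ler_wpM2l.
Qed.

Lemma bounded_measurableB f g : bounded_measurable f -> bounded_measurable g ->
  bounded_measurable (fun y => f y - g y).
Proof.
move=> bf bg; have := bounded_measurableD bf (bounded_measurableZ (-1) bg).
by congr bounded_measurable; apply/funext => y; rewrite mulN1r.
Qed.

Lemma bounded_measurable_sum (n : nat) (F : 'I_n -> 'rV[R]_d -> R) :
  (forall i, bounded_measurable (F i)) -> bounded_measurable (fun y => \sum_i F i y).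
Proof.
move=> bF; rewrite (_ : (fun y => _) = (\sum_i F i)); last by apply/funext => y; rewrite fct_sumE.
apply: (big_ind bounded_measurable) => //.
  by split; [exact: measurable_cst|exists 0 => y; rewrite normr0].
exact: bounded_measurableD.
Qed.

Lemma bounded_measurable_smooth f r : smooth f -> supported_within r f -> bounded_measurable f.
Proof.
move=> sf rf; split; first exact: smooth_measurable.
by have [C _ hC] := supported_within_bounded (smooth_continuous sf) rf; exists C.
Qed.

Lemma integrable_mul_bounded (m : {measure set (Rn R d) -> \bar R}) (g : Rn R d -> R) f :
  m.-integrable [set: Rn R d] (EFin \o g) -> bounded_measurable f ->
  m.-integrable [set: Rn R d] (EFin \o (fun y => g y * f y)).
Proof.
move=> ig [mf [C hC]].
have := @integrableMr _ _ _ m setT measurableT f (EFin \o g) mf _ ig.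
have bf : [bounded f x | x in [set: Rn R d]].
  exists C; split; first exact: num_real.
  by move=> M CM y _ /=; rewrite (le_trans (hC y))// ltW.
move=> /(_ bf); congr (integrable _ _ _); apply/funext => y.
by rewrite /= -EFinM mulrC.
Qed.

(** The equation of h enters the estimates through integration against rho - mu, of
    which linearity on bounded measurable functions and a bound are the only
    properties used. *)
Definition linear_functional (L : ('rV[R]_d -> R) -> R) :=
  (forall f g, bounded_measurable f -> bounded_measurable g -> L (fun y => f y + g y) = L f + L g) /\
  (forall a f, bounded_measurable f -> L (fun y => a * f y) = a * L f).

Lemma linear_functionalB L f g : linear_functional L -> bounded_measurable f -> bounded_measurable g ->
  L (fun y => f y - g y) = L f - L g.
Proof.
move=> [LD LZ] bf bg; rewrite -mulN1r -LZ// -LD//; last exact: bounded_measurableZ.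
by congr L; apply/funext => y; rewrite mulN1r.
Qed.

Lemma linear_functional_sum L (n : nat) (F : 'I_n -> 'rV[R]_d -> R) : linear_functional L ->
  (forall i, bounded_measurable (F i)) -> L (fun y => \sum_i F i y) = \sum_i L (F i).
Proof.
move=> [LD LZ]; elim: n F => [|n IH] F bF.
  rewrite big_ord0; have b0 : bounded_measurable (fun=> 0).
    by split; [exact: measurable_cst|exists 0 => y; rewrite normr0].
  rewrite -[RHS](mul0r (L (fun=> 0))) -LZ//.
  by congr L; apply/funext => y; rewrite big_ord0 mulr0.
rewrite big_ord_recr /= -IH// -LD//; last exact: bounded_measurable_sum.
by congr L; apply/funext => y; rewrite big_ord_recr.
Qed.

Lemma linear_functional_integral (m : {measure set (Rn R d) -> \bar R}) (g : Rn R d -> R) :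
  m.-integrable [set: Rn R d] (EFin \o g) -> linear_functional (fun f => \int[m]_y (g y * f y)).
Proof.
move=> ig; split => [f1 f2 b1 b2|a f bf].
  rewrite -RintegralD//; [|exact: integrable_mul_bounded ig b1|exact: integrable_mul_bounded ig b2].
  by apply: eq_Rintegral => y _; rewrite mulrDr.
rewrite -RintegralZl//; last exact: integrable_mul_bounded ig bf.
by apply: eq_Rintegral => y _; rewrite mulrCA.
Qed.

Lemma linear_functional_difference (m1 m2 : {finite_measure set (Rn R d) -> \bar R}) :
  linear_functional (fun f => \int[m1]_y f y - \int[m2]_y f y).
Proof.
have i1 (m : {finite_measure set (Rn R d) -> \bar R}) : m.-integrable [set: Rn R d] (EFin \o cst (1 : R)).
  exact: finite_measure_integrable_cst.
have L (m : {finite_measure set (Rn R d) -> \bar R}) : linear_functional (fun f => \int[m]_y f y).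
  rewrite (_ : (fun f => _) = (fun f => \int[m]_y (cst 1 y * f y))); last first.
    by apply/funext => f; apply: eq_Rintegral => y _; rewrite mul1r.
  exact: (linear_functional_integral (i1 m)).
have [D1 Z1] := L m1; have [D2 Z2] := L m2.
split => [f g bf bg|a f bf]; first by rewrite D1// D2//; ring.
by rewrite Z1// Z2// mulrBr.
Qed.

End bounded_measurable.

Section rescaled_kernels.
Context {R : realType} {d : nat}.
Implicit Types (x y u v : 'rV[R]_d) (r s : R) (i j : 'I_d) (phi : 'rV[R]_d -> R).

Definition rescale s x y : 'rV[R]_d := dilation s^-1 (- (s^-1 *: x)) y.

Lemma rescaleE s x y : rescale s x y = s^-1 *: (y - x).
Proof. by rewrite /rescale /dilation scalerBr. Qed.

Lemma norm_rescale s x y : 0 < s -> `|rescale s x y| = s^-1 * `|x - y|.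
Proof. by move=> s0; rewrite rescaleE normrZ gtr0_norm ?invr_gt0// distrC. Qed.

Lemma smooth_rescale phi s x (c : R) : smooth phi -> smooth (fun y => c * phi (rescale s x y)).
Proof. exact: smooth_dilation. Qed.

Lemma partial_rescale phi s x (c : R) i : smooth phi ->
  partial i (fun y => c * phi (rescale s x y)) = fun y => c / s * partial i phi (rescale s x y).
Proof. exact: partial_dilation. Qed.

Lemma rescale_eq0 phi s x y : supported_within 1 phi -> 0 < s -> s < `|x - y| -> phi (rescale s x y) = 0.
Proof.
by move=> sphi s0 sxy; apply: sphi; rewrite norm_rescale// mulrC ltr_pdivlMr// mul1r.
Qed.

Lemma supported_within_rescale phi s x (c : R) : supported_within 1 phi -> 0 < s ->
  supported_within (`|x| + s) (fun y => c * phi (rescale s x y)).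
Proof.
move=> sphi s0 y xsy; rewrite rescale_eq0 ?mulr0//.
have := ler_normB x (x - y); rewrite opprB addrC subrK; lra.
Qed.

Lemma bounded_measurable_rescale phi s x (c : R) : smooth phi -> supported_within 1 phi -> 0 < s ->
  bounded_measurable (fun y => c * phi (rescale s x y)).
Proof.
move=> smphi sphi s0; apply: bounded_measurable_smooth; first exact: smooth_rescale.
exact: supported_within_rescale.
Qed.

Lemma rescale_shift s x (t : R) i y : 
  rescale s (x - t *: 'e_i) y = rescale s x y + (t / s) *: 'e_i /\
  rescale s (x + t *: 'e_i) y = rescale s x y - (t / s) *: 'e_i.
Proof.
by rewrite !rescaleE; split; apply/rowP => j; rewrite !mxE; ring.
Qed.

(** At scale s the shift by r is a shift by r/s, and replacing x by x0 moves the
    argument by at most r/s. *)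
Lemma rescaled_difference phi s x x0 r (C : R) i y : smooth phi -> 0 < s -> 0 <= r -> 0 <= C ->
  (forall j y, `|partial j (partial i phi) y| <= C) -> `|x - x0| <= r ->
  `|phi (rescale s (x - r *: 'e_i) y) - phi (rescale s (x + r *: 'e_i) y)
     - 2 * (r / s) * partial i phi (rescale s x0 y)| <= 4 * C * d%:R * (r / s) ^+ 2.
Proof.
move=> sphi s0 r0 C0 hC xx0.
have [-> ->] := rescale_shift s x r i y.
have rs : 0 <= r / s by rewrite divr_ge0// ltW.
apply: (le_trans (centered_difference _ _ sphi rs C0 hC)).
have : `|rescale s x y - rescale s x0 y| <= r / s.
  rewrite !rescaleE -scalerBr opprB [y - x + _]addrC addrA subrK normrZ gtr0_norm ?invr_gt0//.
  by rewrite mulrC ler_pM2r ?invr_gt0// distrC.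
move=> h; have -> : 4 * C * d%:R * (r / s) ^+ 2 = 2 * (r / s) * (C * d%:R * (r / s + r / s)) by ring.
apply: ler_wpM2l; first by rewrite mulr_ge0.
by apply: ler_wpM2l; [rewrite mulr_ge0|rewrite lerD2r].
Qed.

End rescaled_kernels.

(** * Thin neighbourhoods and cross-shaped sets *)

Section upper_bound.
Context {R : realType} {d : nat}.
Implicit Types (x y : 'rV[R]_d) (r s : R) (i j k : 'I_d).

Lemma ball_mass_indic (m : {measure set (Rn R d) -> \bar R}) (B : set (Rn R d)) r x :
  ball x r `<=` B -> ball_mass m (fun y => (\1_B y)%:E) r x = m (ball x r : set (Rn R d)).
Proof.
move=> rB; rewrite /ball_mass -[RHS]mul1e -integral_cst//; last exact: measurable_ball_rV.
by apply: eq_integral => y; rewrite inE => /rB By; rewrite indicE mem_set.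
Qed.

Lemma normr_Rintegral_lee (m : {measure set (Rn R d) -> \bar R}) (f : Rn R d -> R) :
  m.-integrable [set: Rn R d] (EFin \o f) -> ((`|\int[m]_y f y|)%:E <= \int[m]_y (`|f y|)%:E)%E.
Proof.
move=> imf; have imn := integrable_norm imf.
have fin := integrable_fin_num measurableT imn.
rewrite -(fineK fin) lee_fin.
exact: (le_normr_Rintegral measurableT imf).
Qed.

(** f vanishes on K and the measure of thicken K t minus K tends to 0. The finiteness
    of the measure of W is what makes the latter true, by continuity from above. *)
Lemma integral_vanishing_thicken (K W : set 'rV[R]_d) (f : Rn R d -> R) (e : R) : closed K ->
  measurable (W : set (Rn R d)) -> (@leb R d W < +oo)%E -> (@leb R d).-integrable [set: Rn R d] (EFin \o f) ->
  (forall y, K y -> f y = 0) -> (forall y, ~ W y -> f y = 0) -> 0 < e ->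
  exists2 s, 0 < s & forall t, t <= s -> (\int[@leb R d]_y (`|f y| * \1_(thicken K t : set (Rn R d)) y)%:E <= e%:E)%E.
Proof.
move=> cK mW fW intf fK fW0 e0.
have [a [a0 ha]] := integral_normr_continuous intf e0.
pose m := mfrestr mW fW.
(* The measure m is Lebesgue measure on W, and a is the modulus of absolute continuity
   of the integral of |f|. *)
have [s s0 hs] := @thin_thicken R d m K a cK a0.
exists s => // t ts.
pose E : set (Rn R d) := (thicken K s `\` K) `&` W.
have mE : measurable E.
  by apply: measurableI => //; apply: measurableD; [exact: measurable_thicken|exact: closed_measurable_rV].
have := ha E mE hs.
have ifE : (@leb R d).-integrable E (EFin \o f) by apply: integrableS intf.
have ifn := integrable_norm ifE.
have fin := integrable_fin_num mE ifn.
rewrite /Rintegral -lte_fin fineK// => /ltW; apply: le_trans.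
have mf : measurable_fun [set: Rn R d] f by case/integrableP: intf => /measurable_EFinP.
have mn : measurable_fun [set: Rn R d] (fun y => (`|f y|)%:E).
  by apply/measurable_EFinP; apply: measurableT_comp.
rewrite [leRHS]integral_mkcond; apply: ge0_le_integral => //.
- apply/measurable_EFinP; apply: measurable_funM; first exact: measurableT_comp.
  by apply: measurable_indic; exact: measurable_thicken.
- by apply/(measurable_restrictT _ mE); exact: measurable_funS mn.
move=> y _; rewrite patchE indicE; case: ifPn => yE.
  by rewrite lee_fin ler_piMr//; case: (_ \in _).
case: (boolP (y \in (thicken K t : set (Rn R d)))) => [yt|]; last by rewrite mulr0.
case: (pselect (K y)) => [Ky|nK]; first by rewrite (fK _ Ky) normr0 mul0r.
case: (pselect (W y)) => [Wy|nW]; last by rewrite (fW0 _ nW) normr0 mul0r.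
exfalso; move/negP: yE; apply; rewrite in_setE; split=> //; split => //.
by move: yt; rewrite in_setE; exact: thicken_le.
Qed.

End upper_bound.

Section cross.
Context {R : realType} {d : nat}.
Implicit Types (x y : 'rV[R]_d) (r s : R) (i j k : 'I_d).

(** The points of the ball at which both bounds are available. *)
Definition cross (K : set 'rV[R]_d) (x0 : 'rV[R]_d) r : set (Rn R d) :=
  ball x0 r `&` [set x | forall i, K (x - r *: 'e_i) /\ K (x + r *: 'e_i)].

Lemma measurable_cross (K : set 'rV[R]_d) x0 r : closed K -> measurable (cross K x0 r).
Proof.
move=> /closed_measurable_rV mK; apply: measurableI; first exact: measurable_ball_rV.
have -> : [set x : Rn R d | forall i, K ((x : 'rV[R]_d) - r *: 'e_i) /\ K ((x : 'rV[R]_d) + r *: 'e_i)] =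
    \bigcap_(i in [set: 'I_d]) (((fun y : Rn R d => (y : 'rV[R]_d) + (- (r *: 'e_i)) : Rn R d) @^-1` K) `&`
      ((fun y : Rn R d => (y : 'rV[R]_d) + r *: 'e_i : Rn R d) @^-1` K)).
  by apply/seteqP; split => [x h i _|x h i]; [exact: h|apply: h].
apply: fin_bigcap_measurable => // i _; apply: measurableI.
  by rewrite -[X in measurable X]setTI; apply: measurable_translation.
by rewrite -[X in measurable X]setTI; apply: measurable_translation.
Qed.

(** A point of the ball outside the cross has one of its 2 d neighbours in the part of
    the double ball that K misses. *)
Lemma leb_cross_ge (K : set 'rV[R]_d) x0 r (V : R) : closed K -> 0 < r ->
  (@leb R d ((ball x0 (2 * r) : set (Rn R d)) `\` K) <= V%:E)%E ->
  (((2 * r) ^+ d - 2 * d%:R * V)%:E <= @leb R d (cross K x0 r))%E.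
Proof.
move=> cK r0; set E : set (Rn R d) := ball x0 (2 * r) `\` K => hV.
have mK := closed_measurable_rV cK.
have mE : measurable (E : set (Rn R d)) by apply: measurableD => //; exact: measurable_ball_rV.
have mS := measurable_cross x0 r cK.
have mB := measurable_ball_rV x0 r.
pose C i : set (Rn R d) := [set y : Rn R d | E ((y : 'rV[R]_d) - r *: 'e_i)] `|`
  [set y : Rn R d | E ((y : 'rV[R]_d) + r *: 'e_i)].
have mt (w : 'rV[R]_d) : measurable [set y : Rn R d | E ((y : 'rV[R]_d) + w)].
  by rewrite -[X in measurable X]setTI; apply: measurable_translation.
have mC i : measurable (C i) by apply: measurableU; exact: mt.
have hw (w : 'rV[R]_d) : (@leb R d [set y : Rn R d | E ((y : 'rV[R]_d) + w)%R] <= V%:E)%E by rewrite leb_translation.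
have CV i : (@leb R d (C i) <= (2 * V)%:E)%E.
  apply: (le_trans (measureU2 _ (mt _) (mt _))).
  by rewrite mulr_natl mulr2n EFinD; apply: leeD; exact: hw.
have re i : `|r *: ('e_i : 'rV[R]_d)| <= r.
  by rewrite normrZ (gtr0_norm r0) ler_piMr ?(ltW r0)// norm_e.
have cov : (@leb R d ((ball x0 r : set (Rn R d)) `\` cross K x0 r) <= \sum_(i <- enum 'I_d) @leb R d (C i))%E.
  apply: measure_cover_seq => //; first exact: measurableD.
  move=> x [/= xB nx]; apply: contrapT => h; apply: nx; split => // i.
  have hB w : `|w| <= r -> ball x0 (2 * r) (x + w).
    move=> wr; apply/ball_normP; move/ball_normP: xB => xB; rewrite opprD addrA.
    have := ler_normB (x0 - x) w; lra.
  have nC : ~ C i x by move=> hC; apply: h; exists i => //; rewrite mem_enum.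
  split; apply: contrapT => nK; apply: nC.
    by left; split => //; apply: hB; rewrite normrN.
  by right; split => //; exact: hB.
have {}cov : (@leb R d ((ball x0 r : set (Rn R d)) `\` cross K x0 r) <= (2 * d%:R * V)%:E)%E.
  apply: (le_trans cov); rewrite big_enum/=.
  apply: (@le_trans _ _ (\sum_(i < d) (2 * V)%:E)%E); first by apply: lee_sum => i _; exact: CV.
  rewrite sumEFin sumr_const card_ord lee_fin.
  by have -> : 2 * V *+ d = 2 * d%:R * V by ring.
have := leb_ball x0 r0; rewrite (measureDI _ mB mS) => hb.
have -> : (2 * r) ^+ d = (r *+ 2) ^+ d by rewrite mulr_natl.
rewrite EFinB -hb leeBlDr// setIC (setIidl (@subIsetl _ _ _)) addeC; exact: leeD.
Qed.

End cross.

Lemma geometric_small (R : realType) (a b : R) : 0 < b ->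
  exists n, forall m, (n <= m)%N -> a * 2^-1 ^+ m <= b.
Proof.
move=> b0; exists (Num.truncn (`|a| / b)).+1 => m nm.
have h : `|a| / b <= 2 ^+ m.
  apply: (le_trans (ltW (truncnS_gt _))); rewrite -natrX ler_nat.
  by apply: (leq_trans nm); rewrite ltnW// ltn_expl.
rewrite exprVn ler_pdivrMr ?exprn_gt0//; apply: (le_trans (ler_norm _)).
by rewrite mulrC -ler_pdivrMr.
Qed.

(** * Lower bound for the differences of the mollified field *)

(** In this section J stands for integration against rho - mu, g for the gradient of
    h, and lam for a measure that dominates J - c dx near x0 (HJ) and has small
    density at x0 (dens). F1 and F2 are the equation of h, tested against
    transfer_kernel and against averaging_kernel. *)
Section density_point.
Context {R : realType} {d : nat}.
Implicit Types (x y : 'rV[R]_d) (r s : R) (i j k : 'I_d).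

Variables (zeta eta : 'rV[R]_d -> R) (C m0 : R).
Hypothesis (szeta : smooth zeta) (seta : smooth eta).
Hypothesis (bzeta : supported_within 1 zeta) (beta : supported_within 1 eta).
Hypothesis lap : forall y, laplacian zeta y = 2 ^+ d * eta (2 *: y) - eta y.
Hypothesis C0 : 0 <= C.
Hypothesis C1 : forall i y, `|partial i zeta y| <= C.
Hypothesis Ce : forall y, `|eta y| <= C.
Hypothesis C3 : forall i j k y, `|partial k (partial j (partial i zeta)) y| <= C.
Hypothesis Ce2 : forall i k y, `|partial k (partial i eta) y| <= C.

(** The mollifier at scale s around x. *)
Definition averaging_kernel s x y : R := s^-1 ^+ d * eta (rescale s x y).

(** The i-th derivative of y |-> s^(2-d) zeta((y-x)/s); by the equation of zeta, its
    integral against rho - mu is the change of the mollified gradient between the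
    scales s and s/2. *)
Definition transfer_kernel i s x y : R := s * s^-1 ^+ d * partial i zeta (rescale s x y).

(** The i-th derivative of transfer_kernel. *)
Definition hessian_kernel i s x y : R := s^-1 ^+ d * partial i (partial i zeta) (rescale s x y).

Lemma bounded_averaging_kernel s x : 0 < s -> bounded_measurable (averaging_kernel s x).
Proof. exact: bounded_measurable_rescale. Qed.

Lemma bounded_transfer_kernel i s x : 0 < s -> bounded_measurable (transfer_kernel i s x).
Proof.
by apply: bounded_measurable_rescale; [exact: smooth_partial|exact: supported_within_partial].
Qed.

Lemma bounded_hessian_kernel i s x : 0 < s -> bounded_measurable (hessian_kernel i s x).
Proof.
by apply: bounded_measurable_rescale; [do 2 apply: smooth_partial|do 2 apply: supported_within_partial].
Qed.

Lemma integral_transfer_kernel i s x : 0 < s -> \int[@leb R d]_y transfer_kernel i s x y = 0.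
Proof.
move=> s0; have := Rintegral_partial (r := `|x| + s) i (smooth_rescale s x (s * (s * s^-1 ^+ d)) szeta).
rewrite partial_rescale//.
have -> : s * (s * s^-1 ^+ d) / s = s * s^-1 ^+ d by rewrite mulrAC divff ?mul1r// gt_eqF.
by apply; exact: supported_within_rescale.
Qed.

Lemma integral_hessian_kernel i s x : 0 < s -> \int[@leb R d]_y hessian_kernel i s x y = 0.
Proof.
move=> s0; have sp := smooth_partial i szeta.
have := Rintegral_partial (r := `|x| + s) i (smooth_rescale s x (s * s^-1 ^+ d) sp).
rewrite partial_rescale//.
have -> : s * s^-1 ^+ d / s = s^-1 ^+ d by rewrite mulrAC divff ?mul1r// gt_eqF.
by apply; apply: supported_within_rescale => //; exact: supported_within_partial.
Qed.

Lemma sum_hessian_kernel s x y : 0 < s ->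
  \sum_i hessian_kernel i s x y = averaging_kernel (s / 2) x y - averaging_kernel s x y.
Proof.
move=> s0; rewrite -mulr_sumr -[\sum_i _]/(laplacian zeta (rescale s x y)) lap.
rewrite /averaging_kernel mulrBr mulrA; congr (_ * _ - _).
  by rewrite invf_div -exprMn mulrC.
by rewrite !rescaleE scalerA invf_div.
Qed.

Variables (lam : {finite_measure set (Rn R d) -> \bar R}) (J : ('rV[R]_d -> R) -> R).
Variables (g : 'I_d -> Rn R d -> R) (K : set 'rV[R]_d) (x0 : 'rV[R]_d) (c theta R0 : R).
Hypothesis linJ : linear_functional J.
Hypothesis HJ : forall f, bounded_measurable f -> (forall y, R0 <= `|x0 - y| -> f y = 0) ->
  (`|J f - c * \int[@leb R d]_y f y|%:E <= \int[lam]_y (`|f y|)%:E)%E.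
Hypothesis ig : forall i, (@leb R d).-integrable [set: Rn R d] (EFin \o g i).

Definition mollified i s x : R := \int[@leb R d]_y (g i y * averaging_kernel s x y).

Hypothesis F1 : forall i s x, 0 < s -> `|x0 - x| + s < R0 ->
  mollified i (s / 2) x - mollified i s x = J (transfer_kernel i s x).
Hypothesis F2 : forall s, 0 < s -> s < R0 ->
  \sum_i \int[@leb R d]_y (g i y * (s^-1 ^+ d / s * partial i eta (rescale s x0 y))) =
  J (averaging_kernel s x0).
Hypothesis dens : forall s, 0 < s -> s < R0 -> (lam (ball x0 s : set (Rn R d)) <= (theta * s ^+ d)%:E)%E.
Hypothesis th0 : 0 < theta.
Hypothesis c0 : 0 < c.

Lemma integrable_indic_ball x s :
  (@leb R d).-integrable [set: Rn R d] (EFin \o \1_(ball x s : set (Rn R d))).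
Proof.
have mB := measurable_ball_rV x s.
apply: (@bounded_support_integrable R d (@leb R d) \1_(ball x s : set (Rn R d)) x s 1).
- exact: measurable_indic.
- by move=> y; rewrite indicE; case: (_ \in _); rewrite ?normr1 ?normr0.
- move=> y xy; rewrite indicE memNset// => /ball_normP; apply/negP; by rewrite -leNgt.
- exact: leb_ball_lty.
Qed.

Lemma J_bound f (M s : R) : 0 < s -> s < R0 -> bounded_measurable f -> 0 <= M ->
  (forall y, `|f y| <= M) -> (forall y, s <= `|x0 - y| -> f y = 0) ->
  `|J f - c * \int[@leb R d]_y f y| <= M * (theta * s ^+ d).
Proof.
move=> s0 sR bf M0 fM f0; rewrite -lee_fin.
have f1 y : R0 <= `|x0 - y| -> f y = 0 by move=> h; apply: f0; rewrite (le_trans (ltW sR)).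
apply: (le_trans (HJ bf f1)).
by apply: (integral_abs_le _ M0 fM f0); [case: bf|exact: dens].
Qed.

(** The difference of the mollified field between opposite points, minus its linear
    prediction by the mean of the source around x0. Up to O(r^2) it will be at most a
    small multiple of r^2 / s, down to s = r. *)
Definition defect r x s : R :=
  \sum_i (mollified i s (x - r *: 'e_i) - mollified i s (x + r *: 'e_i)) -
  2 * r * J (averaging_kernel s x0).

Let A : R := 4 * C * d%:R ^+ 2 * 4 ^+ d.

(** By F1 and sum_hessian_kernel, halving the scale changes the defect by J of a
    second-order remainder of the transfer kernels. This remainder has integral 0, so
    that c dx does not see it; it is O(s^(1-d) (r/s)^2) on a ball of radius 4 s, which
    lam charges little. *)
Lemma defect_step r x s : 0 < s -> 0 <= r -> r <= s -> `|x - x0| <= r -> 4 * s < R0 ->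
  `|defect r x (s / 2) - defect r x s| <= A * theta * (r ^+ 2 / s).
Proof.
move=> s0 r0 rs xx0 sR.
have re i : `|r *: ('e_i : 'rV[R]_d)| <= r.
  by rewrite normrZ (ger0_norm r0) ler_piMr// norm_e.
have dm i y : `|x0 - y| <= `|x - r *: 'e_i - y| + 2 * r.
  have -> : x0 - y = (x - r *: 'e_i - y) - (x - x0) + r *: 'e_i by apply/rowP => j; rewrite !mxE; ring.
  have h1 := ler_normD (x - r *: 'e_i - y - (x - x0)) (r *: 'e_i).
  have h2 := ler_normB (x - r *: 'e_i - y) (x - x0); have := re i; lra.
have dp i y : `|x0 - y| <= `|x + r *: 'e_i - y| + 2 * r.
  have -> : x0 - y = (x + r *: 'e_i - y) - (x - x0) - r *: 'e_i by apply/rowP => j; rewrite !mxE; ring.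
  have h1 := ler_normB (x + r *: 'e_i - y - (x - x0)) (r *: 'e_i).
  have h2 := ler_normB (x + r *: 'e_i - y) (x - x0); have := re i; lra.
pose T i y := transfer_kernel i s (x - r *: 'e_i) y - transfer_kernel i s (x + r *: 'e_i) y
  - 2 * r * hessian_kernel i s x0 y.
pose T0 y := \sum_i T i y.
have bt i z := bounded_transfer_kernel i z s0.
have bh i := bounded_hessian_kernel i x0 s0.
have bT i : bounded_measurable (T i).
  by apply: bounded_measurableB; [apply: bounded_measurableB|exact: bounded_measurableZ].
have s20 : 0 < s / 2 by rewrite divr_gt0.
have -> : defect r x (s / 2) - defect r x s = J T0.
  rewrite linear_functional_sum//.
  have -> : \sum_i J (T i) = \sum_i (J (transfer_kernel i s (x - r *: 'e_i)) -
      J (transfer_kernel i s (x + r *: 'e_i)) - 2 * r * J (hessian_kernel i s x0)).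
    apply: eq_bigr => i _; rewrite linear_functionalB//; last 2 first.
    - exact: bounded_measurableB.
    - exact: bounded_measurableZ.
    by rewrite linear_functionalB//; have [_ ->] := linJ.
  rewrite sumrB -mulr_sumr -linear_functional_sum//.
  have -> : (fun y => \sum_i hessian_kernel i s x0 y) =
      (fun y => averaging_kernel (s / 2) x0 y - averaging_kernel s x0 y).
    by apply/funext => y; rewrite sum_hessian_kernel.
  rewrite linear_functionalB//; [|exact: bounded_averaging_kernel|exact: bounded_averaging_kernel].
  have -> : \sum_i (J (transfer_kernel i s (x - r *: 'e_i)) - J (transfer_kernel i s (x + r *: 'e_i))) =
      \sum_i ((mollified i (s / 2) (x - r *: 'e_i) - mollified i (s / 2) (x + r *: 'e_i)) -
              (mollified i s (x - r *: 'e_i) - mollified i s (x + r *: 'e_i))).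
    apply: eq_bigr => i _.
    have fm : mollified i (s / 2) (x - r *: 'e_i) - mollified i s (x - r *: 'e_i) =
        J (transfer_kernel i s (x - r *: 'e_i)).
      by apply: F1 => //; have := dm i (x - r *: 'e_i); rewrite subrr normr0; lra.
    have fp : mollified i (s / 2) (x + r *: 'e_i) - mollified i s (x + r *: 'e_i) =
        J (transfer_kernel i s (x + r *: 'e_i)).
      by apply: F1 => //; have := dp i (x + r *: 'e_i); rewrite subrr normr0; lra.
    rewrite -fm -fp; move: (mollified i _ _) (mollified i _ _) (mollified i _ _) (mollified i _ _) => a1 a2 a3 a4.
    by ring.
  rewrite sumrB /defect; move: (\sum_i _) (\sum_i _) (J _) (J _) => a1 a2 a3 a4.
  by ring.
have TC i y : `|T i y| <= s * s^-1 ^+ d * (4 * C * d%:R * (r / s) ^+ 2).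
  have -> : T i y = s * s^-1 ^+ d * (partial i zeta (rescale s (x - r *: 'e_i) y)
     - partial i zeta (rescale s (x + r *: 'e_i) y)
     - 2 * (r / s) * partial i (partial i zeta) (rescale s x0 y)).
    rewrite /T /transfer_kernel /hessian_kernel; move: (s^-1 ^+ d) (partial i zeta _) (partial i zeta _)
      (partial i (partial i zeta) _) => a p1 p2 p3.
    by field; rewrite gt_eqF.
  have sd : 0 <= s * s^-1 ^+ d by rewrite mulr_ge0 ?exprn_ge0 ?invr_ge0// ltW.
  rewrite normrM (ger0_norm sd); apply: ler_wpM2l => //.
  exact: (rescaled_difference y (smooth_partial i szeta) s0 r0 C0 (C3 i i) xx0).
have T0C y : `|T0 y| <= d%:R * (s * s^-1 ^+ d * (4 * C * d%:R * (r / s) ^+ 2)).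
  apply: (le_trans (ler_norm_sum _ _ _)); rewrite mulr_natl -[X in _ *+ X](card_ord d) -sumr_const.
  by apply: ler_sum => i _; exact: TC.
have T00 y : 4 * s <= `|x0 - y| -> T0 y = 0.
  move=> hy; rewrite /T0 big1// => i _; rewrite /T /transfer_kernel /hessian_kernel.
  have s1 := supported_within_partial i bzeta; have s2 := supported_within_partial i s1.
  rewrite (rescale_eq0 s1 s0); last by have := dm i y; lra.
  rewrite (rescale_eq0 s1 s0); last by have := dp i y; lra.
  by rewrite (rescale_eq0 s2 s0) ?mulr0 ?subrr//; lra.
(* The kernels are integrated through a functional L that agrees with the integral on
   functions supported near x0, because linearity is only stated for bounded
   measurable functions. *)
have IT : \int[@leb R d]_y T0 y = 0.
  pose L f := \int[@leb R d]_y (\1_(ball x0 (4 * s) : set (Rn R d)) y * f y).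
  have linL : linear_functional L.
    apply: linear_functional_integral; exact: integrable_indic_ball.
  have LE f : (forall y, 4 * s <= `|x0 - y| -> f y = 0) -> L f = \int[@leb R d]_y f y.
    move=> f0; apply: eq_Rintegral => y _; rewrite indicE.
    case: (boolP (y \in _)) => [_|yB]; rewrite ?mul1r// mul0r f0// leNgt; apply/negP => h.
    by move/negP: yB; apply; rewrite in_setE; apply/ball_normP.
  rewrite -LE// linear_functional_sum// big1// => i _.
  rewrite linear_functionalB//; [|exact: bounded_measurableB|exact: bounded_measurableZ].
  rewrite linear_functionalB//; have [_ ->//] := linL.
  have s1 := supported_within_partial i bzeta; have s2 := supported_within_partial i s1.
  rewrite !LE; last 3 first.
  - by move=> y hy; rewrite /hessian_kernel (rescale_eq0 s2 s0) ?mulr0//; lra.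
  - by move=> y hy; rewrite /transfer_kernel (rescale_eq0 s1 s0) ?mulr0//; have := dp i y; lra.
  - by move=> y hy; rewrite /transfer_kernel (rescale_eq0 s1 s0) ?mulr0//; have := dm i y; lra.
  by rewrite !integral_transfer_kernel// integral_hessian_kernel// mulr0 !subr0.
have := J_bound (M := d%:R * (s * s^-1 ^+ d * (4 * C * d%:R * (r / s) ^+ 2))) _ sR (bounded_measurable_sum bT) _ T0C T00.
rewrite IT mulr0 subr0 => H; apply: (le_trans (H _ _)).
- by rewrite mulr_gt0.
- by rewrite !mulr_ge0 ?exprn_ge0 ?divr_ge0 ?invr_ge0// ltW.
rewrite /A (_ : (4 * s) ^+ d = 4 ^+ d * s ^+ d) ?exprMn// (_ : _ * _ = 4 * C * d%:R ^+ 2 * 4 ^+ d * theta * (r ^+ 2 / s) * (s^-1 ^+ d * s ^+ d)).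
  by rewrite -exprMn mulVf ?expr1n ?mulr1// gt_eqF.
move: (s ^+ d) (4 ^+ d) (s^-1 ^+ d) => a1 a2 a3.
by field; rewrite gt_eqF.
Qed.

(** The errors of the successive halvings grow like 2^n, so their sum is comparable
    with the last one. *)
Lemma defect_telescope r x (S : R) n : 0 < S -> 4 * S < R0 -> 0 <= r -> r <= S * 2^-1 ^+ n ->
  `|x - x0| <= r -> `|defect r x (S * 2^-1 ^+ n) - defect r x S| <= A * theta * (r ^+ 2 / S) * 2 ^+ n.
Proof.
move=> S0 SR r0 rS xx0.
have A0 : 0 <= A * theta * (r ^+ 2 / S).
  by rewrite !mulr_ge0 ?exprn_ge0 ?invr_ge0// ltW.
elim: n rS => [|n IH] rS.
  by rewrite !expr0 !mulr1 subrr normr0.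
have Sn0 : 0 < S * 2^-1 ^+ n by rewrite mulr_gt0// exprn_gt0// invr_gt0.
have SnE : S * 2^-1 ^+ n.+1 = S * 2^-1 ^+ n / 2 by rewrite exprSr mulrA.
rewrite SnE in rS *.
have rSn : r <= S * 2^-1 ^+ n by lra.
have Sn4 : 4 * (S * 2^-1 ^+ n) < R0.
  rewrite (le_lt_trans _ SR)// ler_pM2l// ler_piMr ?(ltW S0)// exprn_ile1 ?invr_ge0// invf_le1// ler1n//.
have h1 := defect_step Sn0 r0 rSn xx0 Sn4.
have h2 := IH rSn.
have E : A * theta * (r ^+ 2 / (S * 2^-1 ^+ n)) = A * theta * (r ^+ 2 / S) * 2 ^+ n.
  by rewrite invfM exprVn invrK !mulrA.
rewrite E in h1.
have -> : 2 ^+ n.+1 = 2 ^+ n * 2 :> R by rewrite exprSr.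
have := ler_normD (defect r x (S * 2^-1 ^+ n / 2) - defect r x (S * 2^-1 ^+ n))
  (defect r x (S * 2^-1 ^+ n) - defect r x S).
rewrite subrKA.
move: h1 h2; move: (A * theta * _) (2 ^+ n) => a b h1 h2; rewrite mulrA; lra.
Qed.

(** At a fixed scale no smallness is available, but none is needed: the defect is
    quadratic in r by a Taylor estimate of the kernel, and r will be small. *)
Lemma defect_top (S : R) : 0 < S -> S < R0 -> exists2 B : R, 0 <= B &
  forall r x, 0 <= r -> `|x - x0| <= r -> `|defect r x S| <= B * r ^+ 2.
Proof.
move=> S0 SR; have S1 : 0 <= S^-1 ^+ d by rewrite exprn_ge0// invr_ge0 ltW.
pose M : R := S^-1 ^+ d * (4 * C * d%:R * S^-1 ^+ 2).
have M0 : 0 <= M by rewrite !mulr_ge0// invr_ge0 ltW.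
exists (M * \sum_i \int[@leb R d]_y `|g i y|).
  by rewrite mulr_ge0// sumr_ge0// => i _; apply: Rintegral_ge0.
move=> r x r0 xx0.
pose k i y := averaging_kernel S (x - r *: 'e_i) y - averaging_kernel S (x + r *: 'e_i) y
   - 2 * r * (S^-1 ^+ d / S * partial i eta (rescale S x0 y)).
have bp i : bounded_measurable (fun y => S^-1 ^+ d / S * partial i eta (rescale S x0 y)).
  by apply: bounded_measurable_rescale => //; [exact: smooth_partial|exact: supported_within_partial].
have ba z := bounded_averaging_kernel z S0.
have bk i : bounded_measurable (k i).
  by apply: bounded_measurableB; [exact: bounded_measurableB|exact: bounded_measurableZ].
have -> : defect r x S = \sum_i \int[@leb R d]_y (g i y * k i y).
  rewrite /defect -F2// mulr_sumr -sumrB; apply: eq_bigr => i _.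
  have lin := linear_functional_integral (ig i).
  rewrite (linear_functionalB lin (bounded_measurableB (ba _) (ba _)) (bounded_measurableZ (2 * r) (bp i))).
  by rewrite (linear_functionalB lin (ba _) (ba _)); have [_ ->] := lin.
have kM i y : `|k i y| <= M * r ^+ 2.
  have -> : k i y = S^-1 ^+ d * (eta (rescale S (x - r *: 'e_i) y) - eta (rescale S (x + r *: 'e_i) y)
     - 2 * (r / S) * partial i eta (rescale S x0 y)).
    rewrite /k /averaging_kernel; move: (S^-1 ^+ d) (eta _) (eta _) (partial i eta _) => a p1 p2 p3.
    by field; rewrite gt_eqF.
  rewrite normrM (ger0_norm S1) (_ : M * r ^+ 2 = S^-1 ^+ d * (4 * C * d%:R * (r / S) ^+ 2)).
    apply: ler_wpM2l => //.
    exact: (rescaled_difference y seta S0 r0 C0 (Ce2 i) xx0).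
  by rewrite /M exprMn; move: (S^-1 ^+ d) (S^-1 ^+ 2) (r ^+ 2) => a b e; ring.
apply: (le_trans (ler_norm_sum _ _ _)).
rewrite -mulrA mulr_suml mulr_sumr; apply: ler_sum => i _.
have igk := integrable_mul_bounded (ig i) (bk i).
have ign := integrable_norm (ig i).
apply: (le_trans (le_normr_Rintegral measurableT igk)).
rewrite [leRHS](_ : _ = M * r ^+ 2 * \int[@leb R d]_y `|g i y|); last by rewrite mulrCA mulrC.
rewrite -RintegralZl//.
apply: le_Rintegral => //.
- exact: (integrable_norm igk).
- by have := @integrableZl _ _ _ (@leb R d) setT measurableT (M * r ^+ 2) _ ign.
- by move=> y _; rewrite normrM mulrC ler_wpM2r.
Qed.

Hypothesis mass : forall s x, 0 < s -> m0 <= \int[@leb R d]_y averaging_kernel s x y.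

Lemma J_averaging_ge s : 0 < s -> 2 * s < R0 -> c * m0 - C * 2 ^+ d * theta <= J (averaging_kernel s x0).
Proof.
move=> s0 sR; have s1 : 0 <= s^-1 ^+ d by rewrite exprn_ge0// invr_ge0 ltW.
have s20 : 0 < 2 * s by rewrite mulr_gt0.
have := J_bound s20 sR (bounded_averaging_kernel x0 s0) (mulr_ge0 s1 C0) _ _.
have -> : s^-1 ^+ d * C * (theta * (2 * s) ^+ d) = C * 2 ^+ d * theta.
  rewrite exprMn; have : s^-1 ^+ d * s ^+ d = 1 by rewrite -exprMn mulVf ?expr1n// gt_eqF.
  move: (s^-1 ^+ d) (s ^+ d) (2 ^+ d) => a b e ab.
  by rewrite -[RHS]mulr1 -ab; ring.
move=> H.
have {}H : `|J (averaging_kernel s x0) - c * \int[@leb R d]_y averaging_kernel s x0 y| <= C * 2 ^+ d * theta.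
  apply: H => y.
    by rewrite /averaging_kernel normrM (ger0_norm s1) ler_wpM2l.
  by move=> hy; rewrite /averaging_kernel rescale_eq0 ?mulr0//; lra.
have := ler_wpM2l (ltW c0) (mass x0 s0).
move: H; rewrite ler_norml => /andP[h1 _] h2.
move: h1 h2; move: (c * \int[_]_y _) (J _) (C * _ * _) (c * m0) => a1 a2 a3 a4 h1 h2; lra.
Qed.

(** The source term J (averaging_kernel r x0) is at least about c m0, while the defect
    at scale r comes from defect_telescope and defect_top. *)
Lemma mollified_difference_ge (S : R) : 0 < S -> 4 * S < R0 -> exists2 B : R, 0 <= B &
  forall n x, let r := S * 2^-1 ^+ n in `|x - x0| <= r ->
    2 * r * (c * m0 - C * 2 ^+ d * theta) - A * theta * r - B * r ^+ 2 <=
    \sum_i (mollified i r (x - r *: 'e_i) - mollified i r (x + r *: 'e_i)).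
Proof.
move=> S0 SR; have SR1 : S < R0 by lra.
have [B B0 hB] := defect_top S0 SR1.
exists B => // n x r xr.
have q0 : 0 < 2^-1 ^+ n :> R by rewrite exprn_gt0// invr_gt0.
have r0 : 0 < r by rewrite mulr_gt0.
have rS : r <= S by rewrite ler_piMr ?(ltW S0)// exprn_ile1 ?invr_ge0// invf_le1 ?ler1n.
have h1 := defect_telescope S0 SR (ltW r0) (lexx _) xr.
have h2 := hB r x (ltW r0) xr.
have E : A * theta * (r ^+ 2 / S) * 2 ^+ n = A * theta * r.
  rewrite -(mulrA (A * theta)); congr (_ * _).
  have q2 : 2^-1 ^+ n * 2 ^+ n = 1 :> R by rewrite -exprMn mulVf ?expr1n.
  transitivity (r * (S / S) * (2^-1 ^+ n * 2 ^+ n)).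
    by rewrite expr2 {2}/r; move: (2^-1 ^+ n) (2 ^+ n) => a b; ring.
  by rewrite q2 divff ?gt_eqF// !mulr1.
rewrite E in h1.
have h3 : 2 * r * (c * m0 - C * 2 ^+ d * theta) <= 2 * r * J (averaging_kernel r x0).
  by rewrite ler_pM2l ?mulr_gt0// J_averaging_ge//; lra.
have := ler_norm (- (defect r x r)); rewrite normrN.
have := ler_normD (defect r x r - defect r x S) (defect r x S); rewrite subrK.
move: h1 h2; rewrite -/r; set D := defect r x r; set D' := defect r x S => h1 h2 h4 h5.
have : D = \sum_i (mollified i r (x - r *: 'e_i) - mollified i r (x + r *: 'e_i)) -
  2 * r * J (averaging_kernel r x0) by [].
move: (\sum_i _) (J _) h3 => a b h3 h6.
by lra.
Qed.

(** * Upper bound for the mollified field on its zero set *)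

Section scale.
Variable r : R.
Hypotheses (r0 : 0 < r) (rR : 4 * r < R0).

Let B : set (Rn R d) := ball x0 (4 * r).

(** A bound for the change of the mollified field between the scales s and s/2 that
    only involves lam on a ball of radius 2 s; the ball B on which lam is truncated
    makes its integral in x small. *)
Definition transfer_bound s x : \bar R :=
  ((s * s^-1 ^+ d * C)%:E * ball_mass lam (fun y => (\1_B y)%:E) (2 * s) x)%E.

(** By F1 the change of scale is J of the transfer kernel. The latter has integral 0,
    so only lam contributes. *)
Lemma transfer_boundP i s x : 0 < s -> s <= r -> `|x0 - x| < 2 * r ->
  (`|mollified i (s / 2) x - mollified i s x|%:E <= transfer_bound s x)%E.
Proof.
move=> s0 sr xr.
have tri y : `|x0 - y| <= `|x0 - x| + `|x - y|.
  by have := ler_normD (x0 - x) (x - y); rewrite addrA subrK.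
have rR' := rR; have sR : `|x0 - x| + s < R0 by lra.
rewrite F1//.
have bt := bounded_transfer_kernel i x s0.
have t0 y : 2 * s <= `|x - y| -> transfer_kernel i s x y = 0.
  move=> hy; rewrite /transfer_kernel (rescale_eq0 (supported_within_partial i bzeta) s0) ?mulr0//; lra.
have := HJ bt; rewrite (integral_transfer_kernel i x s0) mulr0 subr0 => H.
apply: (le_trans (H _)) => [y hy|].
  by apply: t0; have := tri y; lra.
have sd : 0 <= s * s^-1 ^+ d by rewrite mulr_ge0 ?exprn_ge0 ?invr_ge0// ltW.
rewrite /transfer_bound ball_mass_indic; last first.
  by move=> y /ball_normP xy; apply/ball_normP; have := tri y; lra.
have lf : lam (ball x (2 * s) : set (Rn R d)) \is a fin_num.
  by apply: fin_num_measure; exact: measurable_ball_rV.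
have tM y : `|transfer_kernel i s x y| <= s * s^-1 ^+ d * C.
  by rewrite /transfer_kernel normrM (ger0_norm sd) ler_wpM2l.
have hV : (lam (ball x (2 * s) : set (Rn R d)) <= (fine (lam (ball x (2 * s) : set (Rn R d))))%:E)%E by rewrite fineK.
have := integral_abs_le (proj1 bt) (mulr_ge0 sd C0) tM t0 hV.
by rewrite EFinM fineK.
Qed.

(** The part of |g_i| that is seen from K at scale s. *)
Definition scale_function (s : R) i (y : Rn R d) : \bar R :=
  (`|g i y| * \1_(thicken K (2 * s) : set (Rn R d)) y)%:E.

Lemma mollified_on_compact i s x : 0 < s -> K x ->
  (`|mollified i s x|%:E <= (s^-1 ^+ d * C)%:E * ball_mass (@leb R d) (scale_function s i) (2 * s) x)%E.
Proof.
move=> s0 Kx.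
have ba := bounded_averaging_kernel x s0.
have sd : 0 <= s^-1 ^+ d by rewrite exprn_ge0 ?invr_ge0// ltW.
have mg : measurable_fun [set: Rn R d] (g i) by case/integrableP: (ig i) => /measurable_EFinP.
have mF : measurable_fun [set: Rn R d] (scale_function s i).
  apply/measurable_EFinP; apply: measurable_funM; first exact: measurableT_comp.
  by apply: measurable_indic; exact: measurable_thicken.
have mB := measurable_ball_rV x (2 * s).
apply: (le_trans (normr_Rintegral_lee (integrable_mul_bounded (ig i) ba))).
rewrite /ball_mass [X in (_ * X)%E]integral_mkcond -ge0_integralZl//; last 3 first.
- by apply/(measurable_restrictT _ mB); exact: measurable_funTS mF.
- by move=> y _; rewrite patchE; case: (y \in _) => //; rewrite lee_fin mulr_ge0.
- by rewrite lee_fin mulr_ge0.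
apply: ge0_le_integral => //.
- by apply/measurable_EFinP; apply: measurableT_comp => //; apply: measurable_funM => //; case: ba.
- apply: measurable_funeM; apply/(measurable_restrictT _ mB); exact: measurable_funTS mF.
move=> y _; rewrite patchE; case: ifPn => [|yB].
  rewrite in_setE => yB; rewrite -EFinM lee_fin indicE mem_set ?mulr1; last by exists x.
  rewrite normrM mulrC ler_wpM2r//.
  by rewrite /averaging_kernel normrM (ger0_norm sd) ler_wpM2l.
rewrite mule0 lee_fin /averaging_kernel rescale_eq0 ?mulr0 ?mulr0 ?normr0//.
have : ~ ball x (2 * s) y by move=> h; move/negP: yB; apply; rewrite in_setE.
by move=> h; rewrite ltNge; apply/negP => xy; apply: h; apply/ball_normP; lra.
Qed.

Definition mollified_bound N i x : \bar R :=
  let s := r * 2^-1 ^+ N in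
  ((s^-1 ^+ d * C)%:E * ball_mass (@leb R d) (scale_function s i) (2 * s) x +
   \sum_(j < N) transfer_bound (r * 2^-1 ^+ j) x)%E.

Let scale_gt0 n : 0 < r * 2^-1 ^+ n.
Proof. by rewrite mulr_gt0// exprn_gt0// invr_gt0. Qed.

Let scale_le n : r * 2^-1 ^+ n <= r.
Proof. by rewrite ler_piMr ?(ltW r0)// exprn_ile1 ?invr_ge0// invf_le1 ?ler1n. Qed.

(** Telescoping from scale r down to the scale r / 2^N, at which the average is
    bounded by that of |g_i| near K. *)
Lemma mollified_boundP N i x : K x -> `|x0 - x| < 2 * r ->
  (`|mollified i r x|%:E <= mollified_bound N i x)%E.
Proof.
move=> Kx xr.
suff H : (`|mollified i r x|%:E <= `|mollified i (r * 2^-1 ^+ N) x|%:E +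
    \sum_(j < N) transfer_bound (r * 2^-1 ^+ j) x)%E.
  apply: (le_trans H); apply: leeD => //; exact: mollified_on_compact.
elim: N => [|N IH]; first by rewrite big_ord0 adde0 expr0 mulr1.
rewrite big_ord_recr/=; apply: (le_trans IH).
rewrite [leRHS]addeA [leRHS](addeAC); apply: leeD => //.
have := transfer_boundP i (scale_gt0 N) (scale_le N) xr.
rewrite exprSr mulrA => h; apply: le_trans (leeD (lexx _) h).
rewrite -EFinD lee_fin distrC.
by have := ler_normD (mollified i (r * 2^-1 ^+ N / 2) x) (mollified i (r * 2^-1 ^+ N) x - mollified i (r * 2^-1 ^+ N / 2) x); rewrite [X in `|X|]addrC subrK.
Qed.

Lemma measurable_scale_function s i : measurable_fun [set: Rn R d] (scale_function s i).
Proof.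
apply/measurable_EFinP; apply: measurable_funM.
  by apply: measurableT_comp => //; case/integrableP: (ig i) => /measurable_EFinP.
by apply: measurable_indic; exact: measurable_thicken.
Qed.

Lemma scale_function_ge0 s i y : (0 <= scale_function s i y)%E.
Proof. by rewrite lee_fin mulr_ge0. Qed.

Let mB1 : measurable_fun [set: Rn R d] (fun y => (\1_B y)%:E : \bar R).
Proof. by apply/measurable_EFinP; apply: measurable_indic; exact: measurable_ball_rV. Qed.

Let B1_ge0 y : (0 <= (\1_B y)%:E :> \bar R)%E.
Proof. by rewrite lee_fin. Qed.

Lemma transfer_bound_ge0 s x : 0 < s -> (0 <= transfer_bound s x)%E.
Proof.
move=> s0; apply: mule_ge0; last exact: ball_mass_ge0.
by rewrite lee_fin !mulr_ge0 ?exprn_ge0 ?invr_ge0// ltW.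
Qed.

Lemma measurable_transfer_bound s : measurable_fun [set: Rn R d] (transfer_bound s).
Proof. by apply: measurable_funeM; exact: measurable_ball_mass. Qed.

Lemma integral_transfer_bound s : 0 < s ->
  (\int[@leb R d]_x transfer_bound s x = (4 ^+ d * C)%:E * s%:E * lam B)%E.
Proof.
move=> s0; have sd : 0 <= s * s^-1 ^+ d * C by rewrite !mulr_ge0 ?exprn_ge0 ?invr_ge0// ltW.
have s20 : 0 < 2 * s by rewrite mulr_gt0.
rewrite ge0_integralZl//; last 2 first.
- exact: measurable_ball_mass.
- by move=> y _; exact: ball_mass_ge0.
rewrite integral_ball_mass// integral_indic ?setIT//; last exact: measurable_ball_rV.
rewrite muleA -!EFinM; congr (_%:E * _)%E.
have -> : 2 * s *+ 2 = 4 * s :> R by ring.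
rewrite exprMn.
have : s^-1 ^+ d * s ^+ d = 1 by rewrite -exprMn mulVf ?expr1n// gt_eqF.
move: (s^-1 ^+ d) (s ^+ d) (4 ^+ d) => a b e ab.
by rewrite -[RHS]mulr1 -ab; ring.
Qed.

Lemma measurable_mollified_bound N i : measurable_fun [set: Rn R d] (mollified_bound N i).
Proof.
apply: emeasurable_funD.
  by apply: measurable_funeM; apply: measurable_ball_mass; [exact: measurable_scale_function|exact: scale_function_ge0].
by apply: emeasurable_sum => j; exact: measurable_transfer_bound.
Qed.

Lemma mollified_bound_ge0 N i x : (0 <= mollified_bound N i x)%E.
Proof.
apply: adde_ge0.
  apply: mule_ge0; last by apply: ball_mass_ge0 => y; exact: scale_function_ge0.
  by rewrite lee_fin mulr_ge0// exprn_ge0// invr_ge0 ltW.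
by apply: sume_ge0 => j _; exact: transfer_bound_ge0.
Qed.

(** Integrating in x turns ball averages into integrals; the transfer bounds at the
    scales r / 2^j have integrals proportional to r / 2^j, whence a geometric sum. *)
Lemma integral_mollified_bound N i (e V : R) : 0 <= V -> (lam B <= V%:E)%E ->
  (\int[@leb R d]_y scale_function (r * 2^-1 ^+ N) i y <= e%:E)%E ->
  (\int[@leb R d]_x mollified_bound N i x <= (4 ^+ d * C * (e + 2 * r * V))%:E)%E.
Proof.
move=> V0 hV he; set s := r * 2^-1 ^+ N; have s0 : 0 < s by exact: scale_gt0.
have s20 : 0 < 2 * s by rewrite mulr_gt0.
have sd : 0 <= s^-1 ^+ d * C by rewrite !mulr_ge0 ?exprn_ge0 ?invr_ge0// ltW.
have mF := @measurable_scale_function s i.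
have F0 := @scale_function_ge0 s i.
rewrite ge0_integralD//; last 4 first.
- by move=> x _; apply: mule_ge0; [rewrite lee_fin|exact: ball_mass_ge0].
- by apply: measurable_funeM; exact: measurable_ball_mass.
- by move=> x _; apply: sume_ge0 => j _; exact: transfer_bound_ge0.
- by apply: emeasurable_sum => j; exact: measurable_transfer_bound.
rewrite mulrDr EFinD; apply: leeD.
  rewrite ge0_integralZl//; last 2 first.
  - exact: measurable_ball_mass.
  - by move=> y _; exact: ball_mass_ge0.
  rewrite integral_ball_mass// muleA -EFinM.
  have -> : s^-1 ^+ d * C * (2 * s *+ 2) ^+ d = 4 ^+ d * C.
    have -> : 2 * s *+ 2 = 4 * s :> R by ring.
rewrite exprMn.
    have : s^-1 ^+ d * s ^+ d = 1 by rewrite -exprMn mulVf ?expr1n// gt_eqF.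
    move: (s^-1 ^+ d) (s ^+ d) (4 ^+ d) => a b e' ab.
    by rewrite -[RHS]mulr1 -ab; ring.
  by rewrite [leRHS]EFinM; apply: lee_wpmul2l => //; rewrite lee_fin mulr_ge0// exprn_ge0.
rewrite ge0_integral_sum//; last 2 first.
- by move=> j; exact: measurable_transfer_bound.
- by move=> j x _; exact: transfer_bound_ge0.
have -> : (\sum_(j < N) \int[@leb R d]_x transfer_bound (r * 2^-1 ^+ j) x =
    \sum_(j < N) ((4 ^+ d * C * (r * 2^-1 ^+ j))%:E * lam B))%E.
  by apply: eq_bigr => j _; rewrite integral_transfer_bound// EFinM.
apply: (@le_trans _ _ (\sum_(j < N) (4 ^+ d * C * (r * 2^-1 ^+ j) * V)%:E)%E).
  apply: lee_sum => j _; rewrite [leRHS]EFinM; apply: lee_wpmul2l => //.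
  by rewrite lee_fin !mulr_ge0 ?exprn_ge0 ?invr_ge0// ltW.
rewrite sumEFin lee_fin -mulr_suml -mulr_sumr -mulr_sumr.
have -> : \sum_(j < N) 2^-1 ^+ j = 2 - 2 * 2^-1 ^+ N :> R.
  elim: (N) => [|n IH]; first by rewrite big_ord0 expr0 mulr1 subrr.
  by rewrite big_ord_recr/= IH exprSr; move: (2^-1 ^+ n) => a; field.
have : 0 <= 2^-1 ^+ N :> R by rewrite exprn_ge0.
have : 0 <= 4 ^+ d * C by rewrite mulr_ge0// exprn_ge0.
move: (4 ^+ d * C) (2^-1 ^+ N) => a b a0 b0.
rewrite -subr_ge0.
have -> : a * (2 * r * V) - a * (r * (2 - 2 * b)) * V = 2 * (a * (b * (r * V))) by ring.
by rewrite !mulr_ge0// ltW.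
Qed.

End scale.

(** * The two bounds are incompatible *)

Variables (z : 'rV[R]_d) (Rw : R).
Hypothesis cK : closed K.
Hypothesis gK : forall i y, K y -> g i y = 0.
Hypothesis gW : forall i y, ~ ball z Rw y -> g i y = 0.
Hypothesis massK : forall s, 0 < s -> s < R0 ->
  (c%:E * @leb R d ((ball x0 s : set (Rn R d)) `\` K) <= lam (ball x0 s : set (Rn R d)))%E.
Hypotheses (R00 : 0 < R0) (m00 : 0 < m0).
Hypothesis small1 : 4 * (C * 2 ^+ d * theta) <= c * m0.
Hypothesis small2 : 2 * (4 * C * d%:R ^+ 2 * 4 ^+ d * theta) <= c * m0.
Hypothesis small3 : 4 * d%:R * theta <= c.
Hypothesis small4 : 24 * d%:R * C * 8 ^+ d * theta < c * m0.

Lemma uniform_thin_scale r (e : R) : 0 < r -> 0 < e -> exists N, forall i,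
  (\int[@leb R d]_y scale_function (r * 2^-1 ^+ N) i y <= e%:E)%E.
Proof.
move=> r0 e0.
have /choice[n hn] : forall i, exists n, forall m, (n <= m)%N ->
    (\int[@leb R d]_y scale_function (r * 2^-1 ^+ m) i y <= e%:E)%E.
  move=> i; have mB := measurable_ball_rV z Rw.
  have [s s0 hs] := integral_vanishing_thicken cK mB (leb_ball_lty Rw z) (ig i) (gK i) (gW i) e0.
  have [n hn] := geometric_small (2 * r) s0.
  by exists n => m nm; apply: hs; rewrite mulrA; exact: hn.
exists (\max_i n i)%N => i; apply: hn; exact: leq_bigmax.
Qed.

Lemma leb_cross_ge_half r : 0 < r -> 2 * r < R0 -> (((2 * r) ^+ d / 2)%:E <= @leb R d (cross K x0 r))%E.
Proof.
move=> r0 rR; have r20 : 0 < 2 * r by rewrite mulr_gt0.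
have hV : (@leb R d ((ball x0 (2 * r) : set (Rn R d)) `\` K) <= (theta / c * (2 * r) ^+ d)%:E)%E.
  have := le_trans (massK r20 rR) (dens r20 rR).
  by rewrite -lee_pdivlMl// -EFinM; congr (_ <= _%:E)%E; rewrite mulrCA mulrA.
apply: le_trans (leb_cross_ge cK r0 hV); rewrite lee_fin.
have h : 4 * d%:R * (theta / c) <= 1 by rewrite mulrA ler_pdivrMr ?mul1r.
have : 0 <= (2 * r) ^+ d by rewrite exprn_ge0// ltW.
move: h; move: (theta / c) ((2 * r) ^+ d) (d%:R) => a b e h b0.
have := ler_wpM2r b0 h; lra.
Qed.

(** The two bounds are integrated over the cross. The constants: the lower bound is r
    c m0 / 2 on a set of measure (2r)^d / 2, the upper bound is 6 d C 4^d r theta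
    (4r)^d, and small4 says that the latter is smaller. *)
Lemma no_density_point : False.
Proof.
(* Copies in the local context, where lra looks for hypotheses. *)
have [] := (R00, c0, m00, th0) => -[] [] R00' c0' m00' th0'.
have cm : 0 < c * m0 by rewrite mulr_gt0.
(* The fixed scale of the lower bound; r is S / 2^n with n so large that the quadratic
   error B r^2 is at most r c m0 / 2. *)
pose S : R := R0 / 8.
have S0 : 0 < S by rewrite divr_gt0.
have SR : 4 * S < R0 by rewrite /S; lra.
have [B B0 hB] := mollified_difference_ge S0 SR.
have cm2 : 0 < c * m0 / 2 by rewrite divr_gt0.
have [n /(_ n (leqnn n)) hn] := geometric_small (B * S) cm2.
pose r := S * 2^-1 ^+ n.
have r0 : 0 < r by rewrite mulr_gt0// exprn_gt0// invr_gt0.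
have rS : r <= S by rewrite ler_piMr ?(ltW S0)// exprn_ile1 ?invr_ge0// invf_le1 ?ler1n.
have rR : 4 * r < R0 by lra.
have r2R : 2 * r < R0 by lra.
pose V := theta * (4 * r) ^+ d.
have r40 : 0 < 4 * r by rewrite mulr_gt0.
have V0 : 0 < V by rewrite mulr_gt0// exprn_gt0.
have hV : (lam (ball x0 (4 * r) : set (Rn R d)) <= V%:E)%E by exact: dens.
(* At scale r / 2^N the contribution of g near K is as small as the one of lam, which
   is r V up to a constant. *)
have [N hN] := uniform_thin_scale r0 (mulr_gt0 r0 V0).
pose H i x := mollified_bound r N i x.
have mH i : measurable_fun [set: Rn R d] (H i) by exact: measurable_mollified_bound.
have H0 i x : (0 <= H i x)%E by exact: mollified_bound_ge0.
have mHt i (w : 'rV[R]_d) : measurable_fun [set: Rn R d] (fun x : Rn R d => H i ((x : 'rV[R]_d) + w)%R).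
  exact: (measurableT_comp (mH i) (measurable_translation w)).
pose M i (x : Rn R d) := (H i ((x : 'rV[R]_d) - r *: 'e_i)%R + H i ((x : 'rV[R]_d) + r *: 'e_i)%R)%E.
have M0 i x : (0 <= M i x)%E by rewrite adde_ge0.
have mM i : measurable_fun [set: Rn R d] (M i) by apply: emeasurable_funD; exact: mHt.
have upper : (\int[@leb R d]_x \sum_i M i x <= (6 * d%:R * C * 4 ^+ d * r * V)%:E)%E.
  rewrite ge0_integral_sum//.
  apply: (@le_trans _ _ (\sum_(i < d) (2 * (4 ^+ d * C * (r * V + 2 * r * V)))%:E)%E).
    apply: lee_sum => i _.
    have iH : (\int[@leb R d]_x H i x <= (4 ^+ d * C * (r * V + 2 * r * V))%:E)%E.
      by apply: integral_mollified_bound => //; exact: ltW.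
    have iHt (w : 'rV[R]_d) : (\int[@leb R d]_x H i ((x : 'rV[R]_d) + w)%R <= (4 ^+ d * C * (r * V + 2 * r * V))%:E)%E.
      by rewrite ge0_integral_translation.
    by rewrite ge0_integralD// mulr_natl mulr2n EFinD; apply: leeD; exact: iHt.
  rewrite sumEFin sumr_const card_ord lee_fin; move: (4 ^+ d) => a.
  by have -> : 2 * (a * C * (r * V + 2 * r * V)) *+ d = 6 * d%:R * C * a * r * V by ring.
have mX := measurable_cross x0 r cK.
have lower : ((r * (c * m0 / 2))%:E * @leb R d (cross K x0 r) <= \int[@leb R d]_x \sum_i M i x)%E.
  have mS : measurable_fun [set: Rn R d] (fun x => \sum_i M i x)%E by exact: emeasurable_sum.
  have S0' x : (0 <= \sum_i M i x)%E by exact: sume_ge0.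
  apply: (@le_trans _ _ (\int[@leb R d]_(x in cross K x0 r) \sum_i M i x)%E); last first.
    by apply: ge0_subset_integral.
  rewrite -integral_cst//; apply: ge0_le_integral => //.
  - by move=> x _; rewrite lee_fin mulr_ge0// ltW.
  - exact: measurable_funTS.
  move=> x [/ball_normP xr xK].
  have re i : `|r *: ('e_i : 'rV[R]_d)| <= r.
    by rewrite normrZ (gtr0_norm r0) ler_piMr ?(ltW r0)// norm_e.
  have HM i : ((mollified i r (x - r *: 'e_i) - mollified i r (x + r *: 'e_i))%:E <= M i x)%E.
    have [Km Kp] := xK i.
    have hm : `|x0 - (x - r *: 'e_i)| < 2 * r.
      have := ler_normD (x0 - x) (r *: 'e_i); have := re i; rewrite opprB addrA (addrAC _ _ (- x)); lra.
    have hp : `|x0 - (x + r *: 'e_i)| < 2 * r.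
      have := ler_normB (x0 - x) (r *: 'e_i); have := re i; rewrite opprD addrA; lra.
    have bm := mollified_boundP r0 rR N i Km hm.
    have bp := mollified_boundP r0 rR N i Kp hp.
    apply: le_trans (leeD bm bp); rewrite -EFinD lee_fin.
    by apply: (le_trans (ler_norm _)); exact: ler_normB.
  apply: (@le_trans _ _ (\sum_i (mollified i r (x - r *: 'e_i) - mollified i r (x + r *: 'e_i))%:E)%E); last first.
    by apply: lee_sum => i _; exact: HM.
  rewrite sumEFin lee_fin; apply: le_trans (hB n x _); last by rewrite distrC ltW.
  rewrite -/r.
  have s1 := ler_wpM2l (ltW r0) small1.
  have s2 := ler_wpM2l (ltW r0) small2.
  have s3 : B * r ^+ 2 <= r * (c * m0 / 2).
    by rewrite expr2 mulrA mulrC ler_wpM2l ?(ltW r0)// /r mulrA.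
  move: s1 s2 s3; move: (C * 2 ^+ d * theta) (B * r ^+ 2) (4 * C * d%:R ^+ 2 * 4 ^+ d * theta) (c * m0) => a1 a2 a3 a4.
  nra.
have := leb_cross_ge_half r0 r2R => half.
have rc : 0 <= r * (c * m0 / 2) by rewrite mulr_ge0// ltW.
have := le_trans (lee_wpmul2l _ half) (le_trans lower upper).
rewrite !lee_fin => /(_ rc).
have e4 : (4 : R) ^+ d = 2 ^+ d * 2 ^+ d by rewrite -exprMn; congr (_ ^+ d); lra.
have e4r : (4 * r) ^+ d = 2 ^+ d * 2 ^+ d * r ^+ d by rewrite exprMn e4.
have e2r : (2 * r) ^+ d = 2 ^+ d * r ^+ d by rewrite exprMn.
rewrite /V e4r e2r e4.
have : 0 < 2 ^+ d * r ^+ d * r by rewrite !mulr_gt0// exprn_gt0.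
move: small4; rewrite (_ : (8 : R) ^+ d = 2 ^+ d * 2 ^+ d * 2 ^+ d); last first.
  by rewrite -!exprMn; congr (_ ^+ d); lra.
move: (2 ^+ d) (r ^+ d) (d%:R) (c * m0) => a b e f h1 h2.
rewrite leNgt => /negP; apply.
have := ltr_pM2l h2; move=> /(_ (24 * e * C * (a * a * a) * theta) f); rewrite h1.
move=> h3; lra.
Qed.

End density_point.

(** * The kernels and the constants they determine *)

Section kernel_package.
Context {R : realType} {d : nat}.
Implicit Types (x y : 'rV[R]_d) (r s : R) (i j k : 'I_d) (phi psi : 'rV[R]_d -> R).

Lemma foldr_partial_difference phi psi (a : R) l : smooth phi -> smooth psi ->
  foldr partial (fun y => phi y - a * psi y) l = fun y => foldr partial phi l y - a * foldr partial psi l y.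
Proof.
move=> sphi spsi; elim: l => [//|i l /= ->].
apply: partialE => y; apply: is_deriveB.
  by have [_ /(_ i y) /derivableP] := sphi l.
by apply: is_derive_scalef; have [_ /(_ i y) /derivableP] := spsi l.
Qed.

Lemma smooth_difference phi psi (a : R) : smooth phi -> smooth psi -> smooth (fun y => phi y - a * psi y).
Proof.
move=> sphi spsi l; rewrite foldr_partial_difference//=.
have [c1 d1] := sphi l; have [c2 d2] := spsi l; split => [y|i y].
  by apply: continuousB; [exact: c1|exact: continuous_scalef].
apply: derivableB; first exact: d1.
by have := is_derive_scalef a (derivableP (d2 i y)) => -[].
Qed.

(** Only a ball on which eta is bounded below is counted, so that no change of
    variables is needed. *)
Lemma averaging_kernel_mass (eta : 'rV[R]_d -> R) p : smooth eta -> supported_within 1 eta ->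
  (forall y, 0 <= eta y) -> 0 < eta p ->
  exists2 m0 : R, 0 < m0 & forall s x, 0 < s -> m0 <= \int[@leb R d]_y averaging_kernel eta s x y.
Proof.
move=> seta beta eta0 ep; have ceta := smooth_continuous seta.
have ep2 : eta p / 2 < eta p by lra.
have /nbhs_ballP[k /= k0 hk] : \forall y \near p, eta p / 2 < eta y.
  by have := ceta p => /(cvgr_gt _); apply.
have e20 : 0 < eta p / 2 by rewrite divr_gt0.
exists (eta p / 2 * (2 * k) ^+ d); first by rewrite mulr_gt0 ?exprn_gt0 ?mulr_gt0.
move=> s x s0; have s1 : 0 < s^-1 by rewrite invr_gt0.
have sd : 0 < s^-1 ^+ d by rewrite exprn_gt0.
have sk : 0 < s * k by rewrite mulr_gt0.
pose B : set (Rn R d) := ball (x + s *: p) (s * k).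
have iB := integrable_indic_ball (x + s *: p) (s * k).
have i1 : (@leb R d).-integrable [set: Rn R d] (EFin \o (fun y => s^-1 ^+ d * (eta p / 2) * \1_B y)).
  by have := @integrableZl _ _ _ (@leb R d) setT measurableT (s^-1 ^+ d * (eta p / 2)) _ iB.
have ie : (@leb R d).-integrable [set: Rn R d] (EFin \o averaging_kernel eta s x).
  apply: (@supported_within_integrable R d (@leb R d) _ (`|x| + s)).
  - exact: smooth_rescale.
  - exact: supported_within_rescale.
  - by move=> t; exact: leb_ball_lty.
have E : \int[@leb R d]_y (s^-1 ^+ d * (eta p / 2) * \1_B y) = eta p / 2 * (2 * k) ^+ d.
  rewrite RintegralZl//.
  have -> : \int[@leb R d]_y \1_B y = (s * k *+ 2) ^+ d.
    by rewrite /Rintegral integral_indic ?setIT//=; [rewrite leb_ball|exact: measurable_ball_rV].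
  have -> : s * k *+ 2 = s * (2 * k) by ring.
  rewrite exprMn; have : s^-1 ^+ d * s ^+ d = 1 by rewrite -exprMn mulVf ?expr1n// gt_eqF.
  move: (s^-1 ^+ d) (s ^+ d) (_ ^+ d) => a b e ab.
  by rewrite -[RHS]mul1r -ab; ring.
rewrite -E; apply: le_Rintegral => //.
move=> y _; rewrite /averaging_kernel -mulrA ler_wpM2l ?(ltW sd)// indicE.
case: (boolP (y \in B)) => [|_]; last by rewrite mulr0.
rewrite in_setE mulr1 => yB; apply: ltW; apply: hk.
apply/ball_normP; move/ball_normP: yB => yB; rewrite rescaleE.
have -> : p - s^-1 *: (y - x) = s^-1 *: (x + s *: p - y).
  apply/rowP => j; rewrite !mxE; field; rewrite gt_eqF//.
by rewrite normrZ gtr0_norm// mulrC ltr_pdivrMr// mulrC.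
Qed.

Lemma kernel_package : (0 < d)%N -> exists zeta eta (C m0 : R),
  [/\ smooth zeta /\ smooth eta,
      supported_within 1 zeta /\ supported_within 1 eta,
      (forall y, laplacian zeta y = 2 ^+ d * eta (2 *: y) - eta y) &
      (forall i, laplacian (partial i zeta) = partial i (fun y => 2 ^+ d * eta (2 *: y) - eta y))] /\
  [/\ 0 <= C,
      forall i y, `|partial i zeta y| <= C,
      forall y, `|eta y| <= C,
      forall i j k y, `|partial k (partial j (partial i zeta)) y| <= C &
      forall i k y, `|partial k (partial i eta) y| <= C] /\
  (0 < m0 /\ forall s x, 0 < s -> m0 <= \int[@leb R d]_y averaging_kernel eta s x y).
Proof.
move=> d0; have [zeta [eta [[sz se] [bz be] [eta0 [p ep]] lap lapp]]] := @kernels R d d0.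
have bz1 : supported_within 1 zeta by move=> y /ltW; exact: bz.
have be1 : supported_within 1 eta by move=> y /ltW; exact: be.
have bnd phi : smooth phi -> supported_within 1 phi -> exists2 C : R, 0 <= C & forall y, `|phi y| <= C.
  by move=> /smooth_continuous; exact: supported_within_bounded.
have [A1 A10 hA1] := @finite_family_bounded R d 'I_d (fun i => partial i zeta)
  (fun i => bnd _ (smooth_partial i sz) (supported_within_partial i bz1)).
have [A2 A20 hA2] := bnd _ se be1.
have [A3 A30 hA3] := @finite_family_bounded R d ('I_d * 'I_d * 'I_d)%type
  (fun q => partial q.2 (partial q.1.2 (partial q.1.1 zeta)))
  (fun q => bnd _ (smooth_partial _ (smooth_partial _ (smooth_partial _ sz)))
    (supported_within_partial _ (supported_within_partial _ (supported_within_partial _ bz1)))).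
have [A4 A40 hA4] := @finite_family_bounded R d ('I_d * 'I_d)%type (fun q => partial q.2 (partial q.1 eta))
  (fun q => bnd _ (smooth_partial _ (smooth_partial _ se))
    (supported_within_partial _ (supported_within_partial _ be1))).
have [m0 m00 hm0] := averaging_kernel_mass se be1 eta0 ep.
exists zeta, eta, (A1 + A2 + A3 + A4), m0; split; first by split.
split => //; split.
- by rewrite !addr_ge0.
- by move=> i y; apply: (le_trans (hA1 i y)); lra.
- by move=> y; apply: (le_trans (hA2 y)); lra.
- by move=> i j k y; apply: (le_trans (hA3 (i, j, k) y)); lra.
- by move=> i k y; apply: (le_trans (hA4 (i, k) y)); lra.
Qed.

Lemma small_constant (C m0 : R) : 0 <= C -> 0 < m0 -> exists2 kappa : R, 0 < kappa &
  [/\ 4 * (C * 2 ^+ d * kappa) <= m0, 2 * (4 * C * d%:R ^+ 2 * 4 ^+ d * kappa) <= m0,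
      4 * d%:R * kappa <= 1 & 24 * d%:R * C * 8 ^+ d * kappa < m0].
Proof.
move=> C0 m00.
pose D1 := 4 * (C * 2 ^+ d); pose D2 := 2 * (4 * C * d%:R ^+ 2 * 4 ^+ d).
pose D3 := 4 * d%:R * m0; pose D4 := 24 * d%:R * C * 8 ^+ d.
have D10 : 0 <= D1 by rewrite !mulr_ge0// exprn_ge0.
have D20 : 0 <= D2 by rewrite !mulr_ge0// exprn_ge0.
have D30 : 0 <= D3 by rewrite !mulr_ge0// ltW.
have D40 : 0 <= D4 by rewrite !mulr_ge0// exprn_ge0.
pose D := 1 + D1 + D2 + D3 + D4.
have D0 : 0 < D by rewrite /D; lra.
have H a : a <= D -> a * (m0 / D) <= m0.
  by move=> aD; rewrite mulrA ler_pdivrMr// mulrC ler_wpM2l// ltW.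
exists (m0 / D); first by rewrite divr_gt0.
split.
- have : D1 * (m0 / D) <= m0 by apply: H; rewrite /D; lra.
  by rewrite /D1 -!mulrA.
- have : D2 * (m0 / D) <= m0 by apply: H; rewrite /D; lra.
  by rewrite /D2 -!mulrA.
- by rewrite mulrA ler_pdivrMr// mul1r -/D3 /D; lra.
- by rewrite -/D4 mulrA ltr_pdivrMr// mulrC ltr_pM2l// /D; lra.
Qed.

End kernel_package.

Section local_equations.
Context {R : realType} {d : nat}.
Implicit Types (x y : 'rV[R]_d) (r s : R) (i j k : 'I_d).

(** Here the equation of h takes the form of two identities for smooth functions
    supported near x0. For the second one, the weak gradient moves the derivative from
    psi to h, and the Laplacian of the i-th derivative of Z appears; the hypothesis on
    Z and psi replaces the commutation of the two operators. *)
Lemma no_concentration_point : (0 < d)%N -> exists2 kappa : R, 0 < kappa &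
  forall (lam : {finite_measure set (Rn R d) -> \bar R}) (J : ('rV[R]_d -> R) -> R)
    (g : 'I_d -> Rn R d -> R) (K : set 'rV[R]_d) (x0 : 'rV[R]_d) (c R0 : R),
  0 < R0 -> 0 < c -> linear_functional J ->
  (forall f, bounded_measurable f -> (forall y, R0 <= `|x0 - y| -> f y = 0) ->
    (`|J f - c * \int[@leb R d]_y f y|%:E <= \int[lam]_y (`|f y|)%:E)%E) ->
  (forall i, (@leb R d).-integrable [set: Rn R d] (EFin \o g i)) ->
  (forall i y, ~ ball x0 (2 * R0) y -> g i y = 0) ->
  closed K -> (forall i y, K y -> g i y = 0) ->
  (forall phi, smooth phi -> (forall y, R0 <= `|x0 - y| -> phi y = 0) ->
    \sum_i \int[@leb R d]_y (g i y * partial i phi y) = J phi) ->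
  (forall i Z psi, smooth Z -> smooth psi -> laplacian (partial i Z) = partial i psi ->
    (forall y, R0 <= `|x0 - y| -> Z y = 0) -> (forall y, R0 <= `|x0 - y| -> psi y = 0) ->
    \int[@leb R d]_y (g i y * psi y) = J (partial i Z)) ->
  (forall s, 0 < s -> s < R0 -> (lam (ball x0 s : set (Rn R d)) <= (c * kappa * s ^+ d)%:E)%E) ->
  (forall s, 0 < s -> s < R0 ->
    (c%:E * @leb R d ((ball x0 s : set (Rn R d)) `\` K) <= lam (ball x0 s : set (Rn R d)))%E) -> False.
Proof.
move=> d0; have [zeta [eta [C [m0 [[[sz se] [bz be] lap lapp] [[C0 C1 Ce C3 Ce2] [m00 mass]]]]]]] := @kernel_package R d d0.
have [kappa kappa0 [k1 k2 k3 k4]] := @small_constant R d C m0 C0 m00.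
exists kappa => // lam J g K x0 c R0 R00 c0 linJ HJ ig gW cK gK hdiv hcurl dens massK.
have bav := bounded_averaging_kernel se be.
have ac0 s x y : 0 < s -> `|x0 - x| + s < R0 -> R0 <= `|x0 - y| -> s < `|x - y|.
  by move=> s0 xs hy; have := ler_normD (x0 - x) (x - y); rewrite addrA subrK; lra.
have F1 i s x : 0 < s -> `|x0 - x| + s < R0 ->
    mollified eta g i (s / 2) x - mollified eta g i s x = J (transfer_kernel zeta i s x).
  move=> s0 xs; have sn0 : s != 0 by rewrite gt_eqF.
  have s20 : 0 < s / 2 by rewrite divr_gt0.
  (* Z is the potential whose i-th derivative is the transfer kernel, and psi its
     Laplacian, the difference of the mollifiers at the scales s/2 and s. *)
  pose theta y := 2 ^+ d * eta (2 *: y) - eta y.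
  have stheta : smooth theta.
    have := smooth_difference 1 (smooth_dilation 2 0 (2 ^+ d) se) se.
    by congr smooth; apply/funext => y; rewrite /theta /dilation addr0 mul1r.
  pose Z y := s ^+ 2 * s^-1 ^+ d * zeta (rescale s x y).
  pose psi y := s^-1 ^+ d * theta (rescale s x y).
  have psiE : psi = fun y => averaging_kernel eta (s / 2) x y - averaging_kernel eta s x y.
    apply/funext => y; rewrite -(sum_hessian_kernel lap)// /psi /theta -lap.
    by rewrite /laplacian mulr_sumr.
  have ZE i' : partial i' Z = transfer_kernel zeta i' s x.
    rewrite /Z partial_rescale//; apply/funext => y; rewrite /transfer_kernel; congr (_ * _).
    by move: (s^-1 ^+ d) => a; field.
  have hZ := hcurl i Z psi.
  rewrite -ZE -hZ; first last.
  - move=> y hy; rewrite psiE /averaging_kernel !rescale_eq0 ?mulr0 ?subrr//; first exact: ac0 hy.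
    by apply: lt_trans (ac0 _ _ _ s0 xs hy); lra.
  - by move=> y hy; rewrite /Z rescale_eq0 ?mulr0//; exact: ac0 hy.
  - rewrite ZE [RHS]partial_rescale// -(lapp i); apply/funext => y.
    rewrite /laplacian mulr_sumr; apply: eq_bigr => k _.
    rewrite /transfer_kernel partial_rescale; last exact: smooth_partial.
    rewrite partial_rescale; last by do 2 apply: smooth_partial.
    by congr (_ * _); move: (s^-1 ^+ d) => a; field.
  - exact: smooth_rescale.
  - exact: smooth_rescale.
  have lin := linear_functional_integral (ig i).
  by rewrite psiE (linear_functionalB lin)//; exact: bav.
have F2 s : 0 < s -> s < R0 ->
    \sum_i \int[@leb R d]_y (g i y * (s^-1 ^+ d / s * partial i eta (rescale s x0 y))) = J (averaging_kernel eta s x0).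
  move=> s0 sR; rewrite -hdiv; first last.
  - by move=> y hy; rewrite /averaging_kernel rescale_eq0 ?mulr0//; apply: lt_le_trans hy.
  - exact: smooth_rescale.
  by apply: eq_bigr => i _; rewrite /averaging_kernel partial_rescale.
have scale (a b : R) : a * kappa <= b -> a * (c * kappa) <= c * b.
  by move=> h; rewrite mulrCA ler_wpM2l// ltW.
apply: (no_density_point sz se bz be lap C0 C1 Ce C3 Ce2 linJ HJ ig F1 F2 dens _ c0 mass cK gK gW massK R00 m00).
- by rewrite mulr_gt0.
- by rewrite mulrA; apply: scale; rewrite -mulrA.
- by rewrite mulrA; apply: scale; rewrite -mulrA.
- by have := scale _ _ k3; rewrite mulr1.
- by rewrite mulrCA ltr_pM2l.
Qed.

End local_equations.

(** * Level sets of a density and points of concentration *)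

Section density_level.
Context {R : realType} {d : nat}.
Implicit Types (x y : 'rV[R]_d) (A E K : set (Rn R d)).

Lemma countable_cover_positive (m : {measure set (Rn R d) -> \bar R}) A (F : nat -> set (Rn R d)) :
  measurable A -> (forall n, measurable (F n)) -> A `<=` \bigcup_n F n -> (0 < m A)%E ->
  exists n, (0 < m (A `&` F n))%E.
Proof.
move=> mA mF AF mA0; apply: contrapT => h.
suff : m A = 0%E by move=> H; move: mA0; rewrite H ltxx.
apply: measure_negligible => //.
apply: (@negligibleS _ _ _ m (\bigcup_n (A `&` F n))).
  by move=> x Ax; have [n _ Fx] := AF x Ax; exists n.
apply: negligible_bigcup => n; apply/negligibleP; first exact: measurableI.
apply/eqP; rewrite -measure_le0 leNgt; apply/negP => H; apply: h; by exists n.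
Qed.

Lemma closed_bounded_compact (K : set 'rV[R]_d) (r : R) : closed K -> K `<=` ball 0 r -> compact K.
Proof.
move=> cK Kr; apply: (subclosed_compact cK (compact_cball0 (r := r))) => y /Kr /ball_normP.
by rewrite sub0r normrN => /ltW.
Qed.

(** The level sets c (1 - e) < f < c (1 + e) of the Radon-Nikodym derivative f, for
    rational c > 0, cover the set where f > 0; so one of them is charged by m, and
    contains a closed set that is charged too. *)
Lemma near_constant_density (m : {finite_measure set (Rn R d) -> \bar R}) A (e M : R) :
  m `<< @leb R d -> measurable A -> A `<=` ball (0 : 'rV[R]_d) M -> (0 < m A)%E -> 0 < e < 1 ->
  exists c K, [/\ 0 < c, closed (K : set 'rV[R]_d), K `<=` A, (0 < @leb R d K)%E &
    forall E, measurable E -> E `<=` K ->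
      (m E <= c%:E * @leb R d E + (e * c)%:E * @leb R d E)%E /\
      (c%:E * @leb R d E <= m E + (e * c)%:E * @leb R d E)%E].
Proof.
move=> mleb mA AM mA0 /andP[e0 e1].
pose nu := charge_of_finite_measure m.
pose f := Radon_Nikodym nu (@leb R d).
have mlebn : nu `<< @leb R d by [].
have ffin x : f x \is a fin_num by exact: Radon_Nikodym_fin_num.
have fint : (@leb R d).-integrable setT f by exact: Radon_Nikodym_integrable.
have mf : measurable_fun setT f by exact: measurable_int fint.
have fE E : measurable E -> m E = (\int[@leb R d]_(x in E) f x)%E.
  by move=> mE; exact: (Radon_Nikodym_integral mlebn mE).
pose L c : set (Rn R d) := [set x | ((c * (1 - e))%:E < f x)%E] `&` [set x | (f x < (c * (1 + e))%:E)%E].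
have mL c : measurable (L c).
  by apply: measurableI; rewrite -[X in measurable X]setTI; [exact: emeasurable_fun_o_infty|exact: emeasurable_fun_infty_o].
(* Index 0 is the set where the density is nonpositive, index n + 1 the level set of
   the n-th rational number if that is positive. *)
pose F n : set (Rn R d) := if n is n'.+1 then
    (if (unpickle n' : option rat) is Some q then if 0 < q then L (ratr q) else set0 else set0)
  else [set x | (f x <= 0)%E].
have mF n : measurable (F n).
  case: n => [|n] /=; first by rewrite -[X in measurable X]setTI; exact: emeasurable_fun_infty_c.
  by case: (unpickle n) => [q|//]; case: ifP => // _; exact: mL.
have cover : A `<=` \bigcup_n F n.
  move=> x _; have [f0|f0] := leP (f x) 0%E; first by exists 0%N.
  pose t := fine (f x).
  have tE : f x = t%:E by rewrite fineK.
  have t0 : 0 < t by rewrite -lte_fin -tE.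
  have pe : 0 < 1 + e by lra.
  have me : 0 < 1 - e by lra.
  have lt : t / (1 + e) < t / (1 - e).
    by rewrite ltr_pM2l// ltf_pV2 ?posrE//; lra.
  have [q] := rat_in_itvoo lt.
  rewrite in_itv/= => /andP[q1 q2].
  have q0 : 0 < q.
    by rewrite -(ltr0q R); apply: lt_trans q1; rewrite divr_gt0.
  have FL k : unpickle k = Some q -> F k.+1 = L (ratr q) by move=> qk; rewrite /F qk q0.
  have Lx : L (ratr q) x.
    by split; rewrite /= tE lte_fin; [rewrite -ltr_pdivlMr|rewrite -ltr_pdivrMr].
  by move: (pickle q) (pickleK q) => k /FL FLk; exists k.+1; [|rewrite FLk].
have [[|n]] := countable_cover_positive mA mF cover mA0; rewrite /F.
  have mI : measurable (A `&` [set x | (f x <= 0)%E]) by apply: measurableI => //; exact: (mF 0%N).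
  move=> h; suff : (m (A `&` [set x | (f x <= 0)%E]) <= 0)%E by rewrite leNgt => /negP.
  rewrite fE// -[leRHS](integral0 (@leb R d) (A `&` [set x | (f x <= 0)%E])); apply: le_integral => //.
  - exact: integrableS fint.
  - exact: integrable0.
  - by move=> x; rewrite inE => -[].
case: (unpickle n) => [q|]; last by rewrite setI0 measure0 ltxx.
case: ifP => [q0|]; last by rewrite setI0 measure0 ltxx.
pose c : R := ratr q; rewrite -/c => mAL.
have c0 : 0 < c by rewrite ltr0q.
have mI : measurable (A `&` L c) by apply: measurableI.
have mfin : m (A `&` L c) \is a fin_num by exact: fin_num_measure.
have m0 : 0 < fine (m (A `&` L c)) by rewrite fine_gt0// mAL/= ltey_eq mfin.
have [K [cK KA mK]] := inner_regular m mI m0.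
have mKm := closed_measurable_rV cK.
exists c, K; split => //.
- by move=> x /KA [].
- rewrite lt_neqAle measure_ge0 andbT eq_sym; apply/eqP => K0.
  have mK0 : m K = 0%E by move/null_content_dominatesP: mleb => /(_ K mKm K0).
  have mD : m ((A `&` L c) `\` K) = (m (A `&` L c) - m K)%E.
    by rewrite measureD ?(setIidr KA)//; rewrite ltey_eq mfin.
  by move: mK; rewrite fineK// mD mK0 sube0 ltxx.
move=> E mE EK.
have EL x : E x -> L c x by move=> /EK /KA [].
have ce0 : 0 <= c * (1 - e) by rewrite mulr_ge0 ?(ltW c0)//; lra.
have f0 x : E x -> (0 <= f x)%E.
  by move=> /EL [/= h _]; apply: le_trans (ltW h); rewrite lee_fin.
have mfE : measurable_fun E f by exact: measurable_funTS.
have ec0 : 0 <= e * c by rewrite mulr_ge0// ltW.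
have lowE : ((c * (1 - e))%:E * @leb R d E <= m E)%E.
  rewrite fE// -integral_cst//; apply: ge0_le_integral => //.
  by move=> x /EL [/ltW].
have uppE : (m E <= (c * (1 + e))%:E * @leb R d E)%E.
  rewrite fE// -integral_cst//; apply: ge0_le_integral => //.
  by move=> x /EL [_ /ltW].
split.
  rewrite -ge0_muleDl ?lee_fin ?(ltW c0)//; apply: le_trans uppE _.
  by rewrite (_ : c * (1 + e) = c + e * c)//; ring.
apply: le_trans (leeD lowE (lexx _)); rewrite -ge0_muleDl ?lee_fin//.
by rewrite (_ : (_ + _)%E = c%:E)// -EFinD; congr EFin; ring.
Qed.

End density_level.

Section concentration.
Context {R : realType} {d : nat}.
Implicit Types (x y : 'rV[R]_d) (A E : set (Rn R d)).

Lemma finite_measure_of (m : {measure set (Rn R d) -> \bar R}) : (m setT < +oo)%E ->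
  exists lam : {finite_measure set (Rn R d) -> \bar R}, forall A, lam A = m A.
Proof.
by move=> fm; exists (mfrestr measurableT fm) => A; rewrite /= /mfrestr /mrestr setIT.
Qed.

Lemma bounded_measurable_integrable (m : {finite_measure set (Rn R d) -> \bar R}) (f : 'rV[R]_d -> R) :
  bounded_measurable f -> m.-integrable [set: Rn R d] (EFin \o f).
Proof.
move=> bf; have i1 : m.-integrable [set: Rn R d] (EFin \o cst (1 : R)).
  exact: finite_measure_integrable_cst.
have := integrable_mul_bounded i1 bf.
by congr (_.-integrable _ _); apply/funext => y /=; rewrite mul1r.
Qed.

Lemma bounded_measurable_funpos (f : 'rV[R]_d -> R) : bounded_measurable f ->
  bounded_measurable (fun y => Num.max (f y) 0) /\ bounded_measurable (fun y => Num.max (- f y) 0).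
Proof.
move=> [mf [C hC]]; split; split.
- by apply: measurable_maxr => //; exact: measurable_cst.
- exists C => y; apply: le_trans (hC y); rewrite maxEle; case: ifP => _ //; by rewrite normr0.
- by apply: measurable_maxr; [exact: measurableT_comp|exact: measurable_cst].
- by exists C => y; apply: le_trans (hC y); rewrite maxEle; case: ifP => _; rewrite ?normr0 ?normrN.
Qed.

(** A setwise comparison of measures gives a comparison of integrals of nonnegative
    functions, and f is the difference of two of them. *)
Lemma comparison_integral_bound (rho mu m lam : {finite_measure set (Rn R d) -> \bar R}) (f : 'rV[R]_d -> R) :
  (forall E, measurable E -> rho E <= mu E + m E + lam E)%E ->
  (forall E, measurable E -> mu E + m E <= rho E + lam E)%E ->
  bounded_measurable f ->
  ((`|\int[rho]_y f y - \int[mu]_y f y - \int[m]_y f y|)%:E <= \int[lam]_y (`|f y|)%:E)%E.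
Proof.
have posneg (t : R) : Num.max t 0 - Num.max (- t) 0 = t /\ Num.max t 0 + Num.max (- t) 0 = `|t|.
  have [t0|t0] := leP t 0.
    by rewrite max_l ?oppr_ge0// ler0_norm// opprK !add0r.
  by rewrite max_r ?oppr_le0 ?ltW// gtr0_norm// subr0 addr0.
move=> H1 H2 bf; have [bp bn] := bounded_measurable_funpos bf.
have RintE (nu : {finite_measure set (Rn R d) -> \bar R}) k : bounded_measurable k ->
    (\int[nu]_y k y)%:E = (\int[nu]_y (k y)%:E)%E.
  move=> bk; rewrite /Rintegral fineK//.
  exact: (integrable_fin_num measurableT (bounded_measurable_integrable nu bk)).
have half k : bounded_measurable k -> (forall y, 0 <= k y) ->
    `|\int[rho]_y k y - \int[mu]_y k y - \int[m]_y k y| <= \int[lam]_y k y.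
  move=> bk k0; have mk : measurable_fun [set: Rn R d] (fun y => (k y)%:E).
    by apply/measurable_EFinP; case: bk.
  have k0' y : (0 <= (k y)%:E)%E by rewrite lee_fin.
  have add2 (m1 m2 : {finite_measure set (Rn R d) -> \bar R}) E : measure_add m1 m2 E = (m1 E + m2 E)%E.
    exact: measure_addE.
  have add3 E : measure_add (measure_add mu m) lam E = (mu E + m E + lam E)%E.
    by rewrite -add2; exact: measure_addE.
  have h1 : (\int[rho]_y (k y)%:E <= \int[measure_add (measure_add mu m) lam]_y (k y)%:E)%E.
    by apply: ge0_le_measure_integral => // E mE; have := H1 E mE; rewrite -add3.
  have h2 : (\int[measure_add mu m]_y (k y)%:E <= \int[measure_add rho lam]_y (k y)%:E)%E.
    by apply: ge0_le_measure_integral => // E mE; have := H2 E mE; rewrite -!add2.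
  move: h1 h2; rewrite !ge0_integral_measure_add// -!RintE// -!EFinD !lee_fin => h1 h2.
  by rewrite ler_norml; apply/andP; split; lra.
have splitE (nu : {finite_measure set (Rn R d) -> \bar R}) : \int[nu]_y f y = \int[nu]_y Num.max (f y) 0 - \int[nu]_y Num.max (- f y) 0.
  rewrite -RintegralB//; [|exact: bounded_measurable_integrable|exact: bounded_measurable_integrable].
  by apply: eq_Rintegral => y _; have [->] := posneg (f y).
have -> : (\int[lam]_y (`|f y|)%:E = (\int[lam]_y Num.max (f y) 0 + \int[lam]_y Num.max (- f y) 0)%:E)%E.
  rewrite EFinD !RintE// -ge0_integralD//; first last.
  - by apply/measurable_EFinP; case: bn.
  - by move=> y _; rewrite lee_fin le_max lexx orbT.
  - by apply/measurable_EFinP; case: bp.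
  - by move=> y _; rewrite lee_fin le_max lexx orbT.
  apply: eq_integral => y _; rewrite -EFinD; congr EFin.
  by have [_ ->] := posneg (f y).
have p0 y : 0 <= Num.max (f y) 0 by rewrite le_max lexx orbT.
have n0 y : 0 <= Num.max (- f y) 0 by rewrite le_max lexx orbT.
have h1 := half _ bp p0; have h2 := half _ bn n0.
rewrite lee_fin !splitE.
move: h1 h2; move: (\int[rho]_y _) (\int[mu]_y _) (\int[m]_y _) (\int[lam]_y _)
  (\int[rho]_y _) (\int[mu]_y _) (\int[m]_y _) (\int[lam]_y _) => a1 a2 a3 a4 b1 b2 b3 b4.
rewrite !ler_norml => /andP[u1 u2] /andP[v1 v2]; apply/andP; split; lra.
Qed.

(** If lam were denser than stated at some scale around every point of K, the covering
    bound would make lam (thicken K s0), hence about lam K, larger than it is. *)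
Lemma concentration_point (lam : {finite_measure set (Rn R d) -> \bar R}) (K : set 'rV[R]_d) (c kappa : R) :
  0 < c -> 0 < kappa -> compact K -> closed K -> (0 < @leb R d K)%E ->
  (lam K <= (kappa / (4 * 6 ^+ d) * c)%:E * @leb R d K)%E ->
  exists x0 s0, [/\ K x0, 0 < s0 & forall s, 0 < s -> s <= s0 ->
    (lam (ball x0 s : set (Rn R d)) <= (c * kappa * s ^+ d)%:E)%E].
Proof.
move=> c0 k0 coK cK K0 lK; have mK := closed_measurable_rV cK.
have [M KM] : exists M : R, K `<=` ball 0 M.
  have [M [_ hM]] := compact_bounded coK.
  exists (M + 2) => y Ky; apply/ball_normP; rewrite sub0r normrN.
  by apply: le_lt_trans (hM (M + 1) _ y Ky) _; lra.
have Kfin : @leb R d K \is a fin_num.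
  rewrite ge0_fin_numE//; apply: le_lt_trans (leb_ball_lty M 0).
  by apply: le_measure => //; rewrite ?inE//; exact: measurable_ball_rV.
pose v := fine (@leb R d K); have vE : @leb R d K = v%:E by rewrite fineK.
have v0 : 0 < v by rewrite -lte_fin -vE.
have d6 : 0 < (6 : R) ^+ d by rewrite exprn_gt0.
pose ep := kappa / (4 * 6 ^+ d) * c.
have ep0 : 0 < ep by rewrite mulr_gt0// divr_gt0// mulr_gt0.
have [s0 s00 hs] := @thin_thicken R d lam K (ep * v) cK (mulr_gt0 ep0 v0).
have lT : (lam (thicken K s0 : set (Rn R d)) <= (2 * (ep * v))%:E)%E.
  have mT := measurable_thicken K s0.
  rewrite (measureDI lam mT mK) mulr_natl mulr2n EFinD; apply: leeD; first exact: ltW.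
  apply: le_trans (_ : (lam K <= _)%E); last by rewrite EFinM -vE.
  by apply: le_measure; rewrite ?inE//; exact: measurableI.
apply: contrapT => h.
have bad x : K x -> exists s, [/\ 0 < s, s <= s0 & ((c * kappa * s ^+ d)%:E < lam (ball x s : set (Rn R d)))%E].
  move=> Kx; apply: contrapT => h2; apply: h; exists x, s0; split => // s s1 s2.
  by rewrite leNgt; apply/negP => h3; apply: h2; exists s.
have ck : 0 < c * kappa by rewrite mulr_gt0.
have := covering_bound ck coK bad.
rewrite vE => /le_trans /(_ (lee_wpmul2l _ lT)); rewrite -!EFinM !lee_fin => /(_ (ltW d6)).
apply/negP; rewrite -ltNge /ep.
have -> : 6 ^+ d * (2 * (kappa / (4 * 6 ^+ d) * c * v)) = c * kappa * v / 2.
  by field; rewrite gt_eqF.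
have : 0 < c * kappa * v by rewrite mulr_gt0.
lra.
Qed.

End concentration.

(** * Comparison of the measures with a multiple of Lebesgue measure *)

Section local_vanishing.
Context {R : realType} {d : nat}.
Implicit Types (x y : 'rV[R]_d) (i j k : 'I_d) (A E : set (Rn R d)) (phi psi : 'rV[R]_d -> R).

(** The function vanishes on a neighbourhood of y, because A is closed. *)
Lemma partial_off_closed (A : set 'rV[R]_d) phi i : closed A -> (forall y, ~ A y -> phi y = 0) ->
  forall y, ~ A y -> partial i phi y = 0.
Proof.
move=> cA phiA y Ay; rewrite /partial (@near_eq_derive _ _ _ phi (cst 0)) ?derive_cst//.
near=> z; rewrite phiA//; near: z.
exact: (open_nbhs_nbhs (conj (closed_openC cA) Ay)).
Unshelve. all: by end_near. Qed.

Lemma linear_functional_ext_nonneg (L1 L2 : ('rV[R]_d -> R) -> R) :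
  linear_functional L1 -> linear_functional L2 ->
  (forall f, bounded_measurable f -> (forall y, 0 <= f y) -> L1 f = L2 f) ->
  forall f, bounded_measurable f -> L1 f = L2 f.
Proof.
move=> lin1 lin2 H f bf; have [bp bn] := bounded_measurable_funpos bf.
have -> : f = fun y => Num.max (f y) 0 - Num.max (- f y) 0.
  apply/funext => y; have [f0|f0] := leP (f y) 0.
    by rewrite max_l ?oppr_ge0// opprK add0r.
  by rewrite max_r ?oppr_le0 ?ltW// subr0.
rewrite !linear_functionalB//; congr (_ - _); apply: H => // y.
  by rewrite le_max lexx orbT.
by rewrite le_max lexx orbT.
Qed.

(** Both sides are linear in f, so nonnegative functions suffice, for which integrals
    can be compared measure by measure. *)
Lemma integral_scaled_restriction (m : {finite_measure set (Rn R d) -> \bar R}) (W : set (Rn R d)) (c : R) f :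
  0 <= c -> measurable W -> (@leb R d W < +oo)%E ->
  (forall E, measurable E -> m E = (c%:E * @leb R d (E `&` W))%E) ->
  bounded_measurable f -> (forall y, ~ W y -> f y = 0) ->
  \int[m]_y f y = c * \int[@leb R d]_y f y.
Proof.
move=> c0 mW fW mE bf fW0.
have i1 : m.-integrable [set: Rn R d] (EFin \o \1_W).
  by apply: bounded_measurable_integrable; split; [exact: measurable_indic|exists 1 => y; rewrite indicE; case: (_ \in _); rewrite ?normr0 ?normr1].
have i2 : (@leb R d).-integrable [set: Rn R d] (EFin \o \1_W).
  apply/integrableP; split; first by apply/measurable_EFinP; exact: measurable_indic.
  rewrite (eq_integral (fun t => (\1_W t)%:E)); first by rewrite integral_indic// setIT.
  by move=> y _ /=; rewrite ger0_norm.
have i3 : (@leb R d).-integrable [set: Rn R d] (EFin \o (fun y => c * \1_W y)).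
  by have := @integrableZl _ _ _ (@leb R d) setT measurableT c _ i2.
have fE y : \1_W y * f y = f y.
  rewrite indicE; case: (boolP (y \in W)) => [_|]; first by rewrite mul1r.
  by rewrite notin_setE => /fW0 ->; rewrite mulr0.
have H := linear_functional_ext_nonneg (linear_functional_integral i1) (linear_functional_integral i3).
have -> : \int[m]_y f y = \int[m]_y (\1_W y * f y) by apply: eq_Rintegral => y _.
rewrite H//; last first.
  move=> k bk k0; rewrite /Rintegral; congr fine.
  have mk : measurable_fun [set: Rn R d] (fun y => (k y)%:E) by apply/measurable_EFinP; case: bk.
  have E (nu : {measure set (Rn R d) -> \bar R}) : (\int[nu]_y (\1_W y * k y)%:E = \int[nu]_(y in W) (k y)%:E)%E.
    rewrite [RHS]integral_mkcond; apply: eq_integral => y _.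
    by rewrite patchE indicE; case: ifP => _; rewrite ?mul1r ?mul0r.
  rewrite E (@eq_measure_integral _ _ _ W (mscale (NngNum c0) (@leb R d))); last first.
    by move=> A mA AW; have := mE A mA; rewrite (setIidl AW).
  rewrite ge0_integral_mscale//; last 2 first.
  - exact: measurable_funTS.
  - by move=> y _; rewrite lee_fin.
  rewrite /= -E -ge0_integralZl//; last 2 first.
  - by apply/measurable_EFinP; apply: measurable_funM; [exact: measurable_indic|case: bk].
  - by move=> y _; rewrite lee_fin mulr_ge0.
  by apply: eq_integral => y _; rewrite -EFinM mulrA.
have -> : \int[@leb R d]_y (c * \1_W y * f y) = \int[@leb R d]_y (c * f y).
  by apply: eq_Rintegral => y _; rewrite -mulrA fE.
rewrite RintegralZl//.
have := integrable_mul_bounded i2 bf.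
by congr (_.-integrable _ _); apply/funext => y /=; rewrite fE.
Qed.

(** With nu = rho - mu = np - nm, the difference between nu and c dx on W consists of
    np outside K, of nm, of c dx on W minus K, and of an error e c dx on K; lam is the
    sum of these, and m is c dx on W. *)
Lemma comparison_measures (rho mu np nm : {finite_measure set (Rn R d) -> \bar R}) (K W : set (Rn R d)) (c e : R) :
  0 <= c -> 0 <= e -> measurable K -> measurable W -> K `<=` W -> (@leb R d W < +oo)%E ->
  (forall E, measurable E -> rho E + nm E = mu E + np E)%E ->
  (forall E, measurable E -> E `<=` K ->
      (np E <= c%:E * @leb R d E + (e * c)%:E * @leb R d E)%E /\
      (c%:E * @leb R d E <= np E + (e * c)%:E * @leb R d E)%E) ->
  exists lam m : {finite_measure set (Rn R d) -> \bar R},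
  [/\ (forall E, measurable E -> lam E = np (E `\` K) + nm E +
        (c%:E * @leb R d (E `&` (W `\` K)) + (e * c)%:E * @leb R d (E `&` K)))%E,
      (forall E, measurable E -> m E = c%:E * @leb R d (E `&` W))%E,
      (forall E, measurable E -> rho E <= mu E + m E + lam E)%E &
      (forall E, measurable E -> mu E + m E <= rho E + lam E)%E].
Proof.
move=> c0 e0 mK mW KW fW HJ HK.
have ec0 : 0 <= e * c by rewrite mulr_ge0.
have mWK : measurable (W `\` K) by exact: measurableD.
have mKC : measurable (~` K) by exact: measurableC.
pose l1 := measure_add (mrestr np mKC) nm.
pose l2 := measure_add (mscale (NngNum c0) (mrestr (@leb R d) mWK)) (mscale (NngNum ec0) (mrestr (@leb R d) mK)).
have l1E E : l1 E = (np (E `\` K) + nm E)%E by rewrite setDE; exact: measure_addE.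
have l2E E : l2 E = (c%:E * @leb R d (E `&` (W `\` K)) + (e * c)%:E * @leb R d (E `&` K))%E by exact: measure_addE.
have lE E : measure_add l1 l2 E = (np (E `\` K) + nm E +
        (c%:E * @leb R d (E `&` (W `\` K)) + (e * c)%:E * @leb R d (E `&` K)))%E.
  by rewrite -l1E -l2E; exact: measure_addE.
have lebfin E : measurable E -> E `<=` W -> @leb R d E \is a fin_num.
  move=> mE EW; rewrite ge0_fin_numE//; apply: le_lt_trans fW.
  by apply: le_measure; rewrite ?inE.
have f1 E : measurable E -> @leb R d (E `&` (W `\` K)) \is a fin_num.
  by move=> mE; apply: lebfin; [exact: measurableI|move=> x [_ []]].
have f2 E : measurable E -> @leb R d (E `&` K) \is a fin_num.
  by move=> mE; apply: lebfin; [exact: measurableI|move=> x [_ /KW]].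
have finl : (measure_add l1 l2 setT < +oo)%E.
  rewrite lE ltey_eq; apply/orP; left.
  by rewrite !fin_numD !fin_numM ?f1 ?f2 ?fin_num_measure//; apply: measurableD.
have [lam lamE] := finite_measure_of finl.
have finm : (mscale (NngNum c0) (mrestr (@leb R d) mW) setT < +oo)%E.
  rewrite ltey_eq; apply/orP; left; apply: fin_numM => //.
  by apply: (lebfin (setT `&` W)); [exact: measurableI|move=> x []].
have [m mE] := finite_measure_of finm.
have lamE' E : lam E = (np (E `\` K) + nm E +
        (c%:E * @leb R d (E `&` (W `\` K)) + (e * c)%:E * @leb R d (E `&` K)))%E.
  exact: (etrans (lamE E) (lE E)).
have mE' E : m E = (c%:E * @leb R d (E `&` W))%E by exact: mE.
have R1 (z : \bar R) : z \is a fin_num -> exists t : R, z = t%:E by move=> zf; exists (fine z); rewrite fineK.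
have decomp E : measurable E -> exists r q n a b u w : R,
    [/\ rho E = r%:E, mu E = q%:E, lam E = (b + n + (c * w + e * c * u))%:E, m E = (c * (w + u))%:E &
      [/\ 0 <= b, 0 <= n, 0 <= c * w & [/\ r + n = q + (b + a), a <= c * u + e * c * u & c * u <= a + e * c * u]]].
  move=> mE0; have mEK : measurable (E `&` K) by exact: measurableI.
  have mEW : measurable (E `&` W) by exact: measurableI.
  have [r rE] := R1 _ (fin_num_measure rho E mE0).
  have [q qE] := R1 _ (fin_num_measure mu E mE0).
  have [n nE] := R1 _ (fin_num_measure nm E mE0).
  have [a aE] := R1 _ (fin_num_measure np _ mEK).
  have [b bE] := R1 _ (fin_num_measure np _ (measurableD mE0 mK)).
  have [u uE] := R1 _ (f2 _ mE0).
  have [w wE] := R1 _ (f1 _ mE0).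
  exists r, q, n, a, b, u, w; split => //.
  - by rewrite lamE' bE nE uE wE -!EFinM -!EFinD.
  - have WE : (@leb R d (E `&` W) = (w + u)%:E)%E.
      rewrite (measureDI _ mEW mK) -setIDA -[E `&` W `&` K]setIA (setIidr KW).
      by rewrite EFinD -wE -uE.
    transitivity (c%:E * @leb R d (E `&` W))%E; first by rewrite mE'.
    by rewrite WE -EFinM.
  split.
  - by rewrite -lee_fin -bE.
  - by rewrite -lee_fin -nE.
  - by rewrite mulr_ge0// -lee_fin -wE.
  have npE : np E = (b + a)%:E.
    rewrite EFinD -aE -bE; exact: measureDI.
  have := HJ _ mE0; rewrite rE nE qE npE -!EFinD => -[h1].
  have [] := HK _ mEK (@subIsetr _ _ _); rewrite aE uE -!EFinM -!EFinD !lee_fin => h2 h3.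
  by split.
exists lam, m; split.
- by move=> E _; exact: lamE'.
- by move=> E _; exact: mE'.
- move=> E /decomp[r [q [n [a [b [u [w [-> -> -> -> [b0 n0 w0 [h1 h2 h3]]]]]]]]]].
  by rewrite -!EFinD lee_fin; lra.
- move=> E /decomp[r [q [n [a [b [u [w [-> -> -> -> [b0 n0 w0 [h1 h2 h3]]]]]]]]]].
  by rewrite -!EFinD lee_fin; lra.
Qed.

End local_vanishing.

(** * The positive part vanishes on an open set *)

(** In this section np and nm are the Jordan parts of rho - mu, carried by P and by
    its complement, and the gradient g vanishes on U outside the np-null set N. The
    equations of h are only assumed for functions with compact support in U; this is
    what the whole space and the torus have in common. *)
Section positive_part_vanishing.
Context {R : realType} {d : nat}.
Implicit Types (x y : 'rV[R]_d) (i j k : 'I_d) (phi psi : 'rV[R]_d -> R).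

Variables (rho mu np nm : {finite_measure set (Rn R d) -> \bar R}) (P N : set (Rn R d)).
Variables (U : set 'rV[R]_d) (h : Rn R d -> R) (g : 'I_d -> Rn R d -> R).
Hypothesis d_gt0 : (0 < d)%N.
Hypothesis jordan : forall E, measurable E -> (rho E + nm E = mu E + np E)%E.
Hypotheses (mP : measurable P) (nmP : nm P = 0%E) (npP : np (~` P) = 0%E).
Hypothesis np_leb : np `<< @leb R d.
Hypothesis oU : open U.
Hypotheses (mN : measurable N) (npN : np N = 0%E).
Hypothesis gN : forall y, U y -> ~ N y -> forall i, g i y = 0.
Hypothesis ih : forall M, (@leb R d).-integrable (U `&` ball (0 : 'rV[R]_d) M) (EFin \o h).
Hypothesis ig : forall i M, (@leb R d).-integrable (U `&` ball (0 : 'rV[R]_d) M) (EFin \o g i).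
Hypothesis weak_grad : forall i phi A, smooth phi -> compact A -> A `<=` U ->
  (forall y, ~ A y -> phi y = 0) ->
  \int[@leb R d]_y (h y * partial i phi y) = - \int[@leb R d]_y (g i y * phi y).
Hypothesis coulomb : forall phi A, smooth phi -> compact A -> A `<=` U ->
  (forall y, ~ A y -> phi y = 0) ->
  \int[@leb R d]_y (h y * laplacian phi y) = \int[mu]_y phi y - \int[rho]_y phi y.

Let J phi := \int[rho]_y phi y - \int[mu]_y phi y.

(** The gradient is only locally integrable, and the estimates above ask for
    integrable functions. *)
Definition truncate (B : set 'rV[R]_d) (f : Rn R d -> R) (y : Rn R d) : R := f y * \1_(B : set (Rn R d)) y.

Lemma truncate_off B f y : ~ B y -> truncate B f y = 0.
Proof. by move=> By; rewrite /truncate indicE memNset// mulr0. Qed.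

Lemma truncate_mul B f phi y : (~ B y -> phi y = 0) -> truncate B f y * phi y = f y * phi y.
Proof.
move=> H; case: (pselect (B y)) => [By|nB]; last by rewrite H// !mulr0.
by rewrite /truncate indicE mem_set// mulr1.
Qed.

Lemma integrable_truncate B f M : measurable (B : set (Rn R d)) -> B `<=` U -> B `<=` ball 0 M ->
  (@leb R d).-integrable (U `&` ball (0 : 'rV[R]_d) M) (EFin \o f) ->
  (@leb R d).-integrable [set: Rn R d] (EFin \o truncate B f).
Proof.
move=> mB BU BM iF.
have mUM : measurable (U `&` ball (0 : 'rV[R]_d) M : set (Rn R d)).
  by apply: measurableI; [exact: open_measurable_rV|exact: measurable_ball_rV].
have : (@leb R d).-integrable (B : set (Rn R d)) (EFin \o f).
  by apply: integrableS iF => // y By; split; [exact: BU|exact: BM].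
move/(integrable_mkcond _ mB); congr (_.-integrable _ _); apply/funext => y.
by rewrite patchE /= /truncate indicE; case: (_ \in _); rewrite ?mulr1 ?mulr0.
Qed.

Section at_point.
Variables (x0 : 'rV[R]_d) (R0 : R).
Hypotheses (R00 : 0 < R0) (BU : ball x0 (2 * R0) `<=` U).

Let B : set 'rV[R]_d := ball x0 (2 * R0).
Let A : set 'rV[R]_d := [set y | `|x0 - y| <= R0].
Let h' := truncate B h.
Let g' i := truncate B (g i).

Let AB : A `<=` B.
Proof.
move=> y Ay; apply/ball_normP; apply: le_lt_trans Ay _.
by rewrite mulr_natl mulr2n ltrDl.
Qed.

Let AU : A `<=` U. Proof. by move=> y /AB /BU. Qed.

Let cA : closed A.
Proof.
have -> : A = (fun y => `|x0 - y|) @^-1` [set t : R | t <= R0] by [].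
apply: preimage_closed; last exact: closed_le.
move=> y _; apply: (@continuous_comp _ _ _ (fun y => x0 - y) Num.norm); last exact: norm_continuous.
by apply: continuousB; [exact: cst_continuous|exact: cvg_id].
Qed.

Let BM : B `<=` ball 0 (`|x0| + 2 * R0 + 1).
Proof.
move=> y yB; apply/ball_normP; rewrite sub0r normrN.
have := ler_normB x0 (x0 - y); rewrite opprB addrC subrK; move/ball_normP: yB; lra.
Qed.

Let coA : compact A.
Proof. exact: (closed_bounded_compact cA (fun y Ay => BM (AB Ay))). Qed.

Let mB : measurable (B : set (Rn R d)). Proof. exact: measurable_ball_rV. Qed.

Let ih' : (@leb R d).-integrable [set: Rn R d] (EFin \o h').
Proof. exact: integrable_truncate mB BU BM (ih _). Qed.

Lemma bounded_measurable_off_ball phi : smooth phi -> (forall y, ~ A y -> phi y = 0) -> bounded_measurable phi.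
Proof.
move=> sphi phiA; apply: (@bounded_measurable_smooth _ _ _ (`|x0| + 2 * R0 + 1)) => // y hy.
apply: phiA => /AB /BM /ball_normP; rewrite sub0r normrN; lra.
Qed.

Lemma truncated_integral phi (f : Rn R d -> R) : (forall y, ~ A y -> phi y = 0) ->
  \int[@leb R d]_y (truncate B f y * phi y) = \int[@leb R d]_y (f y * phi y).
Proof.
move=> phiA; apply: eq_Rintegral => y _; apply: truncate_mul => nB.
by apply: phiA => /AB.
Qed.

(** The weak gradient is applied to the partial derivatives of phi. *)
Lemma local_divergence phi : smooth phi -> (forall y, R0 <= `|x0 - y| -> phi y = 0) ->
  \sum_i \int[@leb R d]_y (g' i y * partial i phi y) = J phi.
Proof.
move=> sphi phi0.
have phiA y : ~ A y -> phi y = 0 by move=> nA; apply: phi0; rewrite leNgt; apply/negP => /ltW.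
have pA i := partial_off_closed i cA phiA.
have ppA i := partial_off_closed i cA (pA i).
have sp i := smooth_partial i sphi.
have spp i := smooth_partial i (sp i).
transitivity (- \sum_i \int[@leb R d]_y (h' y * partial i (partial i phi) y)).
  rewrite -sumrN; apply: eq_bigr => i _.
  rewrite (truncated_integral (g i) (pA i)) (truncated_integral h (ppA i)).
  by rewrite (weak_grad i (sp i) coA AU (pA i)) opprK.
have lin := linear_functional_integral ih'.
have /= <- := linear_functional_sum lin (fun i => bounded_measurable_off_ball (spp i) (ppA i)).
have lapA y : ~ A y -> laplacian phi y = 0.
  by move=> nA; rewrite /laplacian big1// => i _; exact: ppA.
rewrite (truncated_integral h lapA).
by rewrite (coulomb sphi coA AU phiA) opprB.
Qed.

(** The weak gradient is applied to psi, and the equation of h to the i-th derivative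
    of Z. *)
Lemma local_curl i Z psi : smooth Z -> smooth psi -> laplacian (partial i Z) = partial i psi ->
  (forall y, R0 <= `|x0 - y| -> Z y = 0) -> (forall y, R0 <= `|x0 - y| -> psi y = 0) ->
  \int[@leb R d]_y (g' i y * psi y) = J (partial i Z).
Proof.
move=> sZ spsi E Z0 psi0.
have off (f : 'rV[R]_d -> R) : (forall y, R0 <= `|x0 - y| -> f y = 0) -> forall y, ~ A y -> f y = 0.
  by move=> f0 y nA; apply: f0; rewrite leNgt; apply/negP => /ltW.
have psiA := off _ psi0; have ZA := partial_off_closed i cA (off _ Z0).
rewrite truncated_integral// -[LHS]opprK -(weak_grad i spsi coA AU psiA) -E.
by rewrite (coulomb (smooth_partial i sZ) coA AU ZA) opprB.
Qed.

End at_point.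

Lemma positive_part_vanishes : np U = 0%E.
Proof.
have mU := open_measurable_rV oU.
have [kappa kappa0 noc] := @no_concentration_point R d d_gt0.
apply/eqP; rewrite -measure_le0 leNgt; apply/negP => npU.
pose b n : set (Rn R d) := ball (0 : 'rV[R]_d) n.+1%:R.
have [n npUn] : exists n, (0 < np ((U : set (Rn R d)) `&` b n))%E.
  apply: countable_cover_positive npU => //; last by rewrite bigcup_ball.
  by move=> n; exact: measurable_ball_rV.
pose Un : set (Rn R d) := (U : set (Rn R d)) `&` b n.
have mUn : measurable Un by apply: measurableI => //; exact: measurable_ball_rV.
pose A : set (Rn R d) := (Un `&` P) `\` N.
have mA : measurable A by apply: measurableD => //; exact: measurableI.
have npA : (0 < np A)%E.
  rewrite ltNge; apply/negP => npA0.
  have : (np Un <= np (A `|` (~` P `|` N)))%E.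
    apply: le_measure; rewrite ?inE//.
      by apply: measurableU => //; apply: measurableU => //; exact: measurableC.
    move=> y Uy; case: (pselect (P y)) => Py; last by right; left.
    by case: (pselect (N y)) => Ny; [right; right|left].
  rewrite leNgt => /negP; apply; apply: le_lt_trans npUn.
  apply: (le_trans (measureU2 _ _ _)) => //; first by apply: measurableU => //; exact: measurableC.
  rewrite -[leRHS]adde0; apply: leeD => //.
  apply: (le_trans (measureU2 _ _ _)) => //; first exact: measurableC.
  have zP : (np (~` P) <= 0)%E by rewrite npP.
  have zN : (np N <= 0)%E by rewrite npN.
  by rewrite -[leRHS]adde0; apply: leeD; [exact: zP|exact: zN].
(* The tolerance on the density: the first term is the one of concentration_point, the
   second keeps it below 1. *)
pose e : R := Num.min (kappa / (4 * 6 ^+ d)) 2^-1.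
have d6 : 0 < (6 : R) ^+ d by rewrite exprn_gt0.
have e01 : 0 < e < 1.
  apply/andP; split; first by rewrite lt_min invr_gt0 divr_gt0//= mulr_gt0.
  by apply: (@le_lt_trans _ _ 2^-1); [rewrite ge_min lexx orbT|rewrite invf_lt1// ltr1n].
have AM : A `<=` ball (0 : 'rV[R]_d) n.+1%:R by move=> y [[[_ ?] _] _].
have [c [K [c0 cK KA lebK HK]]] := near_constant_density np_leb mA AM npA e01.
have mK := closed_measurable_rV cK.
have coK : compact K by exact: (closed_bounded_compact cK (fun y Ky => AM _ (KA _ Ky))).
pose W : set (Rn R d) := ball (0 : 'rV[R]_d) (n.+1%:R + 1).
have mW : measurable W by exact: measurable_ball_rV.
have KW : K `<=` W by move=> y /KA /AM /ball_normP yn; apply/ball_normP; lra.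
have e0 : 0 <= e by case/andP: e01 => /ltW.
have [lam [m [lamE mE up low]]] := comparison_measures (ltW c0) e0 mK mW KW (leb_ball_lty _ _) jordan HK.
have lamK : (lam K <= (kappa / (4 * 6 ^+ d) * c)%:E * @leb R d K)%E.
  rewrite lamE// setDv measure0 add0e setIid.
  have -> : nm K = 0%E.
    apply/eqP; rewrite -measure_le0 -nmP; apply: le_measure; rewrite ?inE// => y /KA [[_ ?] _].
    done.
  have -> : K `&` (W `\` K) = set0 by rewrite setDE setICA setICr setI0.
  rewrite measure0 mule0 !add0e; apply: lee_wpmul2r => //; rewrite lee_fin ler_wpM2r ?(ltW c0)//.
  by rewrite ge_min lexx.
have [x0 [s0 [Kx0 s00 dens]]] := concentration_point c0 kappa0 coK cK lebK lamK.
have Ux0 : U x0 by have [[[]]] := KA _ Kx0.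
have /nbhs_ballP[del /= del0 delU] : nbhs x0 U by exact: open_nbhs_nbhs.
(* Small enough for the density bound, for the ball of radius 2 R0 to lie in U, and
   for it to lie in W. *)
pose R0 := Num.min s0 (Num.min (del / 2) 2^-1).
have R00 : 0 < R0 by rewrite !lt_min s00 invr_gt0 divr_gt0//=.
have R0s : R0 <= s0 by rewrite ge_min lexx.
have R0d : R0 <= del / 2 by rewrite !ge_min lexx orbT.
have R01 : R0 <= 2^-1 by rewrite !ge_min lexx !orbT.
have BU : ball x0 (2 * R0) `<=` U.
  by move=> y /ball_normP xy; apply: delU; apply/ball_normP; lra.
have x0n : `|x0| < n.+1%:R by have /AM/ball_normP := KA _ Kx0; rewrite sub0r normrN.
have ballW s y : s <= 1 -> `|x0 - y| < s -> W y.
  move=> s1 xy; apply/ball_normP; rewrite sub0r normrN.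
  have := ler_normB x0 (x0 - y); rewrite opprB addrC subrK; lra.
have leW : (@leb R d W < +oo)%E by exact: leb_ball_lty.
apply: (noc lam J (fun i => truncate (ball x0 (2 * R0)) (g i)) K x0 c R0 R00 c0) => //.
- exact: linear_functional_difference.
- move=> f bf f0; have := comparison_integral_bound up low bf.
  rewrite (integral_scaled_restriction (ltW c0) mW leW mE bf)// => y nW.
  by apply: f0; rewrite leNgt; apply/negP => xy; apply: nW; apply: ballW xy; lra.
- move=> i; apply: (@integrable_truncate _ _ (`|x0| + 2 * R0 + 1)) => //; first exact: measurable_ball_rV.
    move=> y yB; apply/ball_normP; rewrite sub0r normrN.
    have := ler_normB x0 (x0 - y); rewrite opprB addrC subrK; move/ball_normP: yB; lra.
  exact: ig.
- by move=> i y nB; exact: truncate_off.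
- by move=> i y /KA [[[Uy _] _] nN]; rewrite /truncate (gN Uy nN) mul0r.
- by move=> phi sphi phi0; exact: local_divergence R00 BU phi sphi phi0.
- by move=> i Z psi sZ spsi E Z0 psi0; exact: (local_curl R00 BU).
- by move=> s s1 s2; apply: dens => //; rewrite (le_trans (ltW s2)).
- move=> s s1 s2; have mb := measurable_ball_rV x0 s.
  have bE : (ball x0 s : set (Rn R d)) `\` K = (ball x0 s : set (Rn R d)) `&` (W `\` K).
    apply/seteqP; split => [y [yB nK]|y [yB [_ nK]]]; last by split.
    by split => //; split => //; move/ball_normP: yB; apply: ballW; lra.
  rewrite lamE// bE -[leLHS]add0e; apply: leeD; first exact: adde_ge0.
  rewrite -[leLHS]adde0; apply: leeD => //; apply: mule_ge0 => //.
  by rewrite lee_fin mulr_ge0// ltW.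
Qed.

End positive_part_vanishing.

(** * Periodization of functions supported in the unit cube *)

Section periodization.
Context {R : realType} {d : nat}.
Implicit Types (x y : 'rV[R]_d) (i j k : 'I_d) (phi psi : 'rV[R]_d -> R).

(** The point k of Z^d such that x - k lies in the half-open cube. *)
Definition lattice_point x : 'rV[R]_d := \row_i (Num.floor (x 0 i + 2^-1))%:~R.

Definition periodize phi x := phi (x - lattice_point x).

Lemma lattice_point_itv x i : lattice_point x 0 i <= x 0 i + 2^-1 < lattice_point x 0 i + 1.
Proof. by rewrite mxE -intrD1 floor_itv. Qed.

Lemma lattice_point_le x y i : x 0 i < lattice_point y 0 i - 2^-1 -> lattice_point x 0 i <= lattice_point y 0 i - 1.
Proof.
rewrite !mxE => h; rewrite -[X in _ - X]/(1%:~R) -intrB ler_int.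
rewrite -ltzD1 subrK floor_lt_int; lra.
Qed.

Lemma lattice_point_ge x y i : lattice_point y 0 i + 2^-1 <= x 0 i -> lattice_point y 0 i + 1 <= lattice_point x 0 i.
Proof.
rewrite !mxE => h; rewrite -[X in _ + X]/(1%:~R) -intrD ler_int floor_ge_int intrD.
lra.
Qed.

(** If the lattice points of x and y differ, then y is so close to a face of the cells
    that both sides are 0, which saves a case analysis on the position of x. *)
Lemma periodize_near phi (m : R) x y : supported_within m phi -> `|x - y| < 2^-1 - m ->
  periodize phi y = phi (y - lattice_point x).
Proof.
move=> sphi xy; rewrite /periodize.
have [->//|ne] := eqVneq (lattice_point y) (lattice_point x).
have [i nei] : exists i, lattice_point y 0 i != lattice_point x 0 i.
  apply: contrapT => h; move/eqP: ne; apply; apply/rowP => i; apply/eqP.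
  by apply: contrapT => /negP hi; apply: h; exists i.
have xyi : `|x 0 i - y 0 i| < 2^-1 - m.
  by apply: le_lt_trans xy; have := coord_norm_le (x - y) i; rewrite !mxE.
have big (u : 'rV[R]_d) : m < `|y 0 i - u 0 i| -> phi (y - u) = 0.
  by move=> h; apply: sphi; apply: lt_le_trans (coord_norm_le (y - u) i); rewrite !mxE.
have /andP[x1 x2] := lattice_point_itv x i.
have /andP[y1 y2] := lattice_point_itv y i.
have m2 : m < 2^-1 by have := normr_ge0 (x 0 i - y 0 i); lra.
move: xyi; rewrite ltr_norml => /andP[d1 d2].
(* In coordinate i, y lies below, above, or inside the cell of x; in the last case the
   lattice points agree in that coordinate. *)
have [h|h] := ltP (y 0 i) (lattice_point x 0 i - 2^-1).
  have h1 := lattice_point_le h.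
  rewrite !big//.
    by rewrite -normrN; apply: lt_le_trans (ler_norm _); lra.
  by apply: lt_le_trans (ler_norm _); lra.
have [h2|h2] := leP (lattice_point x 0 i + 2^-1) (y 0 i).
  have h1 := lattice_point_ge h2.
  rewrite !big//.
    by apply: lt_le_trans (ler_norm _); lra.
  by rewrite -normrN; apply: lt_le_trans (ler_norm _); lra.
exfalso; move/negP: nei; apply; apply/eqP; rewrite [LHS]mxE [RHS]mxE; congr (_%:~R).
apply: floor_def; move: h h2; rewrite mxE intrD => h h2; apply/andP; split; lra.
Qed.

Variable m : R.
Hypothesis m2 : m < 2^-1.

Lemma near_periodize phi x : supported_within m phi ->
  \forall y \near x, periodize phi y = phi (dilation 1 (- lattice_point x) y).
Proof.
move=> sphi; apply/nbhs_ballP; exists (2^-1 - m); first by rewrite /= subr_gt0.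
move=> y /ball_normP xy; rewrite (periodize_near sphi xy).
by rewrite /dilation scale1r.
Qed.

Lemma supported_within_foldr phi s : supported_within m phi -> supported_within m (foldr partial phi s).
Proof. by move=> sphi; elim: s => //= i s IH; exact: supported_within_partial. Qed.

(** Near x the periodization is a translate of phi, by periodize_near. *)
Lemma is_derive_periodize phi i x : smooth phi -> supported_within m phi ->
  is_derive x 'e_i (periodize phi) (periodize (partial i phi) x).
Proof.
move=> smphi sphi.
have H := smooth_is_derive i x (smooth_dilation 1 (- lattice_point x) 1 smphi).
rewrite partial_dilation// mulr1 mul1r in H.
rewrite /periodize (_ : x - lattice_point x = dilation 1 (- lattice_point x) x); last by rewrite /dilation scale1r.
apply: near_eq_is_derive H; have := near_periodize x sphi.
by apply: filterS => y; rewrite /periodize mul1r => ->.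
Qed.

Lemma partial_periodize phi i : smooth phi -> supported_within m phi ->
  partial i (periodize phi) = periodize (partial i phi).
Proof. by move=> smphi sphi; apply: partialE => y; exact: is_derive_periodize. Qed.

Lemma smooth_foldr phi s : smooth phi -> smooth (foldr partial phi s).
Proof. by move=> sphi l; rewrite -foldr_cat; exact: sphi. Qed.

Lemma foldr_partial_periodize phi s : smooth phi -> supported_within m phi ->
  foldr partial (periodize phi) s = periodize (foldr partial phi s).
Proof.
move=> smphi sphi; elim: s => //= i s ->.
by apply: partial_periodize; [exact: smooth_foldr|exact: supported_within_foldr].
Qed.

Lemma smooth_periodize phi : smooth phi -> supported_within m phi -> smooth (periodize phi).
Proof.
move=> smphi sphi s; rewrite foldr_partial_periodize//=.
have sm := smooth_foldr s smphi; have su := supported_within_foldr s sphi.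
split=> [x|i x]; last by have [] := is_derive_periodize i x sm su.
have near_x := near_periodize x su.
have /= e := nbhs_singleton near_x; rewrite /continuous_at e.
have sg := smooth_dilation 1 (- lattice_point x) 1 sm.
pose G y := 1 * foldr partial phi s (dilation 1 (- lattice_point x) y).
have cG : G y @[y --> x] --> G x by exact: (smooth_continuous sg).
rewrite -[X in _ --> X]mul1r; apply: cvg_trans cG.
have Gx : \forall y \near x, G y = periodize (foldr partial phi s) y.
  by apply: filterS near_x => y h; rewrite /G mul1r h.
exact: (near_eq_cvg Gx).
Qed.

Lemma periodize_periodic phi : Zd_periodic (periodize phi).
Proof.
move=> i x; rewrite /periodize; congr phi.
apply/rowP => j; rewrite !mxE !eqxx /=.
have -> : x 0 j + (j == i)%:R + 2^-1 = x 0 j + 2^-1 + ((j == i)%:R : int)%:~R :> R.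
  by rewrite addrAC; case: (j == i).
by rewrite floorDrz ?intr_int// intrD; case: (j == i) => /=; rewrite ?intrKfloor; lra.
Qed.

Lemma periodize_carrier phi x : carrier Torus (x : Rn R d) -> periodize phi x = phi x.
Proof.
move=> /= cx; rewrite /periodize; congr phi; apply/rowP => j; rewrite !mxE.
have /andP[h1 h2] := cx j.
rewrite (@floor_def _ _ 0) ?subr0//=; apply/andP; split; lra.
Qed.

Lemma laplacian_periodize phi : smooth phi -> supported_within m phi ->
  laplacian (periodize phi) = periodize (laplacian phi).
Proof.
move=> smphi sphi; apply/funext => x; rewrite /laplacian; apply: eq_bigr => i _.
rewrite (partial_periodize i smphi sphi) partial_periodize//; first exact: smooth_partial.
exact: supported_within_partial.
Qed.

End periodization.

(** * The whole space and the torus *)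

Section ambient_space.
Context {R : realType} {d : nat}.
Implicit Types (x y : 'rV[R]_d) (i j k : 'I_d) (phi psi : 'rV[R]_d -> R) (Omega : ambient).

Definition open_carrier Omega : set 'rV[R]_d :=
  match Omega with Euclidean => setT | Torus => ball 0 2^-1 end.

Lemma open_open_carrier Omega : open (open_carrier Omega).
Proof. by case: Omega; [exact: openT|exact: ball_open]. Qed.

Lemma open_carrier_sub Omega : open_carrier Omega `<=` carrier Omega.
Proof.
case: Omega => //= y /ball_normP; rewrite sub0r normrN => y2 i.
have := le_lt_trans (coord_norm_le y i) y2.
by rewrite ltr_norml => /andP[h1 h2]; rewrite h2 (ltW h1).
Qed.

Lemma leb_measureE : (@leb R d : {measure set (Rn R d) -> \bar R}) = lebesgue_rV d.
Proof. exact: eq_measure. Qed.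

Lemma integrable_lebE D f : (@leb R d).-integrable D f = (lebesgue_rV d).-integrable D f.
Proof. exact: (congr1 (fun m : {measure set (Rn R d) -> \bar R} => m.-integrable D f) leb_measureE). Qed.

Lemma Rintegral_lebE (D : set (Rn R d)) (f : Rn R d -> R) :
  \int[@leb R d]_(x in D) f x = \int[lebesgue_rV d]_(x in D) f x.
Proof. exact: (congr1 (fun m : {measure set (Rn R d) -> \bar R} => \int[m]_(x in D) f x) leb_measureE). Qed.

Lemma measurable_carrier Omega : measurable (carrier Omega : set (Rn R d)).
Proof.
case: Omega => //=; rewrite (_ : [set x | _] = \bigcap_(i in [set: 'I_d])
  ((fun x : Rn R d => (x : 'rV[R]_d) 0 i) @^-1` `[- 2^-1, 2^-1[)).
  apply: fin_bigcap_measurable => // i _.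
  by rewrite -[X in measurable X]setTI; apply: measurable_coord.
by apply/seteqP; split => [x h i _|x h i]; have := h i; rewrite /= in_itv/=; [|apply].
Qed.

(** Both the open and the half-open cube have measure 1. *)
Lemma leb_carrier_diff Omega : @leb R d (carrier Omega `\` open_carrier Omega) = 0%E.
Proof.
have mU : measurable (open_carrier Omega : set (Rn R d)).
  by apply: open_measurable_rV; exact: open_open_carrier.
have mC := measurable_carrier Omega.
case: Omega mU mC => [mU mC|mU mC]; first by rewrite /= setDT measure0.
have U1 : @leb R d (open_carrier Torus) = 1%E.
  rewrite /= leb_ball ?invr_gt0//.
  have -> : 2^-1 *+ 2 = 1 :> R by rewrite mulr2n; lra.
  by rewrite expr1n.
have C1 : @leb R d (carrier Torus) = 1%E.
  have := lebesgue_rV_box (fun _ : 'I_d => measurable_itv `[(- 2^-1 : R), 2^-1[).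
  rewrite big1 => [<-|i _]; last first.
    rewrite lebesgue_measure_itv/= lte_fin ifT; last by lra.
    by rewrite -EFinD; congr EFin; lra.
  congr (lebesgue_rV d _); apply/seteqP; split => x h i; have := h i; by rewrite /= in_itv.
have := measureDI (@leb R d) mC mU; rewrite (setIidr (@open_carrier_sub Torus)) => e.
have {}e : (1 = @leb R d (carrier Torus `\` open_carrier Torus) + 1)%E by rewrite -{2}U1 -{1}C1.
have := measure_ge0 (@leb R d) (carrier Torus `\` open_carrier Torus).
move: e; case: (leb _) => [r||]//; rewrite -EFinD => -[e] _.
by congr EFin; lra.
Qed.

(** On the torus A lies in the open ball of radius 1/2 for the sup norm, hence by
    compactness in a smaller one, and phi can be periodized. *)
Lemma test_function_extension Omega phi (A : set 'rV[R]_d) : smooth phi -> compact A ->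
  A `<=` open_carrier Omega -> (forall y, ~ A y -> phi y = 0) ->
  exists Phi, [/\ test_function Omega Phi, {in carrier Omega, Phi =1 phi},
    forall i, {in carrier Omega, partial i Phi =1 partial i phi} &
    {in carrier Omega, laplacian Phi =1 laplacian phi}].
Proof.
move=> sphi coA AU phiA; case: Omega AU => AU.
  exists phi; split => //; split => //; apply: (subclosed_compact _ coA); first exact: closed_closure.
  apply: (@subset_trans _ (closure A)); last first.
    by have /closure_id <- := compact_closed (@norm_hausdorff _ _) coA.
  apply: closureS => y /= /eqP py; apply: contrapT => nA; apply: py; exact: phiA.
have [m m2 sm] : exists2 m : R, m < 2^-1 & supported_within m phi.
  have [A0|/set0P A0] := eqVneq A set0.
    exists 0; first by rewrite invr_gt0.
    by move=> y _; apply: phiA; rewrite A0.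
  have cn : {within A, continuous (fun y : 'rV[R]_d => `|y|)}.
    by apply: continuous_subspaceT => y; exact: norm_continuous.
  have [z zA hz] := compact_EVT_max A0 coA cn.
  exists `|z|.
    by move: zA; rewrite inE => /AU /ball_normP; rewrite sub0r normrN.
  move=> y hy; apply: phiA => Ay; move: hy; apply/negP; rewrite -leNgt.
  by apply: hz; rewrite inE.
exists (periodize phi); split.
- by split; [exact: (smooth_periodize m2)|exact: periodize_periodic].
- by move=> x; rewrite inE => cx; exact: periodize_carrier.
- move=> i x; rewrite inE => cx; rewrite (partial_periodize m2 i sphi sm).
  exact: periodize_carrier.
- move=> x; rewrite inE => cx; rewrite (laplacian_periodize m2 sphi sm).
  exact: periodize_carrier.
Qed.

Lemma Rintegral_carrier Omega (m : {measure set (Rn R d) -> \bar R}) (f F : Rn R d -> R) :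
  {in carrier Omega, F =1 f} -> (forall y, ~ open_carrier Omega y -> f y = 0) ->
  \int[m]_(x in carrier Omega) F x = \int[m]_x f x.
Proof.
move=> Ff f0; rewrite /Rintegral; congr fine; rewrite integral_mkcond.
apply: eq_integral => x _; rewrite patchE; case: ifPn => [xC|/negP xC].
  by rewrite Ff.
by rewrite f0// => /open_carrier_sub h; apply: xC; rewrite in_setE.
Qed.

End ambient_space.

Section conclusion.
Context {R : realType} {d : nat}.

(** The positive part gives no mass to the open carrier by positive_part_vanishes, to
    the rest of the carrier by absolute continuity, nor to the complement of the
    carrier, where rho vanishes. *)
Lemma positive_part_null (Omega : ambient) (rho mu : probability (Rn R d) R)
    (h : Rn R d -> R) (grad_h : Rn R d -> 'rV[R]_d) : (0 < d)%N ->
  rho (carrier Omega) = 1%E ->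
  positive_part (charge_diff rho mu) `<< lebesgue_rV d ->
  W11loc Omega h ->
  is_weak_gradient Omega h grad_h ->
  coulomb_potential Omega rho mu h ->
  {ae positive_part (charge_diff rho mu), forall x, grad_h x = 0} ->
  forall A : set (Rn R d), measurable A -> (rho A <= mu A)%E.
Proof.
move=> d0 rhoC dom [ih _] wg cp aeg.
pose nu := charge_diff rho mu.
pose P := sval (cid (Hahn_decomposition nu)).
pose H := svalP (cid (svalP (cid (Hahn_decomposition nu)))).
pose N := sval (cid (svalP (cid (Hahn_decomposition nu)))).
have {}HE : hahn_decomposition nu P N by exact: H.
have [[mP _] [mN _] PNT PN0] := HE.
pose np := positive_part nu.
pose nm : {finite_measure set (Rn R d) -> \bar R} := jordan_neg HE.
have nuE E : measurable E -> nu E = (rho E - mu E)%E.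
  move=> mE; rewrite /nu /charge_diff /= /cadd/= /copp/=.
  done.
have npE E : measurable E -> np E = nu (E `&` P).
  move=> mE; transitivity (charge.cjordan_pos H E); first exact: jordan_posE.
  by rewrite cjordan_posE /crestr0 mem_set.
have nmE E : measurable E -> nm E = (- nu (E `&` N))%E.
  move=> mE; transitivity (charge.cjordan_neg HE E); first exact: jordan_negE.
  by rewrite cjordan_negE /crestr0 mem_set.
have jordan E : measurable E -> (rho E + nm E = mu E + np E)%E.
  move=> mE; have mEP : measurable (E `&` P) by exact: measurableI.
  have mEN : measurable (E `&` N) by exact: measurableI.
  have : nu E = (nu (E `&` P) + nu (E `&` N))%E.
    rewrite -chargeU//; last by rewrite setIACA PN0 setI0.
    by rewrite -setIUr PNT setIT.
  rewrite npE// nmE// !nuE//.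
  have fr X : measurable X -> exists t : R, rho X = t%:E.
    by move=> mX; exists (fine (rho X)); rewrite fineK// fin_num_measure.
  have fm X : measurable X -> exists t : R, mu X = t%:E.
    by move=> mX; exists (fine (mu X)); rewrite fineK// fin_num_measure.
  have [a1 ->] := fr _ mE; have [a2 ->] := fr _ mEP; have [a3 ->] := fr _ mEN.
  have [b1 ->] := fm _ mE; have [b2 ->] := fm _ mEP; have [b3 ->] := fm _ mEN.
  rewrite -!EFinB -!EFinD => -[e]; congr EFin; lra.
have nmP : nm P = 0%E by rewrite nmE// PN0 charge0 oppe0.
have npP : np (~` P) = 0%E by rewrite npE ?setICl ?charge0//; exact: measurableC.
have npl : np `<< @leb R d by exact: dom.
have [M [mM npM gM]] := aeg.
have oU := @open_open_carrier R d Omega.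
pose g i (y : Rn R d) : R := grad_h y 0 i.
have localI (f : Rn R d -> R) r : locally_integrable_on Omega f ->
    (@leb R d).-integrable (open_carrier Omega `&` ball (0 : 'rV[R]_d) r) (EFin \o f).
  move=> /(_ _ (compact_cball0 (r := r))); rewrite integrable_lebE; apply: integrableS.
  - apply: measurableI; first exact: measurable_carrier.
    by apply: closed_measurable_rV; apply: compact_closed; [exact: norm_hausdorff|exact: compact_cball0].
  - by apply: measurableI; [exact: open_measurable_rV|exact: measurable_ball_rV].
  - move=> y [/open_carrier_sub cy /ball_normP]; rewrite sub0r normrN => yr.
    by split => //; exact: ltW.
have npU : np (open_carrier Omega : set (Rn R d)) = 0%E.
  apply: (@positive_part_vanishes R d rho mu np nm P M (open_carrier Omega) h g) => //.
  - move=> y _ nM i; rewrite /g; suff -> : grad_h y = 0 by rewrite mxE.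
    by apply: contrapT => gy; apply: nM; exact: gM.
  - by move=> r; exact: localI.
  - by move=> i r; apply: localI; have [] := wg i.
  - move=> i phi A sphi coA AU phiA; have cA := compact_closed (@norm_hausdorff _ _) coA.
    have [Phi [tPhi E0 E1 E2]] := test_function_extension sphi coA AU phiA.
    have [_ /(_ _ tPhi)] := wg i.
    have nU y : ~ open_carrier Omega y -> ~ A y by move=> nU /AU.
    rewrite (@Rintegral_carrier _ _ _ _ (fun y => h y * partial i phi y)); first last.
    + by move=> y /nU nA; rewrite (partial_off_closed i cA phiA nA) mulr0.
    + by move=> y cy /=; rewrite E1.
    rewrite (@Rintegral_carrier _ _ _ _ (fun y => g i y * phi y)); first last.
    + by move=> y /nU nA; rewrite (phiA _ nA) mulr0.
    + by move=> y cy /=; rewrite E0.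
    by rewrite !Rintegral_lebE.
  - move=> phi A sphi coA AU phiA; have cA := compact_closed (@norm_hausdorff _ _) coA.
    have [Phi [tPhi E0 E1 E2]] := test_function_extension sphi coA AU phiA.
    have nU y : ~ open_carrier Omega y -> ~ A y by move=> nU /AU.
    have := cp _ tPhi.
    rewrite (@Rintegral_carrier _ _ _ _ (fun y => h y * laplacian phi y)); first last.
    + move=> y /nU nA; rewrite /laplacian big1 ?mulr0// => i _.
      by rewrite (partial_off_closed i cA (partial_off_closed i cA phiA) nA).
    + by move=> y cy /=; rewrite E2.
    rewrite (@Rintegral_carrier _ _ _ _ phi); [|by move=> y cy /=; rewrite E0|by move=> y /nU /phiA].
    rewrite (@Rintegral_carrier _ _ _ _ phi); [|by move=> y cy /=; rewrite E0|by move=> y /nU /phiA].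
    by rewrite Rintegral_lebE.
have mU := open_measurable_rV oU.
have mC := @measurable_carrier R d Omega.
have npD : np (carrier Omega `\` open_carrier Omega) = 0%E.
  move/null_content_dominatesP: npl; apply; first exact: measurableD.
  exact: leb_carrier_diff.
have npC : np (~` carrier Omega) = 0%E.
  have mCC : measurable (~` (carrier Omega : set (Rn R d))) by exact: measurableC.
  have rC : rho (~` carrier Omega) = 0%E.
    by rewrite probability_setC// rhoC subee.
  suff h0 : (np (~` carrier Omega) <= 0)%E by apply/eqP; rewrite -measure_le0.
  have mI : measurable (~` carrier Omega `&` P) by exact: measurableI.
  have rI : (rho (~` carrier Omega `&` P) <= 0)%E by rewrite -rC; apply: le_measure; rewrite ?inE.
  by rewrite npE// nuE// leeBlDr ?fin_num_measure// add0e (le_trans rI).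
have npT : np setT = 0%E.
  apply/eqP; rewrite -measure_le0.
  have -> : [set: Rn R d] = open_carrier Omega `|` ((carrier Omega `\` open_carrier Omega) `|` ~` carrier Omega).
    apply/seteqP; split => // y _; case: (pselect (open_carrier Omega y)) => yU; first by left.
    by right; case: (pselect (carrier Omega y)) => yC; [left|right].
  have mCC : measurable (~` (carrier Omega : set (Rn R d))) by exact: measurableC.
  have mD : measurable (carrier Omega `\` (open_carrier Omega : set (Rn R d))) by exact: measurableD.
  have z1 : (np (open_carrier Omega : set (Rn R d)) <= 0)%E by rewrite npU.
  have z2 : (np (carrier Omega `\` open_carrier Omega) <= 0)%E by rewrite npD.
  have z3 : (np (~` carrier Omega) <= 0)%E by rewrite npC.
  apply: (le_trans (measureU2 _ mU (measurableU _ _ mD mCC))).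
  rewrite -[leRHS]adde0; apply: leeD; first exact: z1.
  apply: (le_trans (measureU2 _ mD mCC)).
  by rewrite -[leRHS]adde0; apply: leeD; [exact: z2|exact: z3].
move=> A mA.
have npA : np A = 0%E.
  by apply/eqP; rewrite -measure_le0 -npT; apply: le_measure; rewrite ?inE.
have := jordan A mA; rewrite npA adde0 => <-.
by rewrite leeDl.
Qed.

End conclusion.

(** The inequality rho <= mu, applied to a set and to its complement, forces equality
    because the total masses are equal. *)
Theorem theorem1p21 (R : realType) (d : nat) (hd : (1 <= d)%N) (Omega : ambient)
  (rho mu : probability (Rn R d) R)
  (h : Rn R d -> R) (grad_h : Rn R d -> 'rV[R]_d) :
  rho (carrier Omega) = 1%E ->
  mu (carrier Omega) = 1%E ->
  positive_part (charge_diff rho mu) `<< lebesgue_rV d ->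
  W11loc Omega h ->
  is_weak_gradient Omega h grad_h ->
  coulomb_potential Omega rho mu h ->
  {ae positive_part (charge_diff rho mu), forall x, grad_h x = 0} ->
  forall A : set (Rn R d), measurable A -> rho A = mu A.
Proof.
move=> rhoC _ dom ih wg cp aeg A mA.
have le := positive_part_null hd rhoC dom ih wg cp aeg.
apply/eqP; rewrite eq_le le//=.
have := le _ (measurableC mA); rewrite !probability_setC//.
have fr : rho A \is a fin_num by rewrite fin_num_measure.
have fm : mu A \is a fin_num by rewrite fin_num_measure.
rewrite -(fineK fr) -(fineK fm) -!EFinB !lee_fin; lra.
Qed.
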